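(* Let $\pi$ be a set of primes, let $G$ be a finite $\pi$-separable group, and let $N$ be a normal subgroup of $G$. Suppose there exists $\zeta \in \mathrm{I}_{\pi}(G)$ such that $\xi = \zeta_N \in \mathrm{I}_\pi(N)$. Then the map $\kappa \mapsto \kappa\zeta$ is a bijection from $\mathrm{I}_{\pi}(G/N)$ to $\mathrm{I}_\pi(G \mid \xi)$.
   Context: Let $G$ be a finite $\pi$-separable group (one having a normal series each of whose factors is a $\pi$-group or a $\pi'$-group). Let $G^o$ be the set of $\pi$-elements of $G$ (elements whose order is divisible only by primes in $\pi$). For a complex character $\chi$ of $G$, $\chi^o$ denotes the restriction of $\chi$ to $G^o$. A $\pi$-partial character of $G$ is a function on $G^o$ of the form $\chi^o$ for some character $\chi$ of $G$. A $\pi$-partial character is irreducible if it cannot be written as a sum of two $\pi$-partial characters; $\mathrm{I}_\pi(G)$ is the set of irreducible $\pi$-partial characters of $G$. (It is known that $\mathrm{I}_\pi(G)$ is a basis of the space of complex class functions on $G^o$; a partial character $\eta\in \mathrm{I}_\pi(G)$ is a constituent of a $\pi$-partial character if it appears with nonzero coefficient when the latter is written in this basis.) For $N\trianglelefteq G$ and a $\pi$-partial character $\zeta$ of $G$, $\zeta_N$ is the restriction of $\zeta$ to $N^o$. For $\eta\in \mathrm{I}_\pi(N)$, $\mathrm{I}_\pi(G\mid\eta)$ is the set of those partial characters in $\mathrm{I}_\pi(G)$ whose restriction to $N$ has $\eta$ as a constituent. Partial characters of $G/N$ are viewed as partial characters of $G$ by inflation, so $(\kappa\zeta)(g)=\kappa(gN)\zeta(g)$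 for $g\in G^o$. *)

(* Defs.v *)
From HB Require Import structures.
From mathcomp Require Import classical_sets functions cardinality fsbigop.
From mathcomp Require Import all_boot all_order all_algebra.
From mathcomp Require Import all_fingroup all_solvable all_field all_character.

Set Implicit Arguments.
Unset Strict Implicit.
Unset Printing Implicit Defensive.

Import GroupScope GRing.Theory Num.Theory.
Local Open Scope ring_scope.

(* A set of primes is given as a nat_pred pi; only the primes in pi matter.   *)

Definition pi_factor (gT : finGroupType) (pi : nat_pred) (A H K : {set gT}) :=
  invariant_factor A H K && (pi.-group (K / H) || pi^'.-group (K / H)).

Definition pi_separable (gT : finGroupType) (pi : nat_pred) (G : {group gT}) :=
  exists2 s : seq {group gT},
    (pi_factor pi G).-series 1%G s & last 1%G s = G.

Section PartialCharacters.

Variables (gT : finGroupType) (pi : nat_pred).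

Definition pi_elements (G : {group gT}) : {set gT} :=
  [set x in G | pi.-elt x].

(* A complex class function on G^o = pi_elements G is encoded by its extension
   by 0 to a class function of G, so that chi^o is the product of chi with the
   indicator function of G^o. With this encoding 'Res[N] is the restriction
   from G^o to N^o. *)
Definition cfpi (G : {group gT}) (chi : 'CF(G)) : 'CF(G) :=
  chi * '1_(pi_elements G).

Lemma cfpiE (G : {group gT}) (chi : 'CF(G)) (x : gT) :
  cfpi chi x = if x \in pi_elements G then chi x else 0.
Proof.
have EGo: (x \in G) && (x ^: G \subset pi_elements G) = (x \in pi_elements G).
  apply/andP/idP => [[Gx /subsetP-> //]|]; first exact: class_refl.
  rewrite inE => /andP[Gx pi_x]; split=> //.
  by apply/subsetP=> _ /imsetP[y Gy ->]; rewrite inE groupJ //= p_eltJ.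
rewrite cfunE cfunElock genGid EGo.
by case: ifP; rewrite ?mulr1 ?mulr0.
Qed.

(* The zero class function satisfies the library predicate `character', but is
   not a character in the usual sense. *)
Definition partial_char (G : {group gT}) : set 'CF(G) :=
  fun phi => exists chi : 'CF(G),
    [/\ chi \is a character, chi != 0 & phi = cfpi chi].

Definition Ipi (G : {group gT}) : set 'CF(G) :=
  fun phi => partial_char phi /\
    ~ exists alpha beta : 'CF(G),
        [/\ partial_char alpha, partial_char beta & phi = alpha + beta].

(* Ipi G is finite, as each of its elements is cfpi of an irreducible
   character, so the finitely supported sum below is a genuine sum over all of
   Ipi G. The scalars can be taken in algC because all partial characters have
   values in algC. *)
Definition Ipi_constt (G : {group gT}) (eta phi : 'CF(G)) : Prop :=
  Ipi eta /\
  exists2 c : 'CF(G) -> algC,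
    phi = \sum_(theta \in @Ipi G) c theta *: theta & c eta != 0.

Definition Ipi_over (G N : {group gT}) (eta : 'CF(N)) : set 'CF(G) :=
  fun phi => Ipi phi /\ Ipi_constt eta ('Res[N] phi).

End PartialCharacters.

Arguments pi_elements {gT} pi G.
Arguments cfpi {gT} pi {G} chi.
Arguments partial_char {gT} pi G phi.
Arguments Ipi {gT} pi G phi.
Arguments Ipi_constt {gT} pi {G} eta phi.
Arguments Ipi_over {gT} pi G {N} eta phi.

(* Main.v *)
Require Import Defs.
From HB Require Import structures.
From mathcomp Require Import boolp classical_sets functions cardinality fsbigop.
From mathcomp Require Import all_boot all_order all_algebra.
From mathcomp Require Import all_fingroup all_solvable all_field all_character.

Set Implicit Arguments.
Unset Strict Implicit.
Unset Printing Implicit Defensive.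

Import Order.TTheory GroupScope GRing.Theory Num.Theory.
Local Open Scope ring_scope.

(* Irreducible pi-partial characters of a pi-separable group are separated by
   Hall pi-subgroups: every xi in Ipi pi N invariant in G is induced from an
   irreducible character gamma of a subgroup W of N that is stabilised by a
   subgroup S with S N = G and whose restriction to a Hall pi-subgroup H of W is
   irreducible and has scalar product 1 with xi and 0 with the other members of
   Ipi pi N (a nucleus of xi). It is built along a chain of normal subgroups
   M < N with N / M a pi-group or a pi'-group: given a nucleus (S, W, gamma) of a
   constituent theta of the restriction of xi to M, in the stabiliser of theta,
   the new character lies over gamma in S :&: N, and when N / M is a pi'-group it
   is the extension of gamma whose determinantal order is a pi-number. That every
   member of Ipi pi N arises so follows from a count of classes in cosets of M.

   Hence Ipi pi G is linearly independent, so that multiplicities make sense, and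
   for M <| G the multiplicities of restriction and induction agree when G / M is
   a pi-group, while restrictions are multiplicity-free orbit sums when G / M is
   a pi'-group. The theorem follows by induction on G through a proper normal
   subgroup K >= N with G / K a pi-group or a pi'-group. If mu in Ipi pi (K / N) lies under kappa with
   multiplicity c, any constituent of kappa * zeta contains mu * zeta_K at least
   c times, by reciprocity or by conjugacy, while kappa * zeta itself contains it
   exactly c times; so kappa * zeta is irreducible. *)

(** That [Ipi] is a basis is not taken for granted. Irreducibility is mere indecomposability, which
    by itself bounds no summand from below. Pairings with characters of pi-subgroups supply the
    bound: on a pi-group the cut-off to pi-elements changes nothing, so a partial character pairs
    with a character to a natural number, and every summand that pairs nontrivially uses up a whole
    unit. The obstacle is that a Hall pi-subgroup is not normalised by the group acting on [N], so
    invariance cannot be carried along by a character of [H]. This is why a nucleus keeps [gamma] on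
    [W], which [S] normalises, and admits every Hall pi-subgroup of [W]. The ambient group is
    separate from [N] because passing from [M] to [N] uses a group [S] reaching beyond [N], inside
    the stabiliser of [theta] in [G]. The extension of [gamma] across a pi'-quotient needs two
    coprimality conditions: the determinantal order is part of the data, while the degree is a
    pi-number because [gamma] stays irreducible on a Hall pi-subgroup. *)

(** * Mackey's formula and restriction to a covering subgroup *)

Lemma sum_mulG_invariant (gT : finGroupType) (G N S : {group gT}) (f : gT -> algC) :
    (S * N)%g = G -> (forall x s, x \in G -> s \in S -> f (x * s)%g = f x) ->
  #|N|%:R * \sum_(x in G) f x = #|G|%:R * \sum_(x in N) f x.
Proof.
move=> defG fS; have sNG: N \subset G by rewrite -defG mulG_subr.
have sSG: S \subset G by rewrite -defG mulG_subl.
have{} defG: (N * S)%g = G.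
  by rewrite -[RHS]invGid -defG invMG.
rewrite !mulr_natl -!sumr_const.
transitivity (\sum_(n in N) \sum_(x in G) f (n * x)%g).
  apply: eq_bigr => n Nn; have Gn := subsetP sNG n Nn.
  rewrite (reindex_inj (mulgI n)) /=.
  by apply: eq_bigl => x; rewrite groupMl.
rewrite exchange_big; apply: eq_bigr => x /=; rewrite -{1}defG => /mulsgP[m s Nm Ss ->].
rewrite [RHS](reindex_inj (mulIg m)) /=.
apply: eq_big => n; first by rewrite groupMr.
by move=> Nn; rewrite mulgA fS // groupM ?(subsetP sNG).
Qed.

(** Mackey's formula with a single double coset: [G] is [S * N], so only the intersection
    contributes. *)
Lemma cfResInd_mul (gT : finGroupType) (G N S W : {group gT}) (phi : 'CF(S)) :
    (S * N)%g = G -> W :=: S :&: N ->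
  'Res[N] ('Ind[G] phi) = 'Ind[N] ('Res[W] phi).
Proof.
move=> defG defW; have sNG: N \subset G by rewrite -defG mulG_subr.
have sSG: S \subset G by rewrite -defG mulG_subl.
have sWS: W \subset S by rewrite defW subsetIl.
have sWN: W \subset N by rewrite defW subsetIr.
apply/cfun_inP=> x Nx; rewrite cfResE // !cfIndE //.
have -> : \sum_(y in N) ('Res[W] phi) (x ^ y)%g = \sum_(y in N) phi (x ^ y)%g.
  apply: eq_bigr => y Ny; have [Wxy | W'xy] := boolP (x ^ y \in W)%g.
    by rewrite cfResE.
  rewrite !cfun0 //; apply: contra W'xy => Sxy.
  by rewrite defW inE Sxy groupJ.
have eqNG: #|N|%:R * \sum_(y in G) phi (x ^ y)%g
             = #|G|%:R * \sum_(y in N) phi (x ^ y)%g.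
  apply: (sum_mulG_invariant (f := fun y => phi (x ^ y)%g) defG).
  by move=> y s _ Ss /=; rewrite conjgM [LHS]cfunJ.
have eqSN: #|S|%:R * #|N|%:R = #|G|%:R * #|W|%:R :> algC.
  by rewrite -!natrM mul_cardG defG -defW.
have nzC (K : {group gT}) : #|K|%:R != 0 :> algC by apply: neq0CG.
rewrite -[\sum_(y in G) _](mulKf (nzC N)) eqNG !mulrA; congr (_ * _).
apply: (mulIf (nzC W)); rewrite mulVf // -!mulrA -eqSN mulrA -invfM.
by rewrite mulVf // mulf_neq0.
Qed.

Lemma char_cfdot_nat (gT : finGroupType) (G : {group gT}) (phi : 'CF(G)) :
  (forall i, '[phi, 'chi_i] \in Num.nat) -> phi \is a character.
Proof.
move=> Nphi; rewrite [phi]cfun_sum_cfdot; apply: rpred_sum => i _.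
by rewrite rpredZ_nat ?irr_char.
Qed.

(** By reciprocity the multiplicity of ['chi_i] in ['Res[H] ('Ind[G] 'chi_i)] is the norm of a
    nonzero character, hence at least 1, and one copy can be removed. *)
Lemma cfResInd_sub_char (gT : finGroupType) (G H : {group gT}) (psi : 'CF(H)) :
    H \subset G -> psi \is a character ->
  'Res[H] ('Ind[G] psi) - psi \is a character.
Proof.
move=> sHG /char_sum_irr[r ->].
rewrite ['Ind[G] _]linear_sum ['Res[H] _]linear_sum -sumrB.
apply: rpred_sum => i _; apply: char_cfdot_nat => j.
have Nij: '['Res[H] ('Ind[G] 'chi_i), 'chi_j] \in Num.nat.
  by rewrite Cnat_cfdot_char ?cfRes_char ?cfInd_char ?irr_char.
rewrite cfdotBl cfdot_irr; case: eqVneq Nij => [<- | _ Nij]; last by rewrite subr0.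
case/natrP=> n Dn; rewrite Dn.
case: n Dn => [|n] Dn; last by rewrite -natr1 addrK natr_nat.
have /eqP := Dn; rewrite cfdot_Res_l cfnorm_eq0 => /idPn[].
exact: Ind_irr_neq0.
Qed.

(** Positive weights and termwise inequalities leave no slack once the totals agree. In use, [e]
    consists of multiplicities and [a] of scalar products of restrictions. *)
Lemma sum_delta_inj (T : eqType) (r : seq T) (e : T -> algC) (a : T -> T -> algC) :
    {in r, forall i, 0 < e i} -> {in r &, forall i j, (i == j)%:R <= a i j} ->
    \sum_(i <- r) \sum_(j <- r) e i * e j * a i j
      = \sum_(i <- r) \sum_(j <- r) e i * e j * (i == j)%:R ->
  {in r &, forall i j, a i j = (i == j)%:R}.
Proof.
move=> e_gt0 le_a /eqP; rewrite -subr_eq0 -sumrB => /eqP eq0 i j ri rj.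
pose d i j := e i * e j * (a i j - (i == j)%:R).
have d_ge0 k l : k \in r -> l \in r -> 0 <= d k l.
  by move=> rk rl; rewrite /d mulr_ge0 ?subr_ge0 ?le_a // mulr_ge0 // ltW ?e_gt0.
have rowd_ge0 k : k \in r -> 0 <= \sum_(l <- r) d k l.
  by move=> rk; rewrite big_seq sumr_ge0 // => l rl; rewrite d_ge0.
have: \sum_(k <- r) \sum_(l <- r) d k l == 0.
  apply/eqP; rewrite -[RHS]eq0; apply: eq_bigr => k _; rewrite -sumrB.
  by apply: eq_bigr => l _; rewrite /d mulrBr.
rewrite big_seq psumr_eq0 // => /allP/(_ i ri); rewrite ri /=.
rewrite big_seq psumr_eq0 => [/allP/(_ j rj)|l rl]; last exact: d_ge0.
by rewrite rj /= /d !mulf_eq0 !(gt_eqF (e_gt0 _ _)) //= subr_eq0 => /eqP.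
Qed.

Section RestrictToCover.

Variables (gT : finGroupType) (S W H H0 : {group gT}) (gamma : 'CF(W)).
Hypotheses (nsWS : W <| S) (defS : (W * H)%g = S) (defH0 : H0 :=: W :&: H).
Hypotheses (IgammaS : S \subset 'I[gamma]) (irr_gamma : gamma \in irr W).
Hypothesis irr_gammaH0 : 'Res[H0] gamma \in irr H0.

(* Both sides are expansions of the norm of Ind gamma, computed in S and, by
   Mackey, in H; every term can only grow under restriction. *)
Lemma cfdot_Res_cover :
  {in irr_constt ('Ind[S] gamma) &, forall i j,
    '['Res[H] 'chi_i, 'Res[H] 'chi_j] = (i == j)%:R}.
Proof.
set I := irr_constt _.
have sHS: H \subset S by rewrite -defS mulG_subr.
have sWS := normal_sub nsWS.
have sH0W: H0 \subset W by rewrite defH0 subsetIl.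
have sH0H: H0 \subset H by rewrite defH0 subsetIr.
have nsH0H: H0 <| H.
  by rewrite defH0 setIC (normalGI sHS).
have Ngamma := irrWchar irr_gamma.
pose e (i : Iirr S) := '['Ind[S] gamma, 'chi_i].
pose a (i j : Iirr S) := '['Res[H] 'chi_i, 'Res[H] 'chi_j].
have Ne i : e i \in Num.nat by rewrite Cnat_cfdot_char_irr ?cfInd_char.
have defInd : 'Ind[S] gamma = \sum_(i <- enum I) e i *: 'chi_i.
  by rewrite big_enum -cfun_sum_constt.
have: {in enum I &, forall i j, a i j = (i == j)%:R}.
  apply: (sum_delta_inj (e := e) (a := a)) => [i|i j _ _|].
  - by rewrite mem_enum => Ii; rewrite natr_gt0.
  - have := Cnat_cfdot_char (cfRes_char H (irr_char i)) (cfRes_char H (irr_char j)).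
    rewrite -/(a i j) => /natrP[n Da]; rewrite Da ler_nat.
    have [Dij|//] := eqVneq; rewrite -(ltr_nat algC) -Da /a Dij cfnorm_gt0.
    exact: Res_irr_neq0.
  have ->: \sum_(i <- enum I) \sum_(j <- enum I) e i * e j * (i == j)%:R = '['Ind[S] gamma].
    rewrite defInd cfdot_suml; apply: eq_bigr => i _; rewrite cfdot_sumr.
    by apply: eq_bigr => j _; rewrite cfdotZl cfdotZr cfdot_irr conj_natr ?Ne // -mulrA.
  have ->: \sum_(i <- enum I) \sum_(j <- enum I) e i * e j * a i j
             = '['Res[H] ('Ind[S] gamma)].
    rewrite defInd linear_sum cfdot_suml; apply: eq_bigr => i _; rewrite cfdot_sumr.
    by apply: eq_bigr => j _; rewrite !linearZ cfdotZl cfdotZr conj_natr ?Ne // -mulrA.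
  (* Both [gamma] and its restriction to [H0] are invariant irreducibles, so the two norms are the
     indices of [W] in [S] and of [H0] in [H]; these agree because [S] is [W * H]. *)
  rewrite (cfResInd_mul _ defS defH0) -!cfdot_Res_l !cfRes_Ind_invariant //.
    rewrite !cfdotZl !irrWnorm // !mulr1; congr _%:R.
    apply/eqP; rewrite -(eqn_pmul2l (cardG_gt0 H0)) Lagrange //.
    rewrite -(eqn_pmul2l (cardG_gt0 W)) mulnCA Lagrange // mul_cardG defS defH0.
    by rewrite mulnC.
  apply/subsetP=> y Hy; have Sy := subsetP sHS y Hy.
  rewrite inE (subsetP (normal_norm nsH0H)) //; apply/eqP.
  rewrite cfConjgRes_norm ?(subsetP (normal_norm nsH0H)) ?(subsetP (normal_norm nsWS)) //.
  by rewrite inertiaJ ?(subsetP IgammaS).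
by move=> aE i j Ii Ij; apply: aE; rewrite mem_enum.
Qed.

End RestrictToCover.

(** * Extension of invariant characters *)

Section Intertwiners.

Variables (gT : finGroupType) (N : {group gT}) (n : nat).
Variable rN : mx_representation algC N n.
Hypothesis irrN : mx_irreducible rN.

(** A candidate for the value at [y] of a representation extending [rN]. The inverse of [y] in the
    exponent makes the relation multiplicative in the natural order. *)
Definition intertwines (y : gT) (A : 'M[algC]_n) :=
  A \in unitmx /\ {in N, forall x, A *m rN x = rN (x ^ y^-1)%g *m A}.

Lemma intertwines_exists y :
    y \in 'N(N) -> (cfRepr rN ^ y)%CF = cfRepr rN ->
  exists A, intertwines y A.
Proof.
move=> nNy eq_y.
have conj_repr : mx_repr N (fun x => rN (x ^ y^-1)%g).
  split=> [|x z Nx Nz]; first by rewrite conj1g repr_mx1.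
  by rewrite conjMg repr_mxM // memJ_norm ?groupV.
have [] := @cfRepr_rsimP _ _ _ _ rN (MxRepresentation conj_repr) _.
  apply/eqP; rewrite -eq_y; apply/cfun_inP=> x Nx.
  by rewrite cfConjgE // !cfunE Nx memJ_norm ?groupV ?Nx.
move=> B _; rewrite row_free_unit => uB simB.
exists (invmx B); split=> [|x Nx]; first by rewrite unitmx_inv.
apply: (can_inj (mulKmx uB)); rewrite mulKVmx //.
by apply: (can_inj (mulmxK uB)); rewrite simB //= mulmxA mulmxKV.
Qed.

Lemma intertwines_scalar A B y :
    intertwines y A -> intertwines y B ->
  exists2 c : algC, c != 0 & A = c *: B.
Proof.
move=> [uA wA] [uB wB].
have n_gt0: (0 < n)%N by case/mx_irrP: irrN.
have /(mx_abs_irr_cent_scalar (groupC irrN))/is_scalar_mxP[c Dc] :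
    centgmx rN (invmx B *m A).
  apply/centgmxP=> x Nx; rewrite -mulmxA wA // !mulmxA; congr (_ *m _).
  apply: (can_inj (mulmxK uB)); rewrite -mulmxA -wB // mulKmx //.
  by rewrite mulmxKV.
have DA: A = c *: B by rewrite -mul_mx_scalar -Dc mulKVmx.
exists c => //; apply: contraTneq uA => c0.
rewrite DA c0 scale0r unitmxE unitfE -(prednK n_gt0) det0 ?eqxx //.
Qed.

Lemma intertwinesM y z A B :
    y \in 'N(N) -> z \in 'N(N) ->
    intertwines y A -> intertwines z B -> intertwines (y * z) (A *m B).
Proof.
move=> nNy nNz [uA wA] [uB wB]; split=> [|x Nx]; first by rewrite unitmx_mul uA.
rewrite -mulmxA wB // mulmxA wA ?memJ_norm ?groupV // mulmxA.
by rewrite invMg conjgM.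
Qed.

Lemma intertwines_repr x : x \in N -> intertwines x (rN x).
Proof.
move=> Nx; split=> [|z Nz]; first exact: repr_mx_unit.
by rewrite -!repr_mxM ?groupJ ?groupV // conjgE invgK -!mulgA mulVg mulg1.
Qed.

End Intertwiners.

Lemma cfRepr_extension (gT : finGroupType) (G N : {group gT}) n
    (rN : mx_representation algC N n) (rG : mx_representation algC G n) :
    N \subset G -> cfRepr rN \in irr N -> {in N, rG =1 rN} ->
  exists2 chi, chi \in irr G & 'Res[N] chi = cfRepr rN.
Proof.
move=> sNG irr_N eqNG; exists (cfRepr rG).
  apply: (@cfRes_irr_irr _ G N); first exact: cfRepr_char.
  rewrite (_ : 'Res _ = cfRepr rN) //; apply/cfun_inP=> x Nx.
  by rewrite cfResE // !cfunE Nx (subsetP sNG) ?eqNG.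
by apply/cfun_inP=> x Nx; rewrite cfResE // !cfunE Nx (subsetP sNG) ?eqNG.
Qed.

Section CyclicExtension.

Variables (gT : finGroupType) (G N : {group gT}) (y : gT) (gamma : 'CF(N)).
Hypotheses (nsNG : N <| G) (defG : (N * <[y]>)%g = G).
Hypotheses (irr_gamma : gamma \in irr N) (Igamma : G \subset 'I[gamma]).

(** With [m] the order of [y] modulo [N], an intertwiner [A] for [y] is rescaled until its [m]-th
    power is [rN (y ^+ m)]; then sending [x * y ^+ i] to [rN x *m A ^+ i] is a representation. *)
Lemma cyclic_invariant_irr_extendible :
  exists2 chi, chi \in irr G & 'Res[N] chi = gamma.
Proof.
have [[n rN] /= irrN Dgamma] := irr_reprP irr_gamma.
case: n rN irrN Dgamma => [|n] rN irrN Dgamma; first by case/mx_irrP: irrN.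
have [sNG nNG] := andP nsNG.
have Gy : y \in G by rewrite -defG (subsetP (mulG_subr _ _)) ?cycle_id.
have nNy := subsetP nNG y Gy.
have [A0 wA0] : exists A, intertwines rN y A.
  apply: intertwines_exists => //; rewrite -Dgamma inertiaJ //.
  exact: (subsetP Igamma).
pose m := #[coset N y]; have m_gt0 : (0 < m)%N by apply: order_gt0.
have NyX k : (y ^+ k \in N)%g = (m %| k)%N.
  rewrite order_dvdn -morphX //; apply/idP/eqP => [/coset_id // | yk1].
  by rewrite coset_idr // groupX.
have wX A k : intertwines rN y A -> intertwines rN (y ^+ k) (A ^+ k).
  move=> wA; elim: k => [|k IHk].
    by rewrite expg0 expr0 -[1]/(1%:M) -(repr_mx1 rN); apply: intertwines_repr.
  by rewrite expgS exprS; apply: intertwinesM; rewrite ?groupX.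
have Nz : (y ^+ m \in N)%g by rewrite NyX.
have [c nz_c Dc] := intertwines_scalar irrN (wX _ m wA0) (intertwines_repr rN Nz).
(* [c] is the Schur scalar between [A0 ^+ m] and [rN (y ^+ m)]; dividing [A0] by an [m]-th root of
   it makes them equal. *)
pose b := m.-root c; have Db : b ^+ m = c by rewrite rootCK.
have nz_b : b != 0 by apply: contraNneq nz_c => b0; rewrite -Db b0 expr0n gtn_eqF.
pose A := b^-1 *: A0; have Am : A ^+ m = rN (y ^+ m)%g.
  by rewrite exprZn Dc exprVn Db scalerA mulVf // scale1r.
have wA : intertwines rN y A.
  have [uA wA] := wA0; split; first by rewrite unitmxZ ?unitfE ?invr_eq0.
  by move=> x Nx; rewrite -scalemxAl wA // scalemxAr.
have Amk k : A ^+ (m * k) = rN (y ^+ (m * k))%g.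
  by rewrite exprM Am expgM [RHS]repr_mxX.
(* Two expressions of one element differ by a power of [y] lying in [N]; its exponent is a multiple
   of [m], where [A] and [rN] agree. *)
have A_wd x1 i1 x2 i2 : x1 \in N -> x2 \in N ->
    (x1 * y ^+ i1 = x2 * y ^+ i2)%g -> rN x1 *m A ^+ i1 = rN x2 *m A ^+ i2.
  wlog le_i : x1 i1 x2 i2 / (i1 <= i2)%N.
    move=> IH N1 N2 eq12; have [le12 | /ltnW le21] := leqP i1 i2; first exact: IH.
    by apply/esym/IH.
  move=> N1 N2; rewrite -(subnK le_i) expgD exprD mulgA => /mulIg Dx1.
  have: (y ^+ (i2 - i1) \in N)%g by rewrite -(groupMl _ N2) -Dx1.
  rewrite NyX => /dvdnP[k Dk]; rewrite Dk mulnC Amk in Dx1 *.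
  by rewrite mulmxA -repr_mxM // ?NyX ?dvdn_mulr // -Dx1.
have decG g : g \in G -> exists i : 'I_#[y], (g * y ^- i \in N)%g.
  rewrite -defG => /mulsgP[x _ Nx /cyclePmin[i lt_i ->] ->].
  by exists (Ordinal lt_i); rewrite /= mulgK.
pose ex g := odflt (Ordinal (order_gt0 y)) [pick i : 'I_#[y] | g * y ^- i \in N]%g.
have NexG g : g \in G -> (g * y ^- ex g \in N)%g.
  by rewrite /ex => /decG[i Ni]; case: pickP => [//|/(_ i)/idP].
pose R g := rN (g * y ^- ex g)%g *m A ^+ ex g.
have RE x i : x \in N -> R (x * y ^+ i)%g = rN x *m A ^+ i.
  move=> Nx; have Gxy : (x * y ^+ i)%g \in G by rewrite groupM ?groupX // (subsetP sNG).
  by apply: A_wd; rewrite ?NexG // mulgKV.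
have RX i : {in N, forall x, A ^+ i *m rN x = rN (x ^ y ^- i)%g *m A ^+ i}.
  by case: (wX _ i wA).
have repR : mx_repr G R.
  split=> [|g h Gg Gh].
    by have /= := RE _ 0%N (group1 N); rewrite mulg1 expr0 repr_mx1 mulmx1.
  have [Ng Nh] := (NexG g Gg, NexG h Gh).
  have mulXY u v i j : (u * y ^+ i * (v * y ^+ j) = u * v ^ y ^- i * y ^+ (i + j))%g.
    by rewrite expgD conjgE invgK !mulgA mulgKV.
  have Dgh := mulXY (g * y ^- ex g)%g (h * y ^- ex h)%g (ex g) (ex h).
  rewrite !mulgKV in Dgh; have nNyi : (y ^- ex g \in 'N(N))%g by rewrite groupV groupX.
  have NhJ : ((h * y ^- ex h) ^ y ^- ex g \in N)%g by rewrite memJ_norm.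
  have /= rNM := repr_mxM rN Ng NhJ.
  rewrite Dgh RE; last exact: groupM Ng NhJ.
  rewrite rNM exprD /R -mulmxE.
  by rewrite !mulmxA; congr (_ *m _); rewrite -!mulmxA RX.
rewrite Dgamma; apply: (@cfRepr_extension _ _ _ _ rN (MxRepresentation repR)) => //.
  by rewrite -[cfRepr _]Dgamma.
by move=> x Nx; have /= := RE _ 0%N Nx; rewrite mulg1 expr0 mulmx1.
Qed.

End CyclicExtension.

Section CoprimeExtension.

Variables (gT : finGroupType) (G N : {group gT}) (gamma : 'CF(N)).
Hypotheses (nsNG : N <| G) (irr_gamma : gamma \in irr N).
Hypothesis Igamma : G \subset 'I[gamma].
Hypothesis co_deg : coprime #|G : N| (Num.truncn (gamma 1%g)).
Hypothesis co_det : coprime #|G : N| #[cfDet gamma]%CF.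

(* An intertwining family A is a projective representation of G, whose cocycle
   c lives on G / N. Taking determinants trivialises the power of c of exponent
   the degree times the determinantal order; taking products over G / N
   trivialises the power of exponent the index. Hence c itself is trivial. *)
Lemma coprime_invariant_irr_extendible :
  exists2 chi, chi \in irr G & 'Res[N] chi = gamma.
Proof.
have [[n rN] /= irrN Dgamma] := irr_reprP irr_gamma.
have n_gt0 : (0 < n)%N by case/mx_irrP: irrN.
have [sNG nNG] := andP nsNG; have nN g := subsetP nNG g.
pose o := #[cfDet gamma]%CF; pose q := #|G : N|.
have co_q : coprime (n * o) q.
  rewrite coprime_sym coprimeMr co_det andbT.
  by move: co_deg; rewrite Dgamma cfRepr1 natrK.
have /fin_all_exists[B wB] y : exists A, y \in G -> intertwines rN y A.
  have [Gy | G'y] := boolP (y \in G); last by exists 0.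
  have [|A wA] := intertwines_exists (nN y Gy) (rN := rN); last by exists A.
  by rewrite -Dgamma inertiaJ ?(subsetP Igamma).
pose B1 y := if y == 1%g then 1%:M else B y.
have wB1 y : y \in G -> intertwines rN y (B1 y).
  rewrite /B1; case: eqP => [-> _ | _ Gy]; last exact: wB.
  by rewrite -(repr_mx1 rN); apply: intertwines_repr.
(* Intertwiners are chosen only at representatives of cosets of [N], with the identity at 1. Hence
   [A] agrees with [rN] on [N] and is compatible with left multiplication by [N], which is why the
   cocycle depends only on cosets. *)
pose t g := repr (N :* g); pose A g := rN (g * (t g)^-1)%g *m B1 (t g).
have tP g : (g * (t g)^-1 \in N)%g.
  by rewrite -mem_rcoset rcoset_sym mem_repr_rcoset.
have Gt g : g \in G -> t g \in G.
  by move=> Gg; rewrite -(groupMl _ (subsetP sNG _ (tP g))) mulgKV.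
have wA g : g \in G -> intertwines rN g (A g).
  move=> Gg; rewrite -[X in intertwines _ X](mulgKV (t g) g).
  apply: intertwinesM (intertwines_repr _ (tP g)) (wB1 _ (Gt _ Gg)).
    exact/nN/(subsetP sNG).
  exact/nN/Gt.
have A_l x g : x \in N -> A (x * g)%g = rN x *m A g.
  move=> Nx; rewrite /A (_ : t (x * g) = t g)%g; last first.
    by congr repr; apply/rcoset_eqP; rewrite mem_rcoset mulgK.
  have /= rNM := repr_mxM rN Nx (tP g).
  by rewrite -mulgA rNM mulmxA.
have A_N x : x \in N -> A x = rN x.
  move=> Nx; rewrite /A (_ : t x = 1)%g; last by rewrite /t rcoset_id // repr_group.
  by rewrite invg1 mulg1 /B1 eqxx mulmx1.
have A_unit g : g \in G -> A g \in unitmx by case/wA.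
have A_inj g a b : g \in G -> a *: A g = b *: A g -> a = b.
  move=> Gg /(congr1 (mulmxr (invmx (A g)))); rewrite /= -!scalemxAl mulmxV ?A_unit //.
  by move/matrixP/(_ (Ordinal n_gt0) (Ordinal n_gt0)); rewrite !mxE eqxx !mulr1.
have /fin_all_exists[c' Dc'] (p : gT * gT) : exists c, p.1 \in G -> p.2 \in G ->
    c != 0 /\ A p.1 *m A p.2 = c *: A (p.1 * p.2)%g.
  case: p => g h /=; have [Gg | G'g] := boolP (g \in G); last by exists 0.
  have [Gh | G'h] := boolP (h \in G); last by exists 0.
  have wgh := intertwinesM (nN g Gg) (nN h Gh) (wA g Gg) (wA h Gh).
  by have [c nz_c Dc] := intertwines_scalar irrN wgh (wA _ (groupM Gg Gh)); exists c.
pose c g h := c' (g, h).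
have Dc g h : g \in G -> h \in G -> A g *m A h = c g h *: A (g * h)%g.
  by move=> Gg Gh; have [] := Dc' (g, h) Gg Gh.
have nz_c g h : g \in G -> h \in G -> c g h != 0.
  by move=> Gg Gh; have [] := Dc' (g, h) Gg Gh.
have c_coc g h k : g \in G -> h \in G -> k \in G ->
    c g h * c (g * h)%g k = c g (h * k)%g * c h k.
  move=> Gg Gh Gk; apply: (A_inj (g * h * k)%g); first by rewrite !groupM.
  rewrite -scalerA -Dc ?groupM // scalemxAl -Dc // -mulmxA Dc // -scalemxAr.
  by rewrite Dc ?groupM // scalerA mulgA mulrC.
have c_r g h x : g \in G -> h \in G -> x \in N -> c g (x * h)%g = c g h.
  move=> Gg Gh Nx; have Gx := subsetP sNG x Nx.
  apply: (A_inj (g * (x * h))%g); rewrite ?groupM // -Dc ?groupM // A_l // mulmxA.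
  have [_ ->] := wA g Gg; rewrite // -mulmxA Dc // -scalemxAr -A_l.
    by rewrite conjgE invgK -!mulgA mulKg.
  by rewrite memJ_norm ?groupV ?nN.
have c_1 x h : x \in N -> h \in G -> c x h = 1.
  move=> Nx Gh; have Gx := subsetP sNG x Nx; apply: (A_inj (x * h)%g); rewrite ?groupM //.
  by rewrite -Dc // A_N // scale1r A_l.
pose E g := \det (A g) ^+ o; pose F g := \prod_(u in (G / N)%g) c g (repr u).
have nz_E g : g \in G -> E g != 0.
  by move=> Gg; rewrite expf_neq0 // -unitfE -unitmxE A_unit.
have Gr (u : coset_of N) : u \in (G / N)%g -> repr u \in G.
  case/morphimP=> g nNg Gg ->; have := mem_repr_coset (coset N g).
  by rewrite val_coset // => /rcosetP[x Nx ->]; rewrite groupM // (subsetP sNG).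
have nz_F g : g \in G -> F g != 0.
  by move=> Gg; apply/prodf_neq0 => u Gu; rewrite nz_c ?Gr.
have cE g h : g \in G -> h \in G -> c g h ^+ (n * o) * E (g * h)%g = E g * E h.
  move=> Gg Gh; rewrite /E -exprMn -det_mulmx Dc // detZ exprMn.
  by rewrite exprM.
have cF g h : g \in G -> h \in G -> c g h ^+ q * F (g * h)%g = F g * F h.
  move=> Gg Gh; rewrite /q -card_quotient // -prodr_const -big_split /=.
  transitivity (\prod_(u in (G / N)%g) (c g (h * repr u)%g * c h (repr u))).
    by apply: eq_bigr => u Gu; rewrite c_coc ?Gr.
  rewrite big_split; congr (_ * _); rewrite [RHS](reindex_inj (mulgI (coset N h))) /=.
  apply: eq_big => u; first by rewrite groupMl // mem_morphim ?nN.
  move=> Gu; have Gru := Gr u Gu.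
  have Guu : (coset N h * u)%g \in (G / N)%g by rewrite groupM // mem_morphim ?nN.
  have: coset N (h * repr u) = coset N (repr (coset N h * u)%g).
    by rewrite [RHS]coset_reprK morphM ?nN //; congr (_ * _)%g; apply: coset_reprK.
  move/(rcoset_kercosetP (nN _ (groupM Gh Gru)) (nN _ (Gr _ Guu))).
  by case/rcosetP=> x Nx ->; rewrite c_r // Gr.
have E_N x : x \in N -> E x = 1.
  move=> Nx; rewrite /E A_N // -(_ : cfDet gamma x = \det (rN x)).
    by rewrite -exp_cfunE // exp_cforder cfun1E Nx.
  by rewrite Dgamma cfDetRepr cfunE Nx trace_mx11 mxE mulr1n.
have F_N x : x \in N -> F x = 1.
  by move=> Nx; rewrite /F big1 // => u Gu; rewrite c_1 ?Gr.
clearbody E F c; have no_gt0 : (0 < n * o)%N by rewrite muln_gt0 n_gt0 cforder_lin_char_gt0 ?cfDet_lin_char.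
have [a b Dab _] := egcdnP q no_gt0; rewrite (eqP co_q) in Dab.
(* By Bezout [a * (n * o)] exceeds [b * q] by one, so in this quotient all powers of the cocycle
   cancel but the first. *)
pose mu g := E g ^+ a / F g ^+ b.
have nz_mu g : g \in G -> mu g != 0.
  by move=> Gg; apply: mulf_neq0; rewrite ?invr_eq0 expf_neq0 ?nz_E ?nz_F.
have mu_c g h : g \in G -> h \in G -> c g h * mu (g * h)%g = mu g * mu h.
  move=> Gg Gh; have Ggh := groupM Gg Gh.
  rewrite /mu [RHS]mulrACA -invfM -!exprMn -cE // -cF // !exprMn -!exprM.
  rewrite [(_ * o * a)%N]mulnC [(q * b)%N]mulnC Dab addn1 exprS.
  rewrite invfM -!mulrA; congr (_ * _).
  by rewrite mulrCA mulVKf ?expf_neq0 ?nz_c.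
have mu_N x : x \in N -> mu x = 1.
  by move=> Nx; rewrite /mu E_N // F_N // !expr1n divr1.
clearbody mu; pose R g := (mu g)^-1 *: A g.
have repR : mx_repr G R.
  split=> [|g h Gg Gh].
    by rewrite /R A_N // repr_mx1 mu_N ?invr1 ?scale1r.
  rewrite /R -scalemxAl -scalemxAr Dc // !scalerA; congr (_ *: _).
  apply: (mulIf (nz_mu _ (groupM Gg Gh))); rewrite mulVf ?nz_mu ?groupM //.
  by rewrite -[RHS]mulrA mu_c // mulrACA !mulVf ?nz_mu // mulr1.
rewrite Dgamma; apply: (@cfRepr_extension _ _ _ _ rN (MxRepresentation repR)) => //.
  by rewrite -[cfRepr _]Dgamma.
by move=> x Nx; rewrite /= /R A_N // mu_N // invr1 scale1r.
Qed.

End CoprimeExtension.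

Section PiExtension.

Variables (gT : finGroupType) (pi : nat_pred) (G N : {group gT}) (gamma : 'CF(N)).
Hypotheses (nsNG : N <| G) (irr_gamma : gamma \in irr N).
Hypothesis pi'G : pi^'.-nat #|G : N|.
Hypothesis pi_deg : pi.-nat (Num.truncn (gamma 1%g)).
Hypothesis pi_det : pi.-nat #[cfDet gamma]%CF.

(** The order of [alpha] divides the pi-number [k] and also the pi'-number [#|G : N|], since [alpha]
    factors through [G / N]. *)
Lemma lin_char_pi_index (alpha : 'CF(G)) k :
    alpha \is a linear_char -> 'Res[N] alpha = 1 -> pi.-nat k -> alpha ^+ k = 1 ->
  alpha = 1.
Proof.
move=> lin_a aN1 pi_k ak1; apply/eqP; rewrite -[alpha]expr1 -dvdn_cforder.
have co_k: coprime k #|G : N| by apply: pnat_coprime pi'G.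
rewrite -(eqP co_k) dvdn_gcd dvdn_cforder ak1 eqxx /=.
have kerN: N \subset cfker alpha.
  by rewrite -subsetIidl -cfker_Res ?lin_charW ?normal_sub // aN1 cfker_cfun1.
rewrite -(cfQuoK nsNG kerN) cforder_mod // -card_quotient ?normal_norm //.
by rewrite cforder_lin_char_dvdG ?cfQuo_lin_char.
Qed.

(** The determinant of the extension given by coprimality may have any order. It is replaced by its
    pi-part, which has the same restriction to [N] because the determinantal order of [gamma] is a
    pi-number. *)
Lemma pi_extension_exists : G \subset 'I[gamma] ->
  exists2 chi, chi \in irr G & 'Res[N] chi = gamma /\ pi.-nat #[cfDet chi]%CF.
Proof.
move=> Igamma.
have co_deg: coprime #|G : N| (Num.truncn (gamma 1%g)).
  by rewrite coprime_sym (pnat_coprime pi_deg).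
have co_det: coprime #|G : N| #[cfDet gamma]%CF.
  by rewrite coprime_sym (pnat_coprime pi_det).
have [chi0 irr_chi0 chi0N] :=
  coprime_invariant_irr_extendible nsNG irr_gamma Igamma co_deg co_det.
have [[c0 Dc0] [s Ds]] := (irrP irr_chi0, irrP irr_gamma).
pose nu := cfDet chi0; have lin_nu : nu \is a linear_char by apply: cfDet_lin_char.
pose n := #[nu]%CF; have n_gt0 : (0 < n)%N by apply: cforder_lin_char_gt0.
(* The exponent is 1 modulo the pi-part of [n] and 0 modulo its pi'-part, so [nu ^+ e] is the
   pi-part of [nu]. *)
pose e := chinese n`_pi n`_pi^' 1 0.
have co_n : coprime n`_pi n`_pi^' by apply: coprime_partC.
have nuN : 'Res[N] nu = cfDet gamma by rewrite -cfDetRes ?irrWchar // chi0N.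
have lin_mu : nu ^+ e \is a linear_char by rewrite rpredX.
have [u Du] := irrP (lin_char_irr lin_mu).
have muN : 'Res[N] (nu ^+ e) = cfDet gamma.
  rewrite rmorphXn /= nuN -[RHS]expr1; apply/eqP.
  rewrite -(expr_mod _ (exp_cforder (cfDet gamma))) -[X in _ == X](expr_mod _ (exp_cforder (cfDet gamma))).
  have dvd_o: (#[cfDet gamma]%CF %| n`_pi)%N.
    rewrite -(part_pnat_id pi_det) partn_dvd // -nuN; exact: cforder_Res.
  by rewrite -(modn_dvdm _ dvd_o) chinese_modl // modn_dvdm.
have [] := @extend_to_cfdet _ G N s c0 u nsNG; rewrite -?Ds -?Dc0 -?Du //.
move=> c [cN det_c] _; exists 'chi_c; first exact: mem_irr.
split=> //; rewrite det_c; apply: pnat_dvd (part_pnat pi n).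
rewrite dvdn_cforder -exprM -dvdn_cforder -/n.
rewrite -{1}(partnC pi n_gt0) mulnC dvdn_pmul2r ?part_gt0 //.
by rewrite /dvdn chinese_modr // mod0n.
Qed.

(** The determinants differ by a linear character of pi-order trivial on [N], hence coincide; as the
    degree is coprime to the index, the determinant fixes the extension. *)
Lemma pi_extension_unique chi1 chi2 :
    chi1 \in irr G -> 'Res[N] chi1 = gamma -> pi.-nat #[cfDet chi1]%CF ->
    chi2 \in irr G -> 'Res[N] chi2 = gamma -> pi.-nat #[cfDet chi2]%CF ->
  chi1 = chi2.
Proof.
move=> /irrP[c1 ->] c1N pi1 /irrP[c2 ->] c2N pi2.
have [s Ds] := irrP irr_gamma.
have lin1 : cfDet 'chi_c1 \is a linear_char := cfDet_lin_char _.
have lin2 : cfDet 'chi_c2 \is a linear_char := cfDet_lin_char _.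
have U2 := lin_char_unitr lin2.
have detN c : 'Res[N] 'chi[G]_c = gamma -> 'Res[N] (cfDet 'chi_c) = cfDet gamma.
  by move=> cN; rewrite -cfDetRes ?irr_char // cN.
have det12 : cfDet 'chi_c1 = cfDet 'chi_c2.
  rewrite -[LHS](divrK U2) (_ : _ / _ = 1) ?mul1r //.
  apply: (@lin_char_pi_index _ (#[cfDet 'chi_c1]%CF * #[cfDet 'chi_c2]%CF)).
  - exact: rpred_div.
  - by rewrite rmorph_div //= !detN // divrr // lin_char_unitr ?cfDet_lin_char.
  - by rewrite pnatM pi1.
  by rewrite expr_div_n exprM exp_cforder expr1n mulnC exprM exp_cforder expr1n divr1.
have co_deg: coprime #|G : N| (Num.truncn ('chi_s 1%g)).
  by rewrite -Ds coprime_sym (pnat_coprime pi_deg).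
have [u Du] := irrP (lin_char_irr lin2).
have [] := @extend_to_cfdet _ G N s c2 u nsNG co_deg.
- by rewrite -Ds.
- by rewrite -Du -Ds detN.
by move=> c _ uniq; rewrite (uniq c1) -?(uniq c2) -?Ds -?Du.
Qed.

End PiExtension.

(** * Partial characters and multiplicities *)

Section PartialCharacterTheory.

Variables (gT : finGroupType) (pi : nat_pred).
Implicit Types (G H K N : {group gT}).

Lemma cfpi_on G (phi : 'CF(G)) : cfpi pi phi \in 'CF(G, pi_elements pi G).
Proof. exact: mul_cfuni_on. Qed.

Lemma cfpi_onE G (phi : 'CF(G)) :
  phi \in 'CF(G, pi_elements pi G) -> cfpi pi phi = phi.
Proof.
move/cfun_on0=> phi0; apply/cfunP=> x; rewrite cfpiE.
by case: ifP => // /negbT/phi0.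
Qed.

Lemma cfpiRes G H (phi : 'CF(G)) :
  H \subset G -> 'Res[H] (cfpi pi phi) = cfpi pi ('Res[H] phi).
Proof.
move=> sHG; apply/cfun_inP=> x Hx; rewrite cfResE // !cfpiE !inE Hx.
by rewrite (subsetP sHG) // cfResE.
Qed.

Lemma cfpiInd G H (phi : 'CF(H)) :
  H \subset G -> 'Ind[G] (cfpi pi phi) = cfpi pi ('Ind[G] phi).
Proof.
move=> sHG; apply/cfun_inP=> x Gx; rewrite cfpiE inE Gx /= !cfIndE //.
case: ifP => [pi_x | pi'x].
  congr (_ * _); apply: eq_bigr => y _; rewrite cfpiE inE p_eltJ pi_x andbT.
  by case: ifP => // /negbT/cfun0.
rewrite big1 ?mulr0 // => y _; rewrite cfpiE inE p_eltJ pi'x andbF //.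
Qed.

Lemma cfpiMl G (phi psi : 'CF(G)) : cfpi pi phi * psi = cfpi pi (phi * psi).
Proof. by rewrite /cfpi mulrAC. Qed.

Lemma cfpi1 G (phi : 'CF(G)) : cfpi pi phi 1%g = phi 1%g.
Proof. by rewrite cfpiE inE group1 p_elt1. Qed.

Lemma cfpi_pgroup G (phi : 'CF(G)) : pi.-group G -> cfpi pi phi = phi.
Proof.
move=> piG; apply/cfun_inP=> x Gx.
by rewrite cfpiE inE Gx (mem_p_elt piG Gx).
Qed.

Lemma pi_elementsJ G x y : y \in 'N(G) -> (x ^ y \in pi_elements pi G)%g = (x \in pi_elements pi G).
Proof. by move=> nGy; rewrite !inE memJ_norm // p_eltJ. Qed.

Lemma cfpiJ G (phi : 'CF(G)) y : (cfpi pi phi ^ y)%CF = cfpi pi (phi ^ y)%CF.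
Proof.
have [nGy | n'Gy] := boolP (y \in 'N(G)); last by rewrite !cfConjgEout.
apply/cfunP=> x; rewrite cfConjgE // !cfpiE cfConjgE //.
by rewrite pi_elementsJ ?groupV.
Qed.

Definition pchar G (f : 'CF(G)) := exists2 chi, chi \is a character & f = cfpi pi chi.

Lemma pchar_cfpi G (chi : 'CF(G)) : chi \is a character -> pchar (cfpi pi chi).
Proof. by exists chi. Qed.

Lemma partial_charE G f : partial_char pi G f <-> pchar f /\ f != 0.
Proof.
split=> [[chi [Nchi nz_chi ->]] | [[chi Nchi ->] nz_f]].
  split; first exact: pchar_cfpi.
  by apply: contraNneq nz_chi => f0; rewrite -char1_eq0 // -cfpi1 f0 cfunE.
by exists chi; split=> //; apply: contraNneq nz_f => ->; rewrite /cfpi mul0r.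
Qed.

Lemma pchar0 G : pchar (0 : 'CF(G)).
Proof. by exists 0; rewrite ?cfun0_char // /cfpi mul0r. Qed.

Lemma pcharD G (f g : 'CF(G)) : pchar f -> pchar g -> pchar (f + g).
Proof.
case=> [chi Nchi ->] [psi Npsi ->]; exists (chi + psi); first exact: rpredD.
by rewrite /cfpi mulrDl.
Qed.

Lemma pchar_sum G (I : Type) (r : seq I) (P : pred I) (F : I -> 'CF(G)) :
  (forall i, P i -> pchar (F i)) -> pchar (\sum_(i <- r | P i) F i).
Proof. by move=> PF; apply: big_ind => //; [apply: pchar0 | apply: pcharD]. Qed.

Lemma pcharMn G (f : 'CF(G)) n : pchar f -> pchar (f *+ n).
Proof.
by move=> Pf; elim: n => [|n IHn]; rewrite ?mulrS; [apply: pchar0 | apply: pcharD].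
Qed.

Lemma pcharZ G (f : 'CF(G)) a : a \in Num.nat -> pchar f -> pchar (a *: f).
Proof. by case/natrP=> n ->; rewrite scaler_nat; apply: pcharMn. Qed.

Lemma pcharRes G H (f : 'CF(G)) : H \subset G -> pchar f -> pchar ('Res[H] f).
Proof.
by move=> sHG [chi Nchi ->]; rewrite cfpiRes //; apply/pchar_cfpi/cfRes_char.
Qed.

Lemma pcharInd G H (f : 'CF(H)) : H \subset G -> pchar f -> pchar ('Ind[G] f).
Proof.
by move=> sHG [chi Nchi ->]; rewrite cfpiInd //; apply/pchar_cfpi/cfInd_char.
Qed.

Lemma pcharJ G (f : 'CF(G)) y : pchar f -> pchar (f ^ y)%CF.
Proof.
by case=> chi Nchi ->; rewrite cfpiJ; apply/pchar_cfpi; apply: cfConjg_char.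
Qed.

Lemma pchar_on G (f : 'CF(G)) : pchar f -> f \in 'CF(G, pi_elements pi G).
Proof. by case=> chi _ ->; apply: cfpi_on. Qed.

Lemma pchar1_nat G (f : 'CF(G)) : pchar f -> f 1%g \in Num.nat.
Proof. by case=> chi Nchi ->; rewrite cfpi1 Cnat_char1. Qed.

Lemma pchar1_eq0 G (f : 'CF(G)) : pchar f -> (f 1%g == 0) = (f == 0).
Proof.
case=> chi Nchi ->; rewrite cfpi1 char1_eq0 //.
apply/eqP/eqP=> [-> | f0]; first by rewrite /cfpi mul0r.
by apply/eqP; rewrite -char1_eq0 // -cfpi1 f0 cfunE.
Qed.

(** On a pi-subgroup the restriction of a partial character is an ordinary character. All
    integrality of multiplicities comes from here. *)
Lemma pchar_cfdot G H (f : 'CF(G)) (alpha : 'CF(H)) :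
    H \subset G -> pi.-group H -> pchar f -> alpha \is a character ->
  '['Res[H] f, alpha] \in Num.nat.
Proof.
move=> sHG piH [chi Nchi ->] Nalpha.
by rewrite cfpiRes // cfpi_pgroup // Cnat_cfdot_char ?cfRes_char.
Qed.

Lemma Ipi_pchar G (phi : 'CF(G)) : Ipi pi G phi -> pchar phi.
Proof. by case=> /partial_charE[]. Qed.

Lemma Ipi_neq0 G (phi : 'CF(G)) : Ipi pi G phi -> phi != 0.
Proof. by case=> /partial_charE[]. Qed.

Lemma Ipi_split G (phi a b : 'CF(G)) :
  Ipi pi G phi -> pchar a -> pchar b -> phi = a + b -> a = 0 \/ b = 0.
Proof.
case=> _ irr_phi Pa Pb Dphi; have [-> | nz_a] := eqVneq a 0; first by left.
have [-> | nz_b] := eqVneq b 0; first by right.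
by case: irr_phi; exists a, b; split=> //; apply/partial_charE.
Qed.

Lemma Ipi_intro G (phi : 'CF(G)) :
    pchar phi -> phi != 0 ->
    (forall a b, pchar a -> pchar b -> phi = a + b -> a = 0 \/ b = 0) ->
  Ipi pi G phi.
Proof.
move=> Pphi nz_phi irr_phi; split; first exact/partial_charE.
case=> a [b [/partial_charE[Pa nz_a] /partial_charE[Pb nz_b] Dphi]].
by case: (irr_phi a b) => // D0; [case/eqP: nz_a | case/eqP: nz_b].
Qed.

Lemma IpiJ G (phi : 'CF(G)) y : Ipi pi G phi -> Ipi pi G (phi ^ y)%CF.
Proof.
move=> Iphi; apply: Ipi_intro => [||a b Pa Pb Dphi].
- exact/pcharJ/Ipi_pchar.
- by rewrite -(raddf0 (cfConjg y)) (can_eq (cfConjgK y)) Ipi_neq0.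
have [] := @Ipi_split _ phi (a ^ y^-1)%CF (b ^ y^-1)%CF Iphi.
- exact: pcharJ.
- exact: pcharJ.
- by rewrite -[LHS](cfConjgK y) Dphi raddfD.
- by move/(congr1 (cfConjg y)); rewrite cfConjgKV raddf0; left.
by move/(congr1 (cfConjg y)); rewrite cfConjgKV raddf0; right.
Qed.

(** Split one irreducible constituent off any lift: by indecomposability the rest vanishes on
    pi-elements. *)
Lemma Ipi_irr G (phi : 'CF(G)) : Ipi pi G phi -> exists i, phi = cfpi pi 'chi_i.
Proof.
move=> Iphi; have [chi Nchi Dphi] := Ipi_pchar Iphi.
have: chi != 0 by apply: contraNneq (Ipi_neq0 Iphi) => chi0; rewrite Dphi chi0 /cfpi mul0r.
case/neq0_has_constt=> i /(constt_charP i Nchi)[psi Npsi Dchi]; exists i.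
have [||||psi0] := Ipi_split Iphi (a := cfpi pi 'chi_i) (b := cfpi pi psi).
- exact/pchar_cfpi/irr_char.
- exact: pchar_cfpi.
- by rewrite Dphi Dchi /cfpi mulrDl.
- move/eqP; rewrite -pchar1_eq0 ?cfpi1 ?irr1_neq0 //; first by rewrite (negPf (irr1_neq0 i)).
  exact/pchar_cfpi/irr_char.
by rewrite Dphi Dchi [in LHS]/cfpi mulrDl -/(cfpi pi psi) psi0 addr0.
Qed.

Definition Ipis G : seq 'CF(G) :=
  undup [seq cfpi pi 'chi_i | i <- enum (Iirr G) & `[< Ipi pi G (cfpi pi 'chi_i) >]].

Lemma Ipis_uniq G : uniq (Ipis G). Proof. exact: undup_uniq. Qed.

Lemma IpisP G (phi : 'CF(G)) : reflect (Ipi pi G phi) (phi \in Ipis G).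
Proof.
rewrite mem_undup; apply: (iffP mapP) => [[i] | Iphi].
  by rewrite mem_filter => /andP[/asboolP Ii _] ->.
have [i Di] := Ipi_irr Iphi; exists i; rewrite // mem_filter mem_enum -Di.
by apply/andP; split => //; apply/asboolP.
Qed.

(** Splitting terminates because both summands have positive degree. This is existence only;
    uniqueness of the coefficients has to wait for Fong pairs. *)
Lemma pchar_decomp G (f : 'CF(G)) :
  pchar f -> exists n : 'CF(G) -> nat, f = \sum_(phi <- Ipis G) phi *+ n phi.
Proof.
have [d] := ubnP (Num.truncn (f 1%g)); elim: d f => // d IHd f lt_f_d Pf.
have [f0 | nz_f] := eqVneq f 0.
  by exists (fun=> 0%N); rewrite f0 big1.
have [If | notIf] := asboolP (Ipi pi G f).
  exists (fun phi => (phi == f) : nat); rewrite (bigD1_seq f) ?Ipis_uniq //=; last exact/IpisP.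
  by rewrite eqxx big1 ?addr0 // => phi /negPf->.
have [a [b [Pa Pb nz_a nz_b Df]]] : exists a b,
    [/\ pchar a, pchar b, a != 0, b != 0 & f = a + b].
  apply: contrapT => no_ab; apply: notIf; apply: Ipi_intro => // a b Pa Pb Df.
  have [-> | nz_a] := eqVneq a 0; first by left.
  have [-> | nz_b] := eqVneq b 0; first by right.
  by case: no_ab; exists a, b.
have [Na Nb] := (pchar1_nat Pa, pchar1_nat Pb).
have trunc_gt0 (g : 'CF(G)) : pchar g -> g != 0 -> (0 < Num.truncn (g 1%g))%N.
  by move=> Pg nz_g; rewrite -(ltr_nat algC) truncnK ?pchar1_nat // lt0r pchar1_eq0 // nz_g natr_ge0 // pchar1_nat.
have Dtr : Num.truncn (f 1%g) = (Num.truncn (a 1%g) + Num.truncn (b 1%g))%N.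
  by rewrite Df cfunE -{1}(truncnK Na) -{1}(truncnK Nb) -natrD natrK.
rewrite Dtr ltnS in lt_f_d.
have [|m Dm] := IHd a _ Pa.
  by rewrite (leq_trans _ lt_f_d) // -addn1 leq_add2l trunc_gt0.
have [|n Dn] := IHd b _ Pb.
  by rewrite (leq_trans _ lt_f_d) // -add1n leq_add2r trunc_gt0.
exists (fun phi => m phi + n phi)%N; rewrite Df {1}Dm {1}Dn -big_split.
by apply: eq_bigr => phi _; rewrite mulrnDr.
Qed.

Lemma Ipis_span G : 'CF(G, pi_elements pi G) = <<Ipis G>>%VS.
Proof.
apply/eqP; rewrite eqEsubv; apply/andP; split; last first.
  by apply/span_subvP=> phi /IpisP/Ipi_pchar/pchar_on.
apply/subvP=> f /cfpi_onE <-; rewrite [f]cfun_sum_cfdot /cfpi mulr_suml.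
apply: memv_suml => i _; rewrite -scalerAl memvZ // -/(cfpi pi 'chi_i).
have [|n ->] := pchar_decomp (f := cfpi pi 'chi_i); first exact/pchar_cfpi/irr_char.
by rewrite big_seq memv_suml // => phi Iphi; rewrite rpredMn // memv_span.
Qed.

End PartialCharacterTheory.

(** * Multiplicities read off by Fong characters *)

Section Multiplicity.

Variables (gT : finGroupType) (pi : nat_pred).
Implicit Types (G H K N : {group gT}).

(** [alpha] is a Fong character of [phi]. The subgroup [H] is only asked to be a pi-subgroup: it
    will be a Hall subgroup of the nucleus group [W], not of [G]. *)
Definition fong_pair G H (alpha : 'CF(H)) (phi : 'CF(G)) :=
  [/\ H \subset G, pi.-group H, alpha \in irr H
    & forall theta, Ipi pi G theta -> '['Res[H] theta, alpha] = (theta == phi)%:R].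

Definition fong G :=
  forall phi, Ipi pi G phi -> exists (H : {group gT}) (alpha : 'CF(H)), fong_pair alpha phi.

Definition is_dual G (phi d : 'CF(G)) :=
  forall theta, Ipi pi G theta -> '[theta, d] = (theta == phi)%:R.

(** An arbitrary choice, with default [0] if there is none. Under [fong], [is_dual_mult] shows that
    the choice does not affect multiplicities in class functions supported on pi-elements. *)
Definition dual G (phi : 'CF(G)) : 'CF(G) := xget 0 (is_dual phi).

Definition mult G (phi f : 'CF(G)) : algC := '[f, dual phi].

Section Fong.

Variable G : {group gT}.
Hypothesis fongG : fong G.

Lemma dualP (phi : 'CF(G)) : Ipi pi G phi -> is_dual phi (dual phi).
Proof.
move=> Iphi; apply: (@xgetPex _ 0 (is_dual phi)).
have [H [alpha [sHG _ _ Da]]] := fongG Iphi.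
by exists ('Ind[G] alpha) => theta /Da <-; rewrite cfdot_Res_l.
Qed.

Lemma mult_Ipi (phi theta : 'CF(G)) :
  Ipi pi G phi -> Ipi pi G theta -> mult phi theta = (theta == phi)%:R.
Proof. by move=> Iphi; apply: dualP. Qed.

Lemma multD (phi f g : 'CF(G)) : mult phi (f + g) = mult phi f + mult phi g.
Proof. exact: cfdotDl. Qed.

Lemma multZ a (phi f : 'CF(G)) : mult phi (a *: f) = a * mult phi f.
Proof. exact: cfdotZl. Qed.

Lemma mult_sum (phi : 'CF(G)) I (r : seq I) (P : pred I) (F : I -> 'CF(G)) :
  mult phi (\sum_(i <- r | P i) F i) = \sum_(i <- r | P i) mult phi (F i).
Proof. exact: cfdot_suml. Qed.

Lemma Ipis_sum_mult (f : 'CF(G)) :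
    f \in 'CF(G, pi_elements pi G) ->
  f = \sum_(phi <- Ipis pi G) mult phi f *: phi.
Proof.
rewrite Ipis_span; set X := Ipis pi G => /(@coord_span _ _ _ (in_tuple X)) Df.
rewrite (big_nth 0) big_mkord [LHS]Df; apply: eq_bigr => i _; congr (_ *: _).
have XP (j : 'I_(size X)) : Ipi pi G X`_j by apply/IpisP; rewrite mem_nth.
rewrite [in RHS]Df mult_sum (bigD1 i) //= multZ mult_Ipi // eqxx mulr1.
rewrite big1 ?addr0 // => j neq_ji; rewrite multZ mult_Ipi // nth_uniq ?Ipis_uniq //.
by rewrite (_ : (j == i :> nat) = false) ?mulr0 //; apply: negPf.
Qed.

Lemma is_dual_mult (phi d f : 'CF(G)) :
    Ipi pi G phi -> is_dual phi d -> f \in 'CF(G, pi_elements pi G) ->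
  '[f, d] = mult phi f.
Proof.
move=> Iphi dual_d /Ipis_sum_mult Df; rewrite Df cfdot_suml mult_sum.
rewrite big_seq [RHS]big_seq; apply: eq_bigr => theta /IpisP Itheta.
by rewrite cfdotZl multZ dual_d // (mult_Ipi Iphi Itheta).
Qed.

Lemma fong_pair_mult H (alpha : 'CF(H)) (phi f : 'CF(G)) :
    Ipi pi G phi -> fong_pair alpha phi -> f \in 'CF(G, pi_elements pi G) ->
  '['Res[H] f, alpha] = mult phi f.
Proof.
move=> Iphi [sHG _ _ Da] f_on; rewrite cfdot_Res_l; apply: is_dual_mult => // theta It.
by rewrite -cfdot_Res_l Da.
Qed.

Lemma mult_nat (phi f : 'CF(G)) :
  Ipi pi G phi -> pchar pi f -> mult phi f \in Num.nat.
Proof.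
move=> Iphi Pf; have [H [alpha Fa]] := fongG Iphi.
rewrite -(fong_pair_mult Iphi Fa) ?pchar_on //; case: Fa => sHG piH irr_a _.
exact: (pchar_cfdot sHG piH Pf (irrWchar irr_a)).
Qed.

Lemma mult_ge0 (phi f : 'CF(G)) : Ipi pi G phi -> pchar pi f -> 0 <= mult phi f.
Proof. by move=> Iphi Pf; rewrite natr_ge0 ?mult_nat. Qed.

Lemma mult_eq0 (f : 'CF(G)) :
    f \in 'CF(G, pi_elements pi G) ->
  (forall phi, Ipi pi G phi -> mult phi f = 0) -> f = 0.
Proof.
move=> f_on f0; rewrite (Ipis_sum_mult f_on) big_seq big1 // => phi /IpisP Iphi.
by rewrite f0 // scale0r.
Qed.

Lemma mult_inj (f g : 'CF(G)) :
    f \in 'CF(G, pi_elements pi G) -> g \in 'CF(G, pi_elements pi G) ->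
  (forall phi, Ipi pi G phi -> mult phi f = mult phi g) -> f = g.
Proof.
move=> f_on g_on eq_fg; rewrite (Ipis_sum_mult f_on) (Ipis_sum_mult g_on).
by rewrite big_seq [RHS]big_seq; apply: eq_bigr => phi /IpisP/eq_fg->.
Qed.

Lemma exists_mult (f : 'CF(G)) :
    f \in 'CF(G, pi_elements pi G) -> f != 0 ->
  exists2 phi, Ipi pi G phi & mult phi f != 0.
Proof.
move=> f_on nz_f; apply: contrapT => no_phi; case/eqP: nz_f.
apply: mult_eq0 => // phi Iphi; apply: contrapT => /eqP nz.
by case: no_phi; exists phi.
Qed.

Lemma multJ (phi f : 'CF(G)) y :
    Ipi pi G phi -> f \in 'CF(G, pi_elements pi G) ->
  mult (phi ^ y)%CF (f ^ y)%CF = mult phi f.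
Proof.
move=> Iphi f_on; rewrite -(is_dual_mult (d := (dual (phi ^ y) ^ y^-1)%CF) Iphi _ f_on).
  by rewrite -[in RHS](cfConjgK y f) cfConjg_iso.
move=> theta It; rewrite -[theta in LHS](cfConjgK y) cfConjg_iso dualP ?(can_eq (cfConjgK y)) //.
  exact: IpiJ.
exact: IpiJ.
Qed.

Lemma pchar_mult (f : 'CF(G)) :
    f \in 'CF(G, pi_elements pi G) ->
    (forall phi, Ipi pi G phi -> mult phi f \in Num.nat) -> pchar pi f.
Proof.
move=> f_on f_nat; rewrite (Ipis_sum_mult f_on) big_seq.
apply: pchar_sum => phi /IpisP Iphi; apply: pcharZ; first exact: f_nat.
exact: Ipi_pchar.
Qed.

End Fong.

End Multiplicity.

Definition pi_or_pi' (pi : nat_pred) (n : nat) := pi.-nat n || pi^'.-nat n.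

(** * Pi-separable groups *)

(* Unlike pi_separable, this form visibly passes to subgroups. *)
Definition pi_sep (gT : finGroupType) (pi : nat_pred) (G : {group gT}) :=
  forall A B N : {group gT}, A \subset G -> B <| A -> N <| A -> B \proper N ->
  exists M : {group gT},
    [/\ M <| A, B \subset M, M \proper N & pi_or_pi' pi #|N : M|].

Lemma pi_or_pi'_dvd pi m n :
  (m %| n)%N -> pi_or_pi' pi n -> pi_or_pi' pi m.
Proof.
by move=> dvd_mn /orP[] pi_n; apply/orP; [left | right]; apply: pnat_dvd dvd_mn pi_n.
Qed.

Section PiSeparable.

Variables (gT : finGroupType) (pi : nat_pred).
Implicit Types (G H A B K M N : {group gT}).

Lemma pi_sepS G H : H \subset G -> pi_sep pi G -> pi_sep pi H.
Proof. by move=> sHG sepG A B N sAH; apply: sepG; apply: subset_trans sHG. Qed.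

(** Each term [K] of the series is mapped to [B <*> (N :&: K)], which climbs from [B] to [N]. At the
    step [H], [K] where [N] is first reached, the image of [H] serves as [M], with index dividing
    [#|K : H|]. *)
Lemma pi_separable_sep G : pi_separable pi G -> pi_sep pi G.
Proof.
case=> s ser_s last_s A B N sAG nsBA nsNA ltBN; have [sBN not_sNB] := andP ltBN.
have [[sBA nBA] [sNA nNA]] := (andP nsBA, andP nsNA).
pose f K := (B <*> (N :&: K))%G.
have [H [K [facHK ltH eqK]]] : exists H K : {group gT},
    [/\ pi_factor pi G H K, ~~ (N \subset f H) & N \subset f K].
  have: ~~ (N \subset f 1%G) by rewrite /= (setIidPr (sub1G N)) joingG1.
  have: N \subset f (last 1%G s).
    by rewrite last_s /= (setIidPl (subset_trans sNA sAG)) joing_subr.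
  elim: s 1%G ser_s {last_s} => [|K s IHs] H /= ser_s; first by move=> ->.
  have /andP[facHK ser_s'] := ser_s; have [eqK _ ltH | ltK eqL _] := boolP (N \subset f K).
    by exists H, K.
  exact: IHs ser_s' eqL ltK.
have /andP[/and3P[nHG nKG /andP[sHK nHK]] piKH] := facHK.
have nIA (L : {group gT}) : G \subset 'N(L) -> A \subset 'N(N :&: L).
  by move=> nLG; rewrite normsI // (subset_trans sAG).
have nBI (L : {group gT}) : N :&: L \subset 'N(B).
  exact: subset_trans (subsetIl _ _) (subset_trans sNA nBA).
have fE L : f L = (B * (N :&: L))%g :> {set gT} by rewrite /f /= norm_joinEr ?nBI.
have sfN L : f L \subset N by rewrite join_subG sBN subsetIl.
exists (f H); split.
- by rewrite /normal (subset_trans (sfN H)) //= normsY ?nIA.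
- exact: joing_subl.
- by rewrite /proper sfN.
have sIf : N :&: H \subset f H by apply: joing_subr.
have DN : N :=: (f H * (N :&: K))%g.
  apply/eqP; rewrite eqEsubset mul_subG ?subsetIl // andbT.
  by rewrite (subset_trans eqK) // fE mulSg // joing_subl.
have: (#|N : f H| %| #|K : H|)%N.
  rewrite {1}DN indexMg; apply: dvdn_trans (indexgS _ sIf) _.
  have -> : #|N :&: K : N :&: H| = #|N :&: K : H|.
    by rewrite -[RHS]indexgI -setIA (setIidPr sHK).
  rewrite -indexMg -norm_joinEr ?(subset_trans (subsetIr _ _)) //.
  by apply: indexSg; rewrite ?joing_subl // join_subG sHK subsetIr.
move/pi_or_pi'_dvd; apply; rewrite /pi_or_pi' -card_quotient //.
Qed.

End PiSeparable.

Lemma pi_sep_quotient (gT : finGroupType) (pi : nat_pred) (G N : {group gT}) :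
  N <| G -> pi_sep pi G -> pi_sep pi (G / N)%G.
Proof.
move=> nsNG sepG A B L sAG nsBA nsLA ltBL.
have [] := sepG (coset N @*^-1 A)%G (coset N @*^-1 B)%G (coset N @*^-1 L)%G.
- by rewrite sub_cosetpre_quo.
- by rewrite cosetpre_normal.
- by rewrite cosetpre_normal.
- by rewrite cosetpre_proper.
move=> M [nsMA sBM ltML piLM].
have sNM : N \subset M := subset_trans (sub_cosetpre _) sBM.
have DM : coset N @*^-1 (M / N) = M.
  apply: quotientGK; rewrite /normal sNM.
  exact: subset_trans (normal_sub nsMA) (subsetIl _ _).
exists (M / N)%G; split.
- by rewrite -(cosetpreK A) quotient_normal.
- by rewrite -(cosetpreK B) quotientS.
- by rewrite -cosetpre_proper DM.
by rewrite -index_cosetpre DM.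
Qed.

(** A minimal normal subgroup [L] is a pi-group or a pi'-group. Pull back a Hall subgroup of
    [G / L]; when [L] is a pi'-group, pass to a Schur-Zassenhaus complement of [L] in the
    preimage. *)
Lemma pi_sep_Hall (gT : finGroupType) (pi : nat_pred) (G : {group gT}) :
  pi_sep pi G -> exists H : {group gT}, pi.-Hall(G) H.
Proof.
have [n] := ubnP #|G|; elim: n gT G => // n IHn gT G /ltnSE leGn sepG.
have [G1 | ntG] := eqVneq G 1%G.
  by exists 1%G; rewrite G1 pHallE subxx /= cards1 partn1.
have [L /mingroupP[/andP[ntL nLG] minL] sLG] := minnormal_exists ntG (normG G).
have nsLG : L <| G by rewrite /normal sLG.
have [|M [nsMG _ ltML piLM]] := sepG G 1%G L (subxx _) (normal1 G) nsLG.
  by rewrite proper1G.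
have M1 : M :=: 1%g.
  apply: contraTeq ltML => ntM; rewrite /proper negb_and negbK orbC.
  case sML: (M \subset L); last by rewrite orbT.
  by rewrite (minL M) ?subxx // ntM normal_norm.
rewrite /pi_or_pi' M1 indexg1 in piLM.
have ltGL : (#|(G / L)%g| < n)%N.
  apply: leq_trans leGn; rewrite ltn_quotient //.
have [Xb hallXb] := IHn _ _ ltGL (pi_sep_quotient nsLG sepG).
have [X DX sLX sXG] := inv_quotientS nsLG (pHall_sub hallXb).
have nsLX : L <| X := normalS sLX sXG nsLG.
have iGX : pi^'.-nat #|G : X|.
  case/and3P: hallXb => _ _; rewrite DX index_quotient_eq // ?normal_norm //.
  by rewrite (setIidPr _).
have iXL : pi.-nat #|X : L|.
  by rewrite -card_quotient ?normal_norm // -DX; case/and3P: hallXb.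
case/orP: piLM => [piL | pi'L].
  exists X; rewrite /pHall sXG iGX andbT /=.
  by rewrite /pgroup -(Lagrange sLX) pnatM piL.
have hallL : Hall X L.
  by rewrite /Hall sLX coprime_sym (pnat_coprime iXL).
have /splitsP[H /complP[tiLH DLH]] := SchurZassenhaus_split hallL nsLX.
have sHX : H \subset X by rewrite -DLH mulG_subr.
have oH : #|H| = #|X : L|.
  by rewrite -DLH indexMg -indexgI setIC tiLH indexg1.
exists H; rewrite /pHall (subset_trans sHX) // /pgroup oH iXL /=.
rewrite -(Lagrange_index sXG sHX) pnatM iGX.
rewrite -(divgS sHX) oH -(divgS sLX) divnA ?dvdn_gcd ?cardSg //.
by rewrite mulKn ?cardG_gt0.
Qed.

(** * Nuclei *)

(* gamma plays the part of the nucleus of xi: a character of a subgroup W of N,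
   inducing xi and stabilised by a subgroup S that covers G / N, whose
   restriction to the Hall pi-subgroups of W picks xi out of Ipi pi N. *)
Record nucleus (gT : finGroupType) (pi : nat_pred) (G : {set gT})
    (N S W : {group gT}) (xi : 'CF(N)) (gamma : 'CF(W)) : Prop := Nucleus {
  nuc_mul : (S * N)%g = G;
  nuc_cap : W :=: S :&: N;
  nuc_irr : gamma \in irr W;
  nuc_inv : S \subset 'I[gamma];
  nuc_ind : xi = cfpi pi ('Ind[N] gamma);
  nuc_det : pi.-nat #[cfDet gamma]%CF;
  nuc_fong : forall H : {group gT}, pi.-Hall(W) H ->
    @fong_pair _ pi N H ('Res[H] gamma) xi
}.

Lemma cfRes_constt_invariant (gT : finGroupType) (S W : {group gT}) (gamma : 'CF(W)) i :
    W <| S -> gamma \in irr W -> S \subset 'I[gamma] ->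
    i \in irr_constt ('Ind[S] gamma) ->
  exists2 e, (0 < e)%N & 'Res[W] 'chi_i = e%:R *: gamma.
Proof.
move=> nsWS /irrP[s ->] Ig Si; rewrite constt_Ind_Res in Si.
have := Clifford_Res_sum_cfclass nsWS Si.
rewrite cfclass_invariant // big_seq1 => De.
have /natrP[e Ee]: '['Res[W] 'chi_i, 'chi_s] \in Num.nat.
  by rewrite Cnat_cfdot_char ?cfRes_char ?irr_char.
exists e; last by rewrite De Ee.
by rewrite lt0n; apply: contraNneq Si => e0; rewrite Ee e0.
Qed.

Section Step.

Variables (gT : finGroupType) (pi : nat_pred) (N M S W : {group gT}).
Variables (theta : 'CF(M)) (gamma : 'CF(W)).
Hypotheses (nsMN : M <| N) (fongM : fong pi M) (Itheta : Ipi pi M theta).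
Hypothesis nuc : nucleus pi 'I_N[theta] S theta gamma.

Let sMN : M \subset N. Proof. exact: normal_sub. Qed.
Let nMN : N \subset 'N(M). Proof. exact: normal_norm. Qed.
Let defT : (S * M)%g = 'I_N[theta]. Proof. exact: nuc_mul nuc. Qed.
Let defW : W :=: S :&: M. Proof. exact: nuc_cap nuc. Qed.
Let irr_gamma : gamma \in irr W. Proof. exact: nuc_irr nuc. Qed.

Lemma nuc_subN : S \subset N.
Proof. by rewrite (subset_trans (mulG_subl M S)) // defT subsetIl. Qed.

Lemma nuc_subM : W \subset M. Proof. by rewrite defW subsetIr. Qed.

Lemma nuc_normal : W <| S.
Proof. by rewrite defW (normalGI nuc_subN). Qed.

Let sSN := nuc_subN.
Let sWM := nuc_subM.
Let nsWS := nuc_normal.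
Let sWS : W \subset S. Proof. exact: normal_sub. Qed.

Lemma nuc_index_dvd : (#|S : W| %| #|N : M|)%N.
Proof.
rewrite defW indexgI -indexMg (_ : (M * S)%g = 'I_N[theta]); last first.
  by rewrite -defT; apply/esym/normC/(subset_trans sSN).
by apply: indexSg; rewrite ?subsetIl // sub_Inertia.
Qed.

(** Induce through the stabiliser, which is [S * M]: there Mackey's formula leaves on [M] the
    character induced from [a *: gamma], that is [a *: theta] on pi-elements, and inducing on to [N]
    sums the conjugates. *)
Lemma nuc_Res_Ind (chi : 'CF(S)) (a : algC) :
    'Res[W] chi = a *: gamma ->
  'Res[M] (cfpi pi ('Ind[N] chi))
    = a / #|'I_N[theta]|%:R *: \sum_(y in N) (theta ^ y)%CF.
Proof.
move=> chiW; have sTN : 'I_N[theta] \subset N := subsetIl _ _.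
have sST : S \subset 'I_N[theta] by rewrite -defT mulG_subl.
rewrite cfpiRes //; apply/cfun_inP=> x Mx; rewrite cfpiE inE Mx cfunE sum_cfunE /=.
have Nx := subsetP sMN x Mx.
have eq_x y : y \in N -> (theta ^ y)%CF x = cfpi pi ('Ind[M] gamma) (x ^ y^-1)%g.
  by move=> Ny; rewrite -(nuc_ind nuc) cfConjgE ?(subsetP nMN).
rewrite (eq_bigr _ eq_x); case: ifP => [pi_x | pi'x]; last first.
  by rewrite big1 ?mulr0 // => y Ny; rewrite cfpiE inE p_eltJ pi'x andbF.
rewrite cfResE // -(cfIndInd _ sTN sST) cfIndE // -mulrA mulrCA; congr (_ * _).
rewrite mulr_sumr [RHS](reindex_inj invg_inj) /=.
apply: eq_big => [y | y Ny]; first by rewrite groupV.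
have Mxy : (x ^ y \in M)%g by rewrite memJ_norm ?(subsetP nMN).
rewrite invgK cfpiE inE Mxy p_eltJ pi_x /= -[LHS](cfResE _ (sub_Inertia theta sMN) Mxy).
by rewrite (cfResInd_mul _ defT defW) chiW linearZ cfunE.
Qed.

Lemma mult_orbit (phi : 'CF(M)) :
    Ipi pi M phi ->
  mult pi phi (\sum_(y in N) (theta ^ y)%CF)
    = #|[set y in N | (theta ^ y)%CF == phi]|%:R.
Proof.
move=> Iphi; rewrite mult_sum // -sum1_card natr_sum big_mkcond [RHS]big_mkcond /=.
apply: eq_bigr => y _; rewrite inE; case: (y \in N) => //=.
by rewrite mult_Ipi //; [case: eqP | apply: IpiJ].
Qed.

Lemma mult_orbit_refl y :
  y \in N -> mult pi (theta ^ y)%CF (\sum_(y in N) (theta ^ y)%CF) = #|'I_N[theta]|%:R.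
Proof.
move=> Ny; rewrite mult_orbit; last exact: IpiJ.
congr _%:R; rewrite -[RHS](card_rcoset _ y); apply: eq_card => z.
rewrite mem_rcoset !inE groupMr ?groupV //; case Nz: (z \in N) => //=.
have nMz := subsetP nMN z Nz; have nMy := subsetP nMN y Ny.
have: (z * y^-1 \in 'N(M))%g by rewrite groupM ?groupV.
rewrite inE => -> /=; rewrite (cfConjgM _ nsMN) ?groupV //.
by rewrite -[X in _ = (_ == X)](cfConjgK y) (can_eq (cfConjgKV y)).
Qed.

Lemma nuc_mult_Ind (chi : 'CF(S)) (a : algC) y :
    'Res[W] chi = a *: gamma -> y \in N ->
  mult pi (theta ^ y)%CF ('Res[M] (cfpi pi ('Ind[N] chi))) = a.
Proof.
by move=> chiW Ny; rewrite (nuc_Res_Ind chiW) multZ mult_orbit_refl // divfK ?neq0CG.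
Qed.

Lemma nuc_mult_Ind_conj (chi : 'CF(S)) (a : algC) (phi : 'CF(M)) :
    'Res[W] chi = a *: gamma -> Ipi pi M phi ->
    mult pi phi ('Res[M] (cfpi pi ('Ind[N] chi))) != 0 ->
  exists2 y, y \in N & phi = (theta ^ y)%CF.
Proof.
move=> chiW Iphi; rewrite (nuc_Res_Ind chiW) multZ mult_orbit // mulf_eq0.
case/norP=> _; rewrite pnatr_eq0 cards_eq0 => /set0Pn[y].
by rewrite inE => /andP[Ny /eqP <-]; exists y.
Qed.

Section Hall.

Variable H : {group gT}.
Hypothesis hallH : pi.-Hall(S) H.
Let H0 := (W :&: H)%G.

Let hallH0 : pi.-Hall(W) H0.
Proof. by rewrite /= setIC; apply: Hall_setI_normal nsWS hallH. Qed.
Let sHS : H \subset S. Proof. exact: pHall_sub hallH. Qed.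
Let piH : pi.-group H. Proof. exact: pHall_pgroup hallH. Qed.
Let sH0H : H0 \subset H. Proof. exact: subsetIr. Qed.
Let sH0W : H0 \subset W. Proof. exact: subsetIl. Qed.
Let sHN : H \subset N. Proof. exact: subset_trans sSN. Qed.

Lemma nuc_irrH0 : 'Res[H0] gamma \in irr H0.
Proof. by case: (nuc_fong nuc hallH0). Qed.

(** [H0] is a Hall pi-subgroup of [W], as [W] is normal in [S]; so [gamma] on [H0] is a Fong
    character of [theta]. *)
Lemma nuc_cfdotH0 (f : 'CF(N)) :
    pchar pi f ->
  '['Res[H0] f, 'Res[H0] gamma] = mult pi theta ('Res[M] f).
Proof.
move=> Pf; rewrite -(fong_pair_mult fongM Itheta (nuc_fong nuc hallH0)).
  by rewrite cfResRes // (subset_trans sH0W).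
exact/pchar_on/pcharRes.
Qed.

(** If the irreducible ['Res[H] chi] occurred in [Delta], then [Delta] on [H0] would contain [gamma]
    at least [e] times. *)
Lemma nuc_cfdot0 (Delta : 'CF(H)) (chi : 'CF(S)) (e : nat) :
    Delta \is a character -> chi \is a character ->
    '['Res[H0] Delta, 'Res[H0] gamma] = 0 ->
    'Res[W] chi = e%:R *: gamma -> (0 < e)%N -> 'Res[H] chi \in irr H ->
  '[Delta, 'Res[H] chi] = 0.
Proof.
move=> NDelta Nchi Delta0 chiW e_gt0 /irrP[i Di]; apply/eqP; apply: contraTT isT.
rewrite Di -irr_consttE => /(constt_charP i NDelta)[psi Npsi DDelta].
move: Delta0; rewrite DDelta -Di linearD /= cfResRes // cfdotDl.
rewrite -(cfResRes _ sH0W sWS) chiW linearZ /= cfdotZl irrWnorm ?nuc_irrH0 // mulr1.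
move/eqP; rewrite paddr_eq0 ?ler0n ?pnatr_eq0 ?natr_ge0 //; first by rewrite eqn0Ngt e_gt0.
by rewrite Cnat_cfdot_char ?cfRes_char // irrWchar ?irr_gamma.
Qed.

(** Inducing to [N] and restricting back adds a character to [chi']. On [H0] the induced character
    contains [gamma] exactly [e'] times, the multiplicity of [theta], and [chi'] already accounts
    for all of these; so the added part is orthogonal to [chi] on [H]. *)
Lemma nuc_cfdot_Ind (chi chi' : 'CF(S)) (e e' : nat) :
    chi \is a character -> chi' \is a character ->
    'Res[W] chi = e%:R *: gamma -> (0 < e)%N -> 'Res[H] chi \in irr H ->
    'Res[W] chi' = e'%:R *: gamma ->
  '['Res[H] (cfpi pi ('Ind[N] chi')), 'Res[H] chi] = '['Res[H] chi', 'Res[H] chi].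
Proof.
move=> Nchi Nchi' chiW e_gt0 irr_chiH chi'W.
rewrite cfpiRes // cfpi_pgroup //; apply/eqP; rewrite -subr_eq0 -cfdotBl; apply/eqP.
apply: (nuc_cfdot0 _ Nchi _ chiW e_gt0 irr_chiH).
  rewrite -[X in X - _](cfResRes _ sHS sSN) -linearB cfRes_char //.
  exact: cfResInd_sub_char.
have piH0 : pi.-group H0 := pHall_pgroup hallH0.
have Ind_e' : '['Res[H0] ('Ind[N] chi'), 'Res[H0] gamma] = e'%:R.
  rewrite -[LHS]/('['Res[H0] ('Ind[N] chi'), _]) -[X in '[X, _]](cfpi_pgroup _ piH0).
  rewrite -cfpiRes ?(subset_trans sH0H) // nuc_cfdotH0; last exact/pchar_cfpi/cfInd_char.
  by rewrite -[theta](cfConjgJ1) (nuc_mult_Ind chi'W) ?group1.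
rewrite linearB cfdotBl /= !cfResRes // Ind_e'.
rewrite -(cfResRes _ sH0W sWS) chi'W linearZ /= cfdotZl irrWnorm ?nuc_irrH0 //.
by rewrite mulr1 subrr.
Qed.

End Hall.

End Step.

Section GoodCharacters.

Variables (gT : finGroupType) (pi : nat_pred) (N M S W : {group gT}).
Variables (theta : 'CF(M)) (gamma : 'CF(W)).
Hypotheses (sepN : pi_sep pi N) (nsMN : M <| N) (piMN : pi_or_pi' pi #|N : M|).
Hypotheses (fongM : fong pi M) (Itheta : Ipi pi M theta).
Hypothesis nuc : nucleus pi 'I_N[theta] S theta gamma.

(* The characters of S that induce to Ipi pi N: all those over gamma when N / M
   is a pi-group, the canonical extension of gamma when it is a pi'-group. *)
Definition good (chi : 'CF(S)) : Prop :=
  [/\ chi \in irr S, (exists2 e, (0 < e)%N & 'Res[W] chi = e%:R *: gamma),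
      pi.-nat #[cfDet chi]%CF & ~~ pi.-nat #|N : M| -> 'Res[W] chi = gamma].

Let sMN : M \subset N. Proof. exact: normal_sub. Qed.
Let nMN : N \subset 'N(M). Proof. exact: normal_norm. Qed.
Let irr_gamma : gamma \in irr W. Proof. exact: nuc_irr nuc. Qed.
Let Igamma : S \subset 'I[gamma]. Proof. exact: nuc_inv nuc. Qed.
Let sSN : S \subset N. Proof. exact: nuc_subN nuc. Qed.
Let sWM : W \subset M. Proof. exact: nuc_subM nuc. Qed.
Let nsWS : W <| S. Proof. exact: nuc_normal nsMN nuc. Qed.
Let sWS : W \subset S. Proof. exact: normal_sub. Qed.

Lemma good_irr chi : good chi -> chi \in irr S. Proof. by case. Qed.

(** The determinantal condition is automatic: the power of the determinant that kills it on [W] is a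
    character of [S / W], a pi-group. *)
Lemma good_pi chi :
    pi.-nat #|N : M| -> chi \in irr S ->
    (exists2 e, (0 < e)%N & 'Res[W] chi = e%:R *: gamma) ->
  good chi.
Proof.
move=> piNM irr_chi [e e_gt0 chiW]; split=> //; [by exists e | | by rewrite piNM].
pose k := #[cfDet gamma]%CF.
have detW : 'Res[W] (cfDet chi ^+ k) = 1.
  rewrite rmorphXn /= -cfDetRes ?irrWchar // chiW scaler_nat cfDetMn ?irrWchar //.
  by rewrite exprAC exp_cforder expr1n.
have piSW : pi.-nat #|S : W| by apply: pnat_dvd piNM; apply: nuc_index_dvd nuc.
have: pi.-nat (k * #|S : W|)%N by rewrite pnatM (nuc_det nuc).
apply: pnat_dvd; rewrite dvdn_cforder exprM -dvdn_cforder.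
have lin_a : cfDet chi ^+ k \is a linear_char by rewrite rpredX ?cfDet_lin_char.
have kerW : W \subset cfker (cfDet chi ^+ k).
  by rewrite -subsetIidl -cfker_Res ?lin_charW // detW cfker_cfun1.
rewrite -(cfQuoK nsWS kerW) cforder_mod // -card_quotient ?normal_norm //.
by rewrite cforder_lin_char_dvdG ?cfQuo_lin_char.
Qed.

Lemma good_constt i : pi.-nat #|N : M| -> i \in irr_constt ('Ind[S] gamma) -> good 'chi_i.
Proof.
move=> piNM Si; apply: good_pi => //; first exact: mem_irr.
exact: cfRes_constt_invariant Si.
Qed.

Lemma good_ind_constt chi :
  good chi -> exists2 i, i \in irr_constt ('Ind[S] gamma) & chi = 'chi_i.
Proof.
case=> /irrP[i ->] [e e_gt0 chiW] _ _; exists i => //.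
rewrite irr_consttE -cfdot_Res_r chiW cfdotZr irrWnorm // mulr1 conj_natr ?natr_nat //.
by rewrite pnatr_eq0 -lt0n.
Qed.

(** The restriction of [gamma] to a Hall pi-subgroup of [W] is irreducible, so the degree divides
    the order of that subgroup. *)
Lemma nuc_deg_pi : pi.-nat (Num.truncn (gamma 1%g)).
Proof.
have [|H hallH] := @pi_sep_Hall _ pi W.
  exact: pi_sepS (subset_trans sWM sMN) sepN.
have [_ piH /irrP[i Di] _] := nuc_fong nuc hallH.
have := dvd_irr1_cardG i; rewrite -Di cfRes1.
have /natrP[d Dd] : gamma 1%g \in Num.nat by have /irrP[s ->] := irr_gamma; apply: Cnat_irr1.
by rewrite Dd natrK dvdC_nat; move/pnat_dvd; apply.
Qed.

Lemma good_unique_pi' chi chi' :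
  ~~ pi.-nat #|N : M| -> good chi -> good chi' -> chi = chi'.
Proof.
move=> not_pi [irr1 _ det1 /(_ not_pi) W1] [irr2 _ det2 /(_ not_pi) W2].
have pi'NM : pi^'.-nat #|N : M| by have /orP[/idPn[]|] := piMN.
have pi'SW : pi^'.-nat #|S : W| by apply: pnat_dvd pi'NM; apply: nuc_index_dvd nuc.
exact: (pi_extension_unique nsWS irr_gamma pi'SW nuc_deg_pi).
Qed.

Lemma good_exists_pi' : ~~ pi.-nat #|N : M| -> exists chi, good chi.
Proof.
move=> not_pi; have pi'NM : pi^'.-nat #|N : M| by have /orP[/idPn[]|] := piMN.
have pi'SW : pi^'.-nat #|S : W| by apply: pnat_dvd pi'NM; apply: nuc_index_dvd nuc.
have [|chi irr_chi [chiW det_chi]] :=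
  pi_extension_exists nsWS irr_gamma pi'SW nuc_deg_pi _ Igamma; first exact: nuc_det nuc.
by exists chi; split=> //; exists 1%N; rewrite // scale1r.
Qed.

Section Hall.

Variable H : {group gT}.
Hypothesis hallH : pi.-Hall(S) H.
Let H0 := (W :&: H)%G.
Let sHS : H \subset S. Proof. exact: pHall_sub hallH. Qed.
Let piH : pi.-group H. Proof. exact: pHall_pgroup hallH. Qed.
Let sH0H : H0 \subset H. Proof. exact: subsetIr. Qed.
Let sHN : H \subset N. Proof. exact: subset_trans sSN. Qed.
Let irr_gH0 : 'Res[H0] gamma \in irr H0. Proof. exact: nuc_irrH0 nuc _ hallH. Qed.

Lemma Hall_cover : pi.-nat #|N : M| -> (W * H)%g = S.
Proof.
move=> piNM; have nWH := subset_trans sHS (normal_norm nsWS).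
have piSW : pi.-nat #|S : W| by apply: pnat_dvd piNM; apply: nuc_index_dvd nuc.
have sYS : W <*> H \subset S by rewrite join_subG sWS.
rewrite -norm_joinEr //; apply/eqP; rewrite eqEsubset sYS -indexg_eq1.
have pi1 : pi.-nat #|S : W <*> H| by apply: pnat_dvd piSW; rewrite indexgS ?joing_subl.
have pi2 : pi^'.-nat #|S : W <*> H|.
  by case/and3P: hallH => _ _; apply: pnat_dvd; rewrite indexgS ?joing_subr.
by rewrite (pnat_1 pi1 pi2).
Qed.

Lemma Hall_sub_pi' : ~~ pi.-nat #|N : M| -> H \subset W.
Proof.
move=> not_pi; have pi'NM : pi^'.-nat #|N : M| by have /orP[/idPn[]|] := piMN.
have pi'SW : pi^'.-nat #|S : W| by apply: pnat_dvd pi'NM; apply: nuc_index_dvd nuc.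
have nWH := subset_trans sHS (normal_norm nsWS).
rewrite -indexg_eq1; apply/eqP/(@pnat_1 pi).
  by apply: pnat_dvd piH; apply: dvdn_indexg.
apply: pnat_dvd pi'SW; rewrite -indexMg -norm_joinEr //.
by rewrite indexSg ?joing_subl // join_subG sWS.
Qed.

(** For a pi-quotient [H] covers [S / W] and [cfdot_Res_cover] applies; for a pi'-quotient there is
    a single good character, and [H] lies in [W]. *)
Lemma good_dot chi chi' :
  good chi -> good chi' -> '['Res[H] chi, 'Res[H] chi'] = (chi == chi')%:R.
Proof.
move=> g g'; have [piNM | not_pi] := boolP (pi.-nat #|N : M|).
  have [i Si Di] := good_ind_constt g; have [j Sj Dj] := good_ind_constt g'.
  rewrite Di Dj (inj_eq irr_inj); apply: (cfdot_Res_cover nsWS (Hall_cover piNM) _ Igamma) Si Sj => //.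
rewrite (good_unique_pi' not_pi g g') eqxx; have [_ _ _ /(_ not_pi) chiW] := g'.
have sHW := Hall_sub_pi' not_pi; rewrite -(cfResRes _ sHW sWS) chiW irrWnorm //.
by have [] := nuc_fong nuc (pHall_subl sHW sWS hallH).
Qed.

Lemma good_irrH chi : good chi -> 'Res[H] chi \in irr H.
Proof.
move=> g; rewrite irrEchar cfRes_char ?irrWchar ?good_irr //=.
by rewrite good_dot // eqxx.
Qed.

Lemma good_Ind_dot chi chi' :
    good chi -> good chi' ->
  '['Res[H] (cfpi pi ('Ind[N] chi')), 'Res[H] chi] = (chi' == chi)%:R.
Proof.
move=> g g'; have [irr_chi [e e_gt0 chiW] _ _] := g.
have [irr_chi' [e' _ chiW'] _ _] := g'.
rewrite (nuc_cfdot_Ind nsMN fongM Itheta nuc hallH _ _ chiW e_gt0 _ chiW') ?irrWchar ?good_irrH //.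
exact: good_dot.
Qed.

Lemma good_dot0 (f : 'CF(N)) chi :
    pchar pi f -> good chi -> mult pi theta ('Res[M] f) = 0 ->
  '['Res[H] f, 'Res[H] chi] = 0.
Proof.
move=> Pf g f0; have [irr_chi [e e_gt0 chiW] _ _] := g.
have [psi Npsi Df] := Pf.
apply: (nuc_cfdot0 nsMN nuc hallH _ (irrWchar irr_chi) _ chiW e_gt0 (good_irrH g)).
  by rewrite Df cfpiRes // cfpi_pgroup // cfRes_char.
by rewrite cfResRes // (nuc_cfdotH0 nsMN fongM Itheta nuc hallH).
Qed.

(** For a pi-quotient, reciprocity and Mackey turn the pairing with [gamma] on [H0] into a pairing
    on [H] with ['Ind[S] gamma], whose constituents are all good. *)
Lemma good_dot_exists (f : 'CF(N)) :
    pchar pi f -> mult pi theta ('Res[M] f) != 0 ->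
  exists2 chi, good chi & '['Res[H] f, 'Res[H] chi] != 0.
Proof.
move=> Pf; rewrite -(nuc_cfdotH0 nsMN fongM Itheta nuc hallH Pf) => nz_f.
have [piNM | not_pi] := boolP (pi.-nat #|N : M|); last first.
  have [chi g] := good_exists_pi' not_pi; exists chi => //.
  have [_ _ _ /(_ not_pi) chiW] := g; have sHW := Hall_sub_pi' not_pi.
  rewrite -(cfResRes _ sHW sWS) chiW.
  have -> : H = H0 by apply/val_inj/esym/setIidPr.
  exact: nz_f.
rewrite -(cfResRes _ sH0H sHN) cfdot_Res_l in nz_f.
rewrite -(cfResInd_mul gamma (Hall_cover piNM) (erefl _)) in nz_f.
apply: contrapT => no_chi; case/eqP: nz_f.
rewrite ['Ind[S] gamma]cfun_sum_constt linear_sum cfdot_sumr big1 // => i Si.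
rewrite linearZ cfdotZr; apply/eqP; rewrite mulf_eq0; apply/orP; right.
apply: contrapT => /negP nz_i; apply: no_chi; exists 'chi_i => //.
exact: good_constt.
Qed.

End Hall.

(** The pairing with [chi] on a Hall subgroup has total 1, while each nonzero summand contributes at
    least 1; hence there is only one. *)
Lemma good_Ipi chi : good chi -> Ipi pi N (cfpi pi ('Ind[N] chi)).
Proof.
move=> g; have [irr_chi [e e_gt0 chiW] _ _] := g.
have [|H hallH] := @pi_sep_Hall _ pi S; first exact: pi_sepS sSN sepN.
have [sHN piH] : H \subset N /\ pi.-group H.
  by rewrite (subset_trans (pHall_sub hallH)) // (pHall_pgroup hallH).
set s := cfpi pi _; have Ps : pchar pi s by apply/pchar_cfpi/cfInd_char/irrWchar.
have s1 : '['Res[H] s, 'Res[H] chi] = 1 by rewrite good_Ind_dot // eqxx.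
(* On [M] the summand [a] contains a conjugate of [theta], hence [theta], so it pairs with some good
   [chi']. Then so does [s], which forces [chi'] to be [chi]. *)
have dot_pos a b : pchar pi a -> pchar pi b -> s = a + b -> a != 0 ->
    exists k, '['Res[H] a, 'Res[H] chi] = k.+1%:R.
  move=> Pa Pb Ds nz_a; have PaM := pcharRes sMN Pa.
  have nz_aM : 'Res[M] a != 0 by rewrite -(pchar1_eq0 PaM) cfRes1 (pchar1_eq0 Pa).
  have [phi Iphi nz_phi] := exists_mult fongM (pchar_on PaM) nz_aM.
  have nz_sphi : mult pi phi ('Res[M] s) != 0.
    rewrite Ds linearD multD paddr_eq0 ?negb_and ?nz_phi ?mult_ge0 //.
    exact: pcharRes.
  have [y Ny Dphi] := nuc_mult_Ind_conj nsMN fongM Itheta nuc chiW Iphi nz_sphi.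
  have nz_a_theta : mult pi theta ('Res[M] a) != 0.
    rewrite -(multJ fongM y Itheta (pchar_on PaM)) -Dphi.
    by rewrite cfConjgRes_norm ?(subsetP nMN) // ?(subsetP (normG N)) // cfConjg_id.
  have [chi' g' nz_chi'] := good_dot_exists hallH Pa nz_a_theta.
  have Nchi' : 'Res[H] chi' \is a character by rewrite irrWchar ?good_irrH.
  have: '['Res[H] s, 'Res[H] chi'] != 0.
    rewrite Ds linearD cfdotDl paddr_eq0 ?natr_ge0 ?(pchar_cfdot sHN piH) //.
    by rewrite negb_and nz_chi'.
  rewrite good_Ind_dot //; have [Dchi | _] := eqVneq chi chi'; last by rewrite eqxx.
  have /natrP[[|k] Dk] := pchar_cfdot sHN piH Pa Nchi'.
    by rewrite Dk eqxx in nz_chi'.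
  by rewrite Dchi; exists k.
apply: Ipi_intro => // [|a b Pa Pb Ds].
  by apply: contra_eqN s1 => /eqP->; rewrite linear0 cfdot0l eq_sym oner_eq0.
have [-> | nz_a] := eqVneq a 0; first by left.
have [-> | nz_b] := eqVneq b 0; first by right.
have [k Dk] := dot_pos a b Pa Pb Ds nz_a.
have [l Dl] := dot_pos b a Pb Pa (etrans Ds (addrC a b)) nz_b.
move/eqP: s1; rewrite Ds linearD cfdotDl Dk Dl -natrD pnatr_eq1.
by rewrite addSn addnS.
Qed.

End GoodCharacters.

(** * Spanning in the case of a pi-quotient *)

Section CosetCount.

Variables (gT : finGroupType) (pi : nat_pred) (E M : {group gT}) (y : gT).
Hypotheses (nsME : M <| E) (defE : (M * <[y]>)%g = E) (piEM : pi.-nat #|E : M|).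
Hypothesis fongM : fong pi M.

Let A := pi_elements pi E :&: (M :* y).

Let Ey : y \in E. Proof. by rewrite -defE (subsetP (mulG_subr _ _)) ?cycle_id. Qed.
Let sME : M \subset E. Proof. exact: normal_sub. Qed.
Let nMy : y \in 'N(M). Proof. exact: subsetP (normal_norm nsME) _ Ey. Qed.
Let sMyE : M :* y \subset E.
Proof. by apply/subsetP=> _ /rcosetP[m Mm ->]; rewrite groupM // (subsetP sME). Qed.

Lemma coset_class z : z \in M :* y -> z ^: E = z ^: M.
Proof.
move=> Myz; apply/eqP; rewrite eqEsubset andbC imsetS //=.
have [m Mm Dz] := rcosetP Myz; have Ez := subsetP sMyE z Myz.
have defE' : E = (<[z]> <*> M)%G.
  apply/val_inj/eqP; rewrite eqEsubset join_subG cycle_subG Ez sME !andbT /=.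
  have Yz : z \in <[z]> <*> M by rewrite mem_gen // inE cycle_id.
  have sMY : M \subset <[z]> <*> M by apply: joing_subr.
  rewrite -defE mul_subG // cycle_subG (_ : y = m^-1 * z)%g; last by rewrite Dz mulKg.
  by rewrite groupM ?groupV // (subsetP sMY).
apply/subsetP=> _ /imsetP[g Eg ->]; rewrite defE' /= norm_joinEl in Eg; last first.
  by rewrite cycle_subG (subsetP (normal_norm nsME)).
have /mulsgP[u m' /cycleP[k ->] Mm' ->] := Eg; rewrite conjgM.
have -> : (z ^ (z ^+ k))%g = z by apply/conjg_fixP/commgP/commuteX/commute_refl.
exact: imset_f.
Qed.

Lemma norm_class_cent z : z \in M :* y -> (#|z ^: E| * #|'C_M[z]|)%N = #|M|.
Proof. by move=> Myz; rewrite coset_class // -index_cent1 mulnC Lagrange ?subsetIl. Qed.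

(** An [E]-class in the coset is a single [M]-class, so its centraliser orders in [M] add up to
    [#|M|]. *)
Lemma card_coset_classes :
  (#|M| * #|classes E ::&: A|)%N = (\sum_(z in A) #|'C_M[z]|)%N.
Proof.
have sAMy : A \subset M :* y := subsetIr _ _.
have AE z : z \in A -> z \in E by move/(subsetP sAMy)/(subsetP sMyE).
have clA z : z \in A -> z ^: E \subset A.
  move=> Az; apply/subsetP=> w zEw; have Myz := subsetP sAMy z Az.
  rewrite inE; apply/andP; split.
    have /imsetP[g Eg ->] := zEw; have /setIP[] := Az.
    by rewrite !inE p_eltJ => /andP[Ez ->] _; rewrite groupJ.
  move: zEw; rewrite coset_class // => /imsetP[m Mm ->].
  have nMz : z^-1%g \in 'N(M) by rewrite groupV (subsetP (normal_norm nsME)) ?AE.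
  rewrite mem_rcoset in Myz; rewrite mem_rcoset conjgE.
  have -> : (m^-1 * (z * m) * y^-1 = m^-1 * m ^ z^-1 * (z * y^-1))%g.
    by rewrite conjgE invgK !mulgA mulgKV.
  by rewrite groupM // groupM ?groupV // memJ_norm.
rewrite (partition_big (class^~ E) (mem (classes E ::&: A))) /=; last first.
  by move=> z Az; rewrite inE mem_classes ?AE ?clA.
rewrite mulnC -sum_nat_const; apply: eq_bigr => C.
rewrite inE => /andP[/imsetP[z Ez ->] szA].
have Myz : z \in M :* y by rewrite (subsetP sAMy) // (subsetP szA) ?class_refl.
rewrite (eq_bigl [in z ^: E]) => [|w]; last first.
  apply/andP/idP=> [[_ /eqP <-] | zEw]; first exact: class_refl.
  by split; [apply: (subsetP szA) | apply/eqP/class_eqP].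
have zE_gt0 : (0 < #|z ^: E|)%N by rewrite card_gt0; apply/set0Pn; exists z; apply: class_refl.
rewrite (eq_bigr (fun _ => #|M| %/ #|z ^: E|)%N) => [|w zEw].
  by rewrite sum_nat_const mulnC divnK // -(norm_class_cent Myz) dvdn_mulr.
have Myw : w \in M :* y by rewrite (subsetP sAMy) // (subsetP szA).
by rewrite -(norm_class_cent Myw) (class_eqP zEw) mulKn.
Qed.

Lemma card_commuting (X Y : {set gT}) :
  #|[set p : gT * gT | [&& p.1 \in X, p.2 \in Y & (p.1 * p.2 == p.2 * p.1)%g]]|
    = (\sum_(x in X) #|[set z in Y | (x * z == z * x)%g]|)%N.
Proof.
rewrite -sum1_card (eq_bigr (fun x => \sum_(z in Y | (x * z == z * x)%g) 1)%N); last first.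
  by move=> x _; rewrite -sum1_card; apply: eq_bigl => z; rewrite inE.
by rewrite pair_big_dep; apply: eq_bigl => -[x z]; rewrite inE.
Qed.

(* Exchanging pi'-parts turns a commuting pair whose first member is a
   pi-element of My into one whose second member is a pi-element of M. *)
Lemma card_commuting_swap :
  #|[set p : gT * gT | [&& p.1 \in A, p.2 \in M & (p.1 * p.2 == p.2 * p.1)%g]]|
  = #|[set p : gT * gT |
        [&& p.1 \in M :* y, p.2 \in pi_elements pi M & (p.1 * p.2 == p.2 * p.1)%g]]|.
Proof.
set P1 := [set p | _]; set P2 := [set p | _].
pose f (p : gT * gT) := (p.1 * p.2.`_pi^', p.2.`_pi)%g.
pose g (p : gT * gT) := (p.1.`_pi, p.2 * p.1.`_pi^')%g.
have comm_constt (x z : gT) rho : commute x z -> commute x z.`_rho.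
  exact: commuteX.
have pi_part1 (x : gT) : (x.`_pi^').`_pi = 1%g by apply/constt1P; apply: p_elt_constt.
have pi_part2 (x : gT) : pi.-elt x -> x.`_pi^' = 1%g.
  by move=> pi_x; apply/constt1P; rewrite p_eltNK.
have fP p : p \in P1 -> f p \in P2 /\ g (f p) = p.
  case: p => z m; rewrite !inE /= => /and3P[/andP[/andP[Ez pi_z] Myz] Mm /eqP czm].
  have cz rho : commute z m.`_rho by apply: comm_constt.
  have Mm' rho : (m.`_rho \in M)%g by rewrite groupX.
  split; first apply/and3P; first split.
  - rewrite (cz pi^') mem_rcoset -mulgA groupM // -mem_rcoset //.
  - by rewrite Mm' p_elt_constt.
  - by apply/eqP/esym/commuteM; [apply/esym/cz | apply: commuteX2].
  rewrite /g /f /= !consttM; try exact: cz.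
  rewrite (constt_p_elt pi_z) pi_part1 mulg1 (pi_part2 z) // mul1g.
  by rewrite (constt_p_elt (p_elt_constt _ _)) consttC.
have gP p : p \in P2 -> g p \in P1 /\ f (g p) = p.
  case: p => z m; rewrite !inE /= => /and3P[Myz /andP[Mm pi_m] /eqP czm].
  have Ez := subsetP sMyE z Myz.
  have cm rho : commute m z.`_rho by apply: comm_constt; apply/esym.
  have Mz' : (z.`_pi^' \in M)%g.
    rewrite -(ker_coset M); apply/kerP; first by rewrite groupX // (subsetP (normal_norm nsME)).
    rewrite morph_constt ?(subsetP (normal_norm nsME)) //; apply/constt1P.
    rewrite p_eltNK; apply: (@mem_p_elt _ _ _ (E / M)); last by rewrite mem_morphim // (subsetP (normal_norm nsME)).
    by rewrite /pgroup card_quotient ?normal_norm.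
  split; first apply/and3P; first split.
  - rewrite groupX // p_elt_constt /= mem_rcoset.
    have -> : (z.`_pi = (z.`_pi^')^-1 * z)%g.
      by apply: (canRL (mulKg _)); rewrite -[RHS](consttC pi) /constt; apply: commuteX2.
    by rewrite -mulgA groupM ?groupV // -mem_rcoset.
  - exact: groupM.
  - by apply/eqP/commuteM; [apply/esym/cm | apply: commuteX2].
  rewrite /f /g /= !consttM; try exact: cm.
  rewrite (constt_p_elt pi_m) pi_part1 mulg1 (pi_part2 m) // mul1g.
  by rewrite (constt_p_elt (p_elt_constt _ _)) consttC.
apply/eqP; rewrite eqn_leq; apply/andP; split.
  rewrite -(card_in_imset (can_in_inj (fun p Pp => (fP p Pp).2))).
  by apply/subset_leq_card/subsetP=> _ /imsetP[p /fP[Pfp _] ->].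
rewrite -(card_in_imset (can_in_inj (fun p Pp => (gP p Pp).2))).
by apply/subset_leq_card/subsetP=> _ /imsetP[p /gP[Pgp _] ->].
Qed.

Lemma card_commuting_r (X Y : {set gT}) :
  #|[set p : gT * gT | [&& p.1 \in X, p.2 \in Y & (p.1 * p.2 == p.2 * p.1)%g]]|
    = (\sum_(z in Y) #|[set x in X | (x * z == z * x)%g]|)%N.
Proof.
rewrite card_commuting (eq_bigr (fun x => \sum_(z in Y | (x * z == z * x)%g) 1)%N); last first.
  by move=> x _; rewrite -sum1_card; apply: eq_bigl => z; rewrite inE.
rewrite (exchange_big_dep (mem Y)) /=; last by move=> x z _ /andP[].
apply: eq_bigr => z Yz; rewrite -sum1_card; apply: eq_bigl => x.
by rewrite !inE Yz.
Qed.

(** Column orthogonality with dual functions in place of conjugate characters: expand the indicator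
    of the class of [m] in the basis [Ipis pi M]. *)
Lemma Ipis_column m x :
    m \in pi_elements pi M ->
  \sum_(theta <- Ipis pi M) theta x * (dual pi theta m)^* = #|'C_M[m]|%:R *+ (x \in m ^: M).
Proof.
move=> Mom; have /setIdP[Mm pi_m] := Mom.
have on_m : '1_(m ^: M) \in 'CF(M, pi_elements pi M).
  apply: cfun_onS (cfuni_on _ _); apply/subsetP=> _ /imsetP[g Mg ->].
  by rewrite inE groupJ //= p_eltJ.
have nzM : #|m ^: M|%:R != 0 :> algC.
  by rewrite pnatr_eq0 cards_eq0; apply/set0Pn; exists m; apply: class_refl.
have Dmult (theta : 'CF(M)) : mult pi theta '1_(m ^: M) = #|'C_M[m]|%:R^-1 * (dual pi theta m)^*.
  rewrite /mult (cfdotEl _ (cfuni_on _ _)).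
  rewrite (eq_bigr (fun _ => (dual pi theta m)^*)) => [|u mMu]; last first.
    rewrite cfun_classE Mm mMu mul1r; have /imsetP[g Mg ->] := mMu.
    by rewrite cfunJ.
  rewrite sumr_const -(mulr_natl (dual pi theta m)^*) mulrA; congr (_ * _).
  by rewrite -(Lagrange (subsetIl M 'C[m])) index_cent1 natrM invfM mulfVK.
have := congr1 (fun f : 'CF(M) => f x) (Ipis_sum_mult fongM on_m).
rewrite /= cfun_classE Mm /= sum_cfunE => Dx; rewrite -[RHS]mulr_natr Dx mulr_sumr.
apply: eq_bigr => theta _; rewrite cfunE Dmult.
by rewrite -[X in _ = _ * X]mulrA mulVKf ?neq0CG // mulrC.
Qed.

(** The number of fixed members is the trace of conjugation by [y] in the basis [Ipis pi M]; column
    orthogonality evaluates that trace as a count of commuting pairs. *)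
Lemma card_fixed_Ipis :
  (#|M| * count (fun theta => (theta ^ y)%CF == theta) (Ipis pi M))%N
   = #|[set p : gT * gT |
        [&& p.1 \in M :* y, p.2 \in pi_elements pi M & (p.1 * p.2 == p.2 * p.1)%g]]|.
Proof.
rewrite card_commuting_r; apply/eqP; rewrite -(eqr_nat algC) natrM; apply/eqP.
rewrite -sum1_count natr_sum.
transitivity (#|M|%:R * \sum_(theta <- Ipis pi M) mult pi theta (theta ^ y)%CF).
  congr (_ * _); rewrite big_mkcond /= big_seq [RHS]big_seq; apply: eq_bigr => theta /IpisP Itheta.
  by rewrite mult_Ipi //; [case: eqP | apply: IpiJ].
rewrite (eq_bigr (fun theta => #|M|%:R^-1 *
  \sum_(m in M) (theta ^ y)%CF m * (dual pi theta m)^*)) // -mulr_sumr mulVKf ?neq0CG //.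
rewrite exchange_big natr_sum (bigID (mem (pi_elements pi M))) /= addrC big1 ?add0r.
  apply: eq_big => [m | m /andP[Mm Mom]]; first by rewrite !inE; case: (m \in M).
  rewrite (eq_bigr (fun theta : 'CF(M) => theta (m ^ y^-1)%g * (dual pi theta m)^*)); last first.
    by move=> theta _; rewrite cfConjgE.
  rewrite Ipis_column //.
  have nMV : (y^-1 \in 'N(M))%g by rewrite groupV.
  have [/imsetP[g Mg Dg] | m'M] := boolP (m ^ y^-1 \in m ^: M)%g.
    congr _%:R; rewrite -(card_rcoset _ (g * y)); apply: eq_card => z.
    have Cgy : (g * y \in 'C[m])%g.
      by apply/cent1P/commute_sym/commgP/conjg_fixP; rewrite conjgM -Dg conjgKV.
    rewrite inE !mem_rcoset in_setI; congr (_ && _).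
      by rewrite invMg mulgA groupMr ?groupV.
    by rewrite groupMr ?groupV //; apply/cent1P/eqP.
  apply/esym/eqP; rewrite pnatr_eq0 cards_eq0; apply/eqP/setP=> z; rewrite !inE.
  apply: contraNF m'M => /andP[/rcosetP[g Mg ->] /eqP cgy].
  apply/imsetP; exists g => //; apply: (canLR (conjgK y)).
  by rewrite -conjgM; apply/esym/conjg_fixP/commgP.
move=> m /andP[Mm m'o]; rewrite big_seq big1 // => theta /IpisP/IpiJ/Ipi_pchar/pchar_on/cfun_on0->//.
by rewrite mul0r.
Qed.

Lemma card_coset_classes_fixed :
  #|classes E ::&: A| = count (fun theta => (theta ^ y)%CF == theta) (Ipis pi M).
Proof.
apply/eqP; rewrite -(eqn_pmul2l (cardG_gt0 M)) card_fixed_Ipis -card_commuting_swap.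
rewrite card_coset_classes card_commuting; apply/eqP/eq_bigr => z _.
by apply: eq_card => m; rewrite in_setI [in RHS]inE; congr (_ && _); apply/cent1P/eqP; apply: commute_sym.
Qed.

End CosetCount.

Section Conjugation.

Variables (gT : finGroupType) (A B : {group gT}) (m : gT).
Hypothesis defB : A :^ m = B.

Lemma conj_isom_proof : isom A B (conjgm A m).
Proof.
apply/isomP; split; first exact: injm_conj.
by rewrite morphim_conj setIid defB.
Qed.

(** Transport between two different groups, whereas [cfConjg] stays on a group that the element
    normalises. *)
Definition cfJ (f : 'CF(A)) : 'CF(B) := cfIsom conj_isom_proof f.

Lemma cfJE f x : cfJ f x = f (x ^ m^-1)%g.
Proof.
have [Ax | A'x] := boolP (x ^ m^-1 \in A)%g.
  by rewrite -{1}(conjgKV m x) -[LHS]/(cfJ f (conjgm A m (x ^ m^-1)%g)) cfIsomE.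
by rewrite !cfun0 // -defB mem_conjg.
Qed.

Lemma cfJ_cfdot f g : '[cfJ f, cfJ g] = '[f, g].
Proof. exact: cfIsom_iso. Qed.

Lemma cfJM f g : cfJ (f * g) = cfJ f * cfJ g.
Proof. exact: rmorphM. Qed.

Lemma pchar_cfJ pi f : pchar pi f -> pchar pi (cfJ f).
Proof.
case=> chi Nchi ->; exists (cfJ chi); first by rewrite /cfJ cfIsom_char.
have memB x : (x \in B) = (x ^ m^-1 \in A)%g by rewrite -defB mem_conjg.
by apply/cfunP=> x; rewrite cfJE !cfpiE !inE p_eltJ memB cfJE.
Qed.

Lemma cfRes_cfJ (M : {group gT}) f :
  M \subset A -> m \in 'N(M) -> 'Res[M] (cfJ f) = ('Res[M] f ^ m)%CF.
Proof.
move=> sMA nMm; have sMB : M \subset B by rewrite -defB -(normP nMm) conjSg.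
apply/cfun_inP=> x Mx; rewrite cfResE // cfJE cfConjgE // cfResE //.
by rewrite memJ_norm ?groupV.
Qed.

Lemma cfInd_cfJ (N : {group gT}) f :
  A \subset N -> m \in N -> 'Ind[N] (cfJ f) = 'Ind[N] f.
Proof.
move=> sAN Nm; have sBN : B \subset N by rewrite -defB conj_subG.
apply/cfun_inP=> x Nx; rewrite !cfIndE // (_ : #|B| = #|A|); last by rewrite -defB cardJg.
congr (_ * _).
rewrite (reindex_inj (mulIg m)) /=; apply: eq_big => [z | z _].
  by rewrite groupMr.
by rewrite cfJE conjgM conjgK.
Qed.

End Conjugation.

Section CosetIndicator.

Variables (gT : finGroupType) (E M : {group gT}) (y : gT).
Hypotheses (nsME : M <| E) (defE : (M * <[y]>)%g = E).

Let Ey : y \in E. Proof. by rewrite -defE (subsetP (mulG_subr _ _)) ?cycle_id. Qed.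
Let nMy : y \in 'N(M). Proof. exact: subsetP (normal_norm nsME) _ Ey. Qed.

(** The indicator of [M :* y], by the second orthogonality relation in the abelian group [E / M].
    Its form as a combination of linear characters turns products with it into combinations of
    characters. *)
Definition coset_ind : 'CF(E) :=
  #|(E / M)%g|%:R^-1 *: \sum_i ('chi[E / M]_i (coset M y))^* *: ('chi_i %% M)%CF.

Lemma cyclic_quotient : cyclic (E / M)%g.
Proof. by rewrite -defE quotientMidl quotient_cycle // cycle_cyclic. Qed.

Lemma coset_indE x : x \in E -> coset_ind x = (x \in M :* y)%:R.
Proof.
move=> Ex; have nMx := subsetP (normal_norm nsME) x Ex.
have abEM := cyclic_abelian cyclic_quotient.
have EMx : coset M x \in (E / M)%g by apply: mem_quotient.
have EMy : coset M y \in (E / M)%g by apply: mem_quotient.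
rewrite cfunE sum_cfunE (eq_bigr (fun i => 'chi[E / M]_i (coset M x) * ('chi_i (coset M y))^*)).
  rewrite second_orthogonality_relation //.
  have -> : 'C_(E / M)[coset M x] = (E / M)%g.
    by apply/setIidPl; rewrite sub_cent1 (subsetP abEM).
  have -> : (coset M x \in coset M y ^: (E / M)) = (x \in M :* y).
    apply/imsetP/rcoset_kercosetP => // [[g EMg ->] | ->].
      by apply/conjg_fixP/commgP; apply: (centsP abEM).
    by exists 1%g; rewrite ?conjg1.
  by case: (x \in _); rewrite ?mulr1n ?mulr0n ?mulr0 // mulVf ?neq0CG.
by move=> i _; rewrite cfunE cfModE // mulrC.
Qed.

End CosetIndicator.

Section CosetExtension.

Variables (gT : finGroupType) (pi : nat_pred) (E M S W : {group gT}) (y : gT).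
Variables (theta : 'CF(M)) (gamma : 'CF(W)).
Hypotheses (sepE : pi_sep pi E) (nsME : M <| E) (defE : (M * <[y]>)%g = E).
Hypothesis piEM : pi.-nat #|E : M|.
Hypotheses (fongM : fong pi M) (Itheta : Ipi pi M theta).
Hypothesis nuc : nucleus pi 'I_E[theta] S theta gamma.
Hypothesis IthetaE : E \subset 'I[theta].

Local Notation kappa := (coset_ind E M y).

(** [S / W] is cyclic, so [gamma] extends to some [chi], and [d] is induced from [chi] on a Hall
    subgroup. Expanding [kappa] into linear characters pairs [chi] with its twists, which are good;
    only the trivial twist survives. *)
Lemma coset_extension :
  exists2 chi, chi \in irr S /\ 'Res[W] chi = gamma &
    exists2 d, '[cfpi pi ('Ind[E] chi) * kappa, d] != 0 &
      forall t, pchar pi t -> mult pi theta ('Res[M] t) = 0 -> '[t * kappa, d] = 0.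
Proof.
have nsWS := nuc_normal nsME nuc; have irr_g := nuc_irr nuc.
have [sSE sWM] := (nuc_subN nuc, nuc_subM nuc).
have defSM : (S * M)%g = E by rewrite (nuc_mul nuc); apply/setIidPl.
have Ey : y \in E by rewrite -defE (subsetP (mulG_subr _ _)) ?cycle_id.
have nME := subsetP (normal_norm nsME).
have [z Sz [m Mm Dy]] : exists2 z, z \in S & exists2 m, m \in M & y = (m * z)%g.
  have := Ey; rewrite -defSM normC ?(subset_trans sSE) ?normal_norm //.
  by case/mulsgP=> m z Mm Sz ->; exists z => //; exists m.
have defS : (W * <[z]>)%g = S.
  apply/eqP; rewrite eqEsubset mul_subG ?(normal_sub nsWS) ?cycle_subG //=.
  apply/subsetP=> s Ss; have Es := subsetP sSE s Ss.
  have Ez := subsetP sSE z Sz.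
  have defE' : (M * <[z]>)%g = E.
    apply/eqP; rewrite eqEsubset mul_subG ?(normal_sub nsME) ?cycle_subG //=.
    rewrite -norm_joinEr ?cycle_subG ?nME // -{1}defE.
    rewrite mul_subG ?joing_subl // cycle_subG Dy groupM //.
      by rewrite (subsetP (joing_subl _ _)).
    by rewrite (subsetP (joing_subr _ _)) ?cycle_id.
  have := Es; rewrite -defE' => /mulsgP[u v Mu Zv Ds]; rewrite Ds mem_mulg //.
  rewrite (nuc_cap nuc) inE Mu andbT.
  have Sv : v \in S by apply: subsetP Zv; rewrite cycle_subG.
  by rewrite -(groupMr _ Sv) -Ds.
have [chi irr_chi chiW] := cyclic_invariant_irr_extendible nsWS defS irr_g (nuc_inv nuc).
exists chi => //.
have [|H hallH] := @pi_sep_Hall _ pi S; first exact: pi_sepS sepE.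
have [sHS piH] := (pHall_sub hallH, pHall_pgroup hallH).
have sHE := subset_trans sHS sSE.
pose lam i := ('chi[E / M]_i %% M)%CF; pose l i := 'Res[S] (lam i).
have lin_lam i : lam i \is a linear_char.
  by apply/cfMod_lin_char/irr_cyclic_lin/(cyclic_quotient nsME defE).
have lin_l i : l i \is a linear_char by apply: cfRes_lin_char.
have lW i : 'Res[W] (l i) = 1.
  rewrite cfResRes ?(normal_sub nsWS) // cfRes_sub_ker.
    by rewrite lin_char1 // scale1r.
  by rewrite (subset_trans sWM) // cfker_mod.
have good_l i : good pi E M gamma (chi * l i).
  apply: (good_pi nsME nuc piEM).
    by rewrite mulrC mul_lin_irr.
  by exists 1%N; rewrite // rmorphM /= lW chiW mulr1 scale1r.
have irr_l i : chi * l i \in irr S by case: (good_l i).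
have goodchi : good pi E M gamma chi.
  by apply: (good_pi nsME nuc piEM) => //; exists 1%N; rewrite // scale1r.
have piEM' : pi_or_pi' pi #|E : M| by rewrite /pi_or_pi' piEM.
have sepH := good_Ind_dot sepE nsME piEM' fongM Itheta nuc hallH goodchi.
pose d := 'Ind[E] ('Res[H] chi).
have dotE t : '[t * kappa, d] = #|(E / M)%g|%:R^-1 *
    \sum_i ('chi[E / M]_i (coset M y))^* * '['Res[H] (t * lam i), 'Res[H] chi].
  rewrite /coset_ind -scalerAr cfdotZl mulr_sumr cfdot_suml; congr (_ * _).
  by apply: eq_bigr => i _; rewrite -scalerAr cfdotZl cfdot_Res_l.
(* Gallagher: distinct characters of [S / W] give distinct twists of an extension of [gamma]. A
   linear character of [E / M] trivial on [S] is trivial because [E] is [S * M]. *)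
have l_inj i : chi * l i = chi -> i = 0.
  move=> eq_chi; have [[c Dc] [s Ds]] := (irrP irr_chi, irrP irr_g).
  have cW : 'Res[W] 'chi_c = 'chi_s by rewrite -Dc chiW.
  have [_ inj_mul _ _] := constt_Ind_ext nsWS cW.
  have kerW : W \subset cfker (l i).
    by rewrite -subsetIidl -cfker_Res ?(normal_sub nsWS) ?lin_charW // lW cfker_cfun1.
  pose b := cfIirr (l i / W)%CF.
  have Db : 'chi_b = (l i / W)%CF by rewrite cfIirrE // lin_char_irr ?cfQuo_lin_char.
  have b0 : b = 0.
    apply: inj_mul; rewrite /mul_mod_Iirr /mul_Iirr !mod_IirrE // Db irr0 cfMod_cfun1.
    by rewrite cfQuoK // mul1r -Dc mulrC eq_chi.
  have l1 : l i = 1 by rewrite -(cfQuoK nsWS kerW) -Db b0 irr0 cfMod_cfun1.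
  apply/eqP; rewrite -irr_eq1 -(cfMod_eq1 _ nsME) -/(lam i); apply/eqP/cfun_inP=> g.
  rewrite -{1}defSM => /mulsgP[u m' Su Mm' ->].
  have [Eu Em'] := (subsetP sSE u Su, subsetP (normal_sub nsME) m' Mm').
  rewrite lin_charM // -(cfResE _ sSE Su) -/(l i) l1 !cfun1E Su groupM // mul1r.
  by rewrite cfker1 ?lin_char1 // (subsetP (cfker_mod _ nsME)).
exists d => [|t Pt t0].
  rewrite dotE mulf_neq0 ?invr_eq0 ?neq0CG // (bigD1 0) //= big1 ?addr0.
    rewrite irr0 cfun1E mem_quotient // conjC1 mul1r /lam irr0 cfMod_cfun1 mulr1.
    by rewrite sepH // eqxx oner_eq0.
  move=> i nz_i; rewrite cfpiMl -cfIndM // -/(l i) sepH //.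
  by case: eqP => [eq_chi | _]; [rewrite (l_inj i eq_chi) eqxx in nz_i | rewrite mulr0].
rewrite dotE big1 ?mulr0 // => i _.
have Plam : pchar pi (t * lam i).
  have [psi Npsi ->] := Pt; rewrite cfpiMl; apply/pchar_cfpi/rpredM => //.
  exact/lin_charW/lin_lam.
rewrite (good_dot0 sepE nsME piEM' fongM Itheta nuc hallH Plam goodchi) ?mulr0 //.
have lamM : 'Res[M] (lam i) = 1.
  by rewrite cfRes_sub_ker ?cfker_mod // lin_char1 // scale1r.
by rewrite rmorphM /= lamM mulr1.
Qed.

End CosetExtension.

Section CosetFamily.

Variables (gT : finGroupType) (pi : nat_pred) (N M : {group gT}) (U : {vspace 'CF(N)}).
Hypotheses (sepN : pi_sep pi N) (nsMN : M <| N) (piNM : pi.-nat #|N : M|).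
Hypothesis fongM : fong pi M.

(* It is enough to control one member of each N-orbit in Ipi pi M. *)
Hypothesis spanU : forall theta, Ipi pi M theta ->
  exists2 n, n \in N &
  exists (S W : {group gT}) (gamma : 'CF(W)),
    nucleus pi 'I_N[(theta ^ n)%CF] S (theta ^ n)%CF gamma /\
    forall chi : 'CF(S), good pi N M gamma chi -> cfpi pi ('Ind[N] chi) \in U.

(** Only the conjugate of [theta] by [n] has a nucleus under control, so the pair is built for
    [E :^ n] and [y ^ n] and carried back by [cfJ], which does not change the function induced to
    [N]. *)
Lemma coset_family (E : {group gT}) y theta :
    y \in N -> (M * <[y]>)%g = E -> Ipi pi M theta -> (theta ^ y)%CF = theta ->
  exists t d : 'CF(E),
    [/\ pchar pi t /\ 'Res[M] t = theta, 'Ind[N] (t * coset_ind E M y) \in U,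
        '[t * coset_ind E M y, d] != 0
      & forall t', pchar pi t' -> mult pi theta ('Res[M] t') = 0 ->
          '[t' * coset_ind E M y, d] = 0].
Proof.
move=> Ny defE Itheta fix_theta; have [n Nn [S [W [gamma [nuc goodU]]]]] := spanU Itheta.
have sMN := normal_sub nsMN; have nMN := subsetP (normal_norm nsMN).
pose y' := (y ^ n)%g; pose E' := (E :^ n)%G.
have defE' : (M * <[y']>)%g = E'.
  by rewrite /= -defE conjsMg cycleJ (normP (nMN n Nn)).
have sEN : E \subset N by rewrite -defE mul_subG ?cycle_subG.
have sE'N : E' \subset N by rewrite conj_subG.
have sME : M \subset E by rewrite -defE mulG_subl.
have sME' : M \subset E' by rewrite -defE' mulG_subl.
have nsME : M <| E := normalS sME sEN nsMN.
have nsME' : M <| E' := normalS sME' sE'N nsMN.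
have Ipi_n : Ipi pi M (theta ^ n)%CF by apply: IpiJ.
have piE'M : pi.-nat #|E' : M| by apply: pnat_dvd piNM; apply: indexSg.
have Ny' : y' \in N by rewrite groupJ.
have IE' : E' \subset 'I[(theta ^ n)%CF].
  rewrite -defE' mul_subG ?sub_inertia // cycle_subG inE nMN //=.
  rewrite -!(cfConjgM _ nsMN) // /y' conjgE !mulgA mulgV mul1g (cfConjgM _ nsMN) //.
  by rewrite fix_theta.
have sepE' := pi_sepS sE'N sepN.
have sWM := nuc_subM nuc; have irr_g := nuc_irr nuc.
have nucE : nucleus pi 'I_E'[(theta ^ n)%CF] (S :&: E')%G (theta ^ n)%CF gamma.
  case: nuc => defT defW _ Ig Dth detg fg; split=> //.
  - by rewrite /= setIC group_modr // defT setIA (setIidPl sE'N).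
  - by rewrite /= -setIA (setIidPr sME').
  by rewrite (subset_trans (subsetIl _ _)).
have [chi [irr_chi chiW] [d nz_d d0]] := coset_extension sepE' nsME' defE' piE'M fongM Ipi_n nucE IE'.
have defEV : E' :^ n^-1 = E by rewrite /= conjsgK.
have nMnV : (n^-1)%g \in 'N(M) by rewrite groupV nMN.
pose t' := cfpi pi ('Ind[E'] chi).
have Pt' : pchar pi t' by apply/pchar_cfpi/cfInd_char/irrWchar.
have Rest' : 'Res[M] t' = (theta ^ n)%CF.
  rewrite (@nuc_Res_Ind _ _ _ _ _ _ _ _ nsME' nucE _ 1) ?scale1r //.
  rewrite (setIidPl IE') (eq_bigr (fun=> theta ^ n)%CF) => [|e Ee]; last first.
    by rewrite inertiaJ ?(subsetP IE').
  by rewrite sumr_const -scaler_nat scalerA mul1r mulVf ?scale1r ?neq0CG.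
have kappaJ : cfJ defEV (coset_ind E' M y') = coset_ind E M y.
  apply/cfun_inP=> x Ex; rewrite cfJE invgK !coset_indE //; last by rewrite memJ_conjg.
  by rewrite !mem_rcoset -conjVg -conjMg memJ_norm ?nMN.
exists (cfJ defEV t'), (cfJ defEV d); split.
- split; first exact: pchar_cfJ.
  by rewrite cfRes_cfJ // Rest' cfConjgK.
- rewrite -kappaJ -cfJM cfInd_cfJ ?groupV //.
  (* Expanding the indicator leaves twists of [chi] on [S :&: E']. Induced to [S], they have all
     their constituents over [gamma], and these are good because [N / M] is a pi-group. *)
  rewrite /coset_ind -scalerAr linearZ memvZ // mulr_sumr linear_sum memv_suml // => i _.
  rewrite -scalerAr linearZ memvZ //= cfpiMl -cfIndM ?subsetIr //.
  rewrite cfpiInd // cfIndInd ?subsetIr //.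
  set psi := _ * _; have sSN := nuc_subN nuc.
  have sSES : S :&: E' \subset S := subsetIl _ _.
  have sWSE : W \subset S :&: E' by rewrite subsetI (normal_sub (nuc_normal nsMN nuc)) (subset_trans sWM).
  have [[k Dk] [s Ds]] : (exists k, psi = 'chi_k) /\ exists s, gamma = 'chi_s.
    split; apply/irrP => //; rewrite /psi mulrC mul_lin_irr //.
    by apply/cfRes_lin_char/cfMod_lin_char/irr_cyclic_lin/(cyclic_quotient nsME' defE').
  have psiW : 'Res[W] 'chi_k = 'chi_s.
    rewrite -Dk -Ds rmorphM /= chiW cfResRes ?subsetIr // cfRes_sub_ker.
      rewrite lin_char1 ?scale1r ?mulr1 //.
      exact/cfMod_lin_char/irr_cyclic_lin/(cyclic_quotient nsME' defE').
    by rewrite (subset_trans sWM) ?cfker_mod.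
  rewrite -(cfIndInd _ sSN sSES) ['Ind[S] psi]cfun_sum_constt linear_sum /cfpi mulr_suml.
  rewrite memv_suml // => j Sj; rewrite linearZ -scalerAl memvZ //; apply: goodU.
  apply: (good_constt nsMN nuc piNM).
  rewrite Ds constt_Ind_Res -(cfResRes _ sWSE sSES).
  have Rk : k \in irr_constt ('Res[S :&: E'] 'chi_j) by rewrite -constt_Ind_Res -Dk.
  apply: (constt_Res_trans _ Rk); first exact/cfRes_char/irr_char.
  by rewrite psiW constt_irr inE.
- by rewrite -kappaJ -cfJM cfJ_cfdot.
move=> t Pt t0; rewrite -kappaJ.
have defEn : E :^ n = E' by [].
have -> : t = cfJ defEV (cfJ defEn t) by apply/cfunP=> x; rewrite !cfJE invgK conjgK.
rewrite -cfJM cfJ_cfdot d0 //; first exact: pchar_cfJ.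
rewrite cfRes_cfJ ?nMN // multJ //.
exact/pchar_on/pcharRes.
Qed.

End CosetFamily.

Lemma mem_pi'_index (gT : finGroupType) (pi : nat_pred) (N M : {group gT}) x :
  M <| N -> pi^'.-nat #|N : M| -> x \in N -> pi.-elt x -> x \in M.
Proof.
case/andP=> sMN nMN pi'NM Nx pi_x; have nMx := subsetP nMN x Nx.
rewrite -(ker_coset M); apply/kerP => //; apply/eqP; rewrite -order_eq1.
apply/eqP/(@pnat_1 pi); first exact: morph_p_elt.
apply: (@mem_p_elt _ _ _ (N / M)); last by rewrite mem_quotient.
by rewrite /pgroup card_quotient.
Qed.

Section Spanning.

Variables (gT : finGroupType) (pi : nat_pred) (N M : {group gT}) (U : {vspace 'CF(N)}).
Hypotheses (sepN : pi_sep pi N) (nsMN : M <| N).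
Hypothesis fongM : fong pi M.
Hypothesis spanU : forall theta, Ipi pi M theta ->
  exists2 n, n \in N &
  exists (S W : {group gT}) (gamma : 'CF(W)),
    nucleus pi 'I_N[(theta ^ n)%CF] S (theta ^ n)%CF gamma /\
    forall chi : 'CF(S), good pi N M gamma chi -> cfpi pi ('Ind[N] chi) \in U.

(** The functions [t * kappa], one for each member of [Ipi pi M] fixed by [y], are free, and there
    are as many of them as classes of [E] in [A]. So they span the class functions on [A], and
    induction to [N] lands in [U]. *)
Lemma cfuni_class_span y :
    pi.-nat #|N : M| -> y \in pi_elements pi N -> '1_(y ^: N) \in U.
Proof.
move=> piNM /setIdP[Ny pi_y]; have [sMN nMN] := andP nsMN.
pose E := (M <*> <[y]>)%G.
have nMy : <[y]> \subset 'N(M) by rewrite cycle_subG (subsetP nMN).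
have defE : (M * <[y]>)%g = E by rewrite /= norm_joinEr.
have sEN : E \subset N by rewrite -defE mul_subG ?cycle_subG.
have sME : M \subset E := joing_subl _ _.
have nsME : M <| E := normalS sME sEN nsMN.
have Ey : y \in E by rewrite (subsetP (joing_subr _ _)) ?cycle_id.
have piEM : pi.-nat #|E : M| by apply: pnat_dvd piNM; apply: indexSg.
pose A := pi_elements pi E :&: (M :* y).
pose kappa := coset_ind E M y.
pose X := [seq theta <- Ipis pi M | (theta ^ y)%CF == theta].
have XP theta : theta \in X -> Ipi pi M theta /\ (theta ^ y)%CF = theta.
  by rewrite mem_filter => /andP[/eqP ? /IpisP].
pose good_pair (theta : 'CF(M)) (td : 'CF(E) * 'CF(E)) :=
  [/\ pchar pi td.1 /\ 'Res[M] td.1 = theta, 'Ind[N] (td.1 * kappa) \in U,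
        '[td.1 * kappa, td.2] != 0
      & forall t', pchar pi t' -> mult pi theta ('Res[M] t') = 0 ->
          '[t' * kappa, td.2] = 0].
have /choice[td tdP] : forall theta, exists td, theta \in X -> good_pair theta td.
  move=> theta; have [/XP[It fix_t] | _] := boolP (theta \in X); last by exists (0, 0).
  have [t [d td]] := coset_family sepN nsMN piNM fongM spanU Ny defE It fix_t.
  by exists (t, d).
pose u theta := (td theta).1 * kappa; pose Us := [seq u theta | theta <- X].
have uA theta : theta \in X -> u theta \in 'CF(E, A).
  case/tdP=> [[/pchar_on t_on _] _ _ _]; apply/cfun_onP=> x A'x; rewrite cfunE.
  have [Ex | E'x] := boolP (x \in E); last by rewrite cfun0 ?mul0r.
  have [Eox | Eo'x] := boolP (x \in pi_elements pi E); last by rewrite (cfun_on0 t_on) ?mul0r.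
  rewrite coset_indE //; have := A'x; rewrite inE Eox /= => /negPf->.
  exact: mulr0.
have uniqX : uniq X by rewrite filter_uniq ?Ipis_uniq.
have sizeUs : size Us = size X by rewrite size_map.
have freeUs : free Us.
  rewrite -[Us]/(tval (in_tuple Us)); apply/freeP => /= k sum0 i.
  have lt_i : (i < size X)%N by rewrite -sizeUs.
  pose th j := nth 0 X j; have XP' j : (j < size X)%N -> th j \in X by apply: mem_nth.
  have nth_Us j : (j < size X)%N -> Us`_j = u (th j) by move=> lt_j; rewrite (nth_map 0).
  have [_ _ nz_i i0] := tdP _ (XP' _ lt_i).
  have := congr1 (fun f => '[f, (td (th i)).2]) sum0.
  rewrite cfdot0l cfdot_suml (bigD1 i) //= cfdotZl nth_Us // big1 ?addr0.
    by move/eqP; rewrite mulf_eq0 (negPf nz_i) orbF => /eqP.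
  move=> j neq_ji; have lt_j : (j < size X)%N by rewrite -sizeUs.
  rewrite cfdotZl nth_Us //; have [[Pt Dt] _ _ _] := tdP _ (XP' _ lt_j).
  have [[Ii _] [Ij _]] := (XP _ (XP' _ lt_i), XP _ (XP' _ lt_j)).
  rewrite /u i0 ?mulr0 // Dt mult_Ipi // nth_uniq //.
  by rewrite (_ : (j == i :> nat) = false) //; apply: negPf.
have spanUs : 'CF(E, A) = <<Us>>%VS.
  apply/esym/eqP; rewrite eqEdim; apply/andP; split.
    by apply/span_subvP=> _ /mapP[theta Xt ->]; apply: uA.
  rewrite dim_cfun_on (eqP (freeUs : \dim _ == _)) sizeUs size_filter.
  by rewrite (card_coset_classes_fixed nsME defE piEM fongM).
have IndU f : f \in 'CF(E, A) -> 'Ind[N] f \in U.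
  rewrite spanUs => /(@coord_span _ _ _ (in_tuple Us)) ->.
  rewrite linear_sum memv_suml // => i _; rewrite linearZ memvZ //=.
  have: Us`_i \in Us by apply: mem_nth; case: i.
  by case/mapP=> theta /tdP[_ tU _ _] ->.
have clA : y ^: E \subset A.
  rewrite (coset_class nsME defE (rcoset_refl _ _)); apply/subsetP=> _ /imsetP[m Mm ->].
  have Em := subsetP sME m Mm.
  rewrite in_setI inE groupJ //= p_eltJ pi_y mem_rcoset conjgE /=.
  have -> : (m^-1 * (y * m) * y^-1 = m^-1 * m ^ y^-1)%g by rewrite conjgE invgK !mulgA.
  by rewrite groupM ?groupV // memJ_norm ?groupV // -cycle_subG.
have /IndU : '1_(y ^: E) \in 'CF(E, A) by apply: cfun_onS clA (cfuni_on _ _).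
(* The function induced from the indicator of [y ^: E] lives on [y ^: N] and is positive at [y],
   hence is a nonzero multiple of the indicator wanted. *)
set f := 'Ind[N] _.
have f_y : f y != 0.
  rewrite cfIndE // mulf_neq0 ?invr_eq0 ?neq0CG // (bigD1 1%g) //= conjg1.
  rewrite cfun_classE Ey class_refl gt_eqF // ltr_pwDl ?ltr01 // sumr_ge0 // => z _.
  by rewrite cfun_classE ler0n.
have -> : f = f y *: '1_(y ^: N).
  apply/cfun_inP=> x Nx; rewrite [RHS]cfunE cfun_classE Ny /=.
  have [/imsetP[g Ng ->] | y'x] := boolP (x \in _); first by rewrite cfunJ ?mulr1.
  rewrite mulr0 cfIndE // big1 ?mulr0 // => z Nz; rewrite cfun_classE Ey /=.
  case: imsetP => // [[e Ee Dxz]]; case/imsetP: y'x; exists (e * z^-1)%g.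
    by rewrite groupM ?groupV // (subsetP sEN).
  by rewrite conjgM -Dxz conjgK.
by rewrite rpredZeq (negPf f_y).
Qed.

(** For a pi'-quotient every pi-element of [N] lies in [M], so functions on pi-elements are
    determined on [M]. There ['Ind[N] theta] and the function from a good character are both
    multiples of the orbit sum. *)
Lemma cfInd_Ipi_span theta :
  pi^'.-nat #|N : M| -> Ipi pi M theta -> 'Ind[N] theta \in U.
Proof.
move=> pi'NM Itheta; have [sMN nMN] := andP nsMN.
have [n Nn [S [W [gamma [nuc goodU]]]]] := spanU Itheta.
have -> : 'Ind[N] theta = 'Ind[N] (theta ^ n)%CF.
  by apply: cfclass_Ind => //; apply/cfclassP; exists n.
have Itn : Ipi pi M (theta ^ n)%CF by apply: IpiJ.
set th := (theta ^ n)%CF in nuc goodU Itn *.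
have piMN : pi_or_pi' pi #|N : M| by rewrite /pi_or_pi' pi'NM orbT.
have [chi g] : exists chi : 'CF(S), good pi N M gamma chi.
  have [piNM | not_pi] := boolP (pi.-nat #|N : M|); last first.
    exact: (good_exists_pi' sepN nsMN piMN nuc not_pi).
  have [i Si] : exists i, i \in irr_constt ('Ind[S] gamma).
    have [s Ds] := irrP (nuc_irr nuc); rewrite Ds.
    by have [i Si] := constt_cfInd_irr s (normal_sub (nuc_normal nsMN nuc)); exists i.
  by exists 'chi_i; apply: (good_constt nsMN nuc piNM).
have [_ [e e_gt0 chiW] _ _] := g.
have sIoM := mem_pi'_index nsMN pi'NM.
have Res0 (f : 'CF(N)) : f \in 'CF(N, pi_elements pi N) -> 'Res[M] f = 0 -> f = 0.
  move=> f_on fM0; apply/cfun_inP=> x Nx; rewrite cfunE.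
  have [pi_x | pi'x] := boolP (pi.-elt x); last by rewrite (cfun_on0 f_on) // inE negb_and pi'x orbT.
  by rewrite -(cfResE f sMN (sIoM x Nx pi_x)) fM0 cfunE.
pose a := e%:R / #|'I_N[th]|%:R : algC.
have nz_a : a != 0 by rewrite mulf_neq0 ?invr_eq0 ?pnatr_eq0 -?lt0n ?cardG_gt0.
have -> : 'Ind[N] th = (#|M|%:R^-1 / a) *: cfpi pi ('Ind[N] chi).
  apply/eqP; rewrite -subr_eq0; apply/eqP/Res0.
    apply: rpredB; last by rewrite memvZ ?cfpi_on.
    by rewrite (nuc_ind nuc) cfpiInd // cfpi_on.
  rewrite linearB linearZ /= (nuc_Res_Ind nsMN nuc chiW) -/a scalerA divfK //.
  apply/eqP; rewrite subr_eq0; apply/eqP/cfun_inP=> x Mx.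
  rewrite cfResE // cfIndE // cfunE sum_cfunE; congr (_ * _).
  rewrite [LHS](reindex_inj invg_inj) /=; apply: eq_big => [z | z Nz]; first exact: groupV.
  by rewrite cfConjgE // (subsetP nMN) // -groupV.
by rewrite memvZ ?goodU.
Qed.

Lemma good_span : pi_or_pi' pi #|N : M| -> ('CF(N, pi_elements pi N) <= U)%VS.
Proof.
move=> piMN; have [piNM | not_pi] := boolP (pi.-nat #|N : M|).
  rewrite cfun_on_sum; apply/subv_sumP => _ /andP[/imsetP[y Ny ->] sy].
  rewrite -memvE; apply: cfuni_class_span => //.
  by rewrite (subsetP sy) ?class_refl.
have pi'NM : pi^'.-nat #|N : M| by have /orP[/idPn[]|] := piMN.
have [sMN nMN] := andP nsMN.
apply/subvP=> f f_on.
have sIoM := mem_pi'_index nsMN pi'NM.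
(* [f] vanishes off the normal subgroup [M], so restricting to [M] and inducing back multiplies it
   by the index. *)
have -> : f = #|N : M|%:R^-1 *: 'Ind[N] ('Res[M] f).
  apply/cfun_inP=> x Nx; rewrite cfunE cfIndE //.
  have [Mx | M'x] := boolP (x \in M).
    rewrite (eq_bigr (fun _ => f x)) => [|z Nz]; last by rewrite cfResE ?cfunJ // memJ_norm ?(subsetP nMN).
    rewrite sumr_const -(mulr_natl (f x)) -(Lagrange sMN) natrM.
    by rewrite -[_ * _ * f x]mulrA !mulKf ?neq0CG ?neq0CiG.
  rewrite (cfun_on0 f_on); last by rewrite inE Nx; apply: contra M'x; apply: sIoM.
  rewrite big1 ?mulr0 // => z Nz; rewrite cfun0 //.
  by rewrite memJ_norm ?(subsetP nMN).
rewrite memvZ //; have fM_on : 'Res[M] f \in 'CF(M, pi_elements pi M).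
  by rewrite -(cfpi_onE f_on) cfpiRes // cfpi_on.
rewrite (Ipis_sum_mult fongM fM_on) linear_sum big_seq memv_suml // => theta /IpisP It.
by rewrite linearZ memvZ //; apply: cfInd_Ipi_span.
Qed.

End Spanning.

Lemma span_uniqP (K : fieldType) (vT : vectType K) (X : seq vT) v :
  uniq X -> v \in <<X>>%VS -> exists c : vT -> K, v = \sum_(s <- X) c s *: s.
Proof.
move=> uniqX /(@coord_span _ _ _ (in_tuple X)) Dv.
exists (fun s => oapp (fun i => coord (in_tuple X) i v) 0 (insub (index s X))).
rewrite (big_nth 0) big_mkord [LHS]Dv; apply: eq_bigr => i _; congr (_ *: _).
by rewrite index_uniq // valK.
Qed.

(** * Existence of nuclei *)

Lemma nucleus_sub (gT : finGroupType) (pi : nat_pred) (G N M S W : {group gT})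
    (theta : 'CF(M)) (gamma : 'CF(W)) :
    M \subset N -> N \subset G -> nucleus pi 'I_G[theta] S theta gamma ->
  nucleus pi 'I_N[theta] (S :&: N)%G theta gamma.
Proof.
move=> sMN sNG [defT defW irr_g Ig Dth detg fg]; split=> //.
- by rewrite /= setIC group_modr // defT setIA (setIidPl sNG).
- by rewrite /= -setIA (setIidPr sMN).
by rewrite (subset_trans (subsetIl _ _)).
Qed.

Section NucleusStep.

Variables (gT : finGroupType) (pi : nat_pred) (G N M : {group gT}).
Hypotheses (sepG : pi_sep pi G) (nsNG : N <| G) (nsMG : M <| G) (sMN : M \subset N).
Hypotheses (piMN : pi_or_pi' pi #|N : M|) (fongM : fong pi M).
Hypothesis nucM : forall theta, Ipi pi M theta ->
  exists (S W : {group gT}) (gamma : 'CF(W)), nucleus pi 'I_G[theta] S theta gamma.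

Let sNG : N \subset G. Proof. exact: normal_sub. Qed.
Let sepN : pi_sep pi N. Proof. exact: pi_sepS sepG. Qed.
Let nsMN : M <| N. Proof. exact: normalS nsMG. Qed.

Lemma good_cfConjg (theta : 'CF(M)) (S W : {group gT}) (gamma : 'CF(W)) (chi : 'CF(S :&: N)) s :
    nucleus pi 'I_G[theta] S theta gamma -> good pi N M gamma chi -> s \in S ->
  good pi N M gamma (chi ^ s)%CF.
Proof.
move=> nuc [irr_chi [e e_gt0 chiW] det_chi ext_chi] Ss.
have sSG : S \subset G by apply: (nuc_subN nuc).
have nSNs : s \in 'N(S :&: N).
  by rewrite (subsetP (normsI (normG S) (subset_trans sSG (normal_norm nsNG)))).
have nWs : s \in 'N(W) := subsetP (normal_norm (nuc_normal nsMG nuc)) s Ss.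
have gs : (gamma ^ s)%CF = gamma by rewrite inertiaJ ?(subsetP (nuc_inv nuc)).
have ResW : 'Res[W] (chi ^ s)%CF = ('Res[W] chi ^ s)%CF by rewrite cfConjgRes_norm.
split; first exact: cfConjg_irr.
- by exists e => //; rewrite ResW chiW linearZ /= gs.
- by rewrite cfDetConjg cforder_inj_rmorph //; apply: can_inj (cfConjgK s).
by move=> not_pi; rewrite ResW ext_chi.
Qed.

(* The nuclei attached to the members of one N-orbit need not be related, so
   only those of the orbit representatives rep theta are used. *)
Lemma nucleus_step : exists nf : forall theta : 'CF(M), {SW : {group gT} * {group gT} & 'CF(SW.2)},
  (forall theta, Ipi pi M theta ->
     nucleus pi 'I_G[theta] (projT1 (nf theta)).1 theta (projT2 (nf theta))) /\
  forall xi, Ipi pi N xi -> exists theta,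
    [/\ Ipi pi M theta,
        exists2 chi : 'CF((projT1 (nf theta)).1 :&: N),
          good pi N M (projT2 (nf theta)) chi & xi = cfpi pi ('Ind[N] chi)
      & forall xi', Ipi pi N xi' -> mult pi theta ('Res[M] xi') != 0 ->
          exists2 chi' : 'CF((projT1 (nf theta)).1 :&: N),
          good pi N M (projT2 (nf theta)) chi' & xi' = cfpi pi ('Ind[N] chi')].
Proof.
have /choice[nf nfP] (theta : 'CF(M)) :
    exists d : {SW : {group gT} * {group gT} & 'CF(SW.2)}, Ipi pi M theta ->
      nucleus pi 'I_G[theta] (projT1 d).1 theta (projT2 d).
  have [It | notIt] := asboolP (Ipi pi M theta); last first.
    by exists (existT (fun SW : {group gT} * {group gT} => 'CF(SW.2)) (M, M) theta).
  have [S [W [gamma nuc]]] := nucM It.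
  by exists (existT (fun SW : {group gT} * {group gT} => 'CF(SW.2)) (S, W) gamma).
exists nf; split=> // xi Ixi.
pose S0 theta := (projT1 (nf theta)).1; pose gam theta := projT2 (nf theta).
have nucN theta : Ipi pi M theta -> nucleus pi 'I_N[theta] (S0 theta :&: N)%G theta (gam theta).
  by move=> It; apply: nucleus_sub sMN sNG (nfP _ It).
(* The value of [choose] depends only on the extension of the predicate once the starting point
   satisfies it, so it is constant on orbits. *)
pose rep (theta : 'CF(M)) := choose (mem (theta ^: N)%CF) theta.
have repP theta : rep theta \in (theta ^: N)%CF by apply: chooseP; apply: cfclass_refl.
have repJ theta n : n \in N -> rep (theta ^ n)%CF = rep theta.
  move=> Nn; have Jn : (theta ^ n)%CF \in (theta ^: N)%CF by apply/cfclassP; exists n.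
  have eqm : mem ((theta ^ n) ^: N)%CF =1 mem (theta ^: N)%CF.
    by move=> phi; rewrite /= -(cfclass_transr Jn).
  by rewrite /rep (eq_choose eqm); apply: choose_id; [exact: Jn | exact: cfclass_refl].
have repK theta : rep (rep theta) = rep theta.
  by have /cfclassP[n Nn Dn] := repP theta; rewrite {1}Dn repJ.
have repI theta : Ipi pi M theta -> Ipi pi M (rep theta).
  by move=> It; have /cfclassP[n _ ->] := repP theta; apply: IpiJ.
pose isS theta f := [/\ Ipi pi M theta, rep theta = theta &
  exists2 chi : 'CF(S0 theta :&: N), good pi N M (gam theta) chi & f = cfpi pi ('Ind[N] chi)].
pose X := [seq phi <- Ipis pi N | `[< exists theta, isS theta phi >]].
have XP phi : phi \in X -> exists theta, isS theta phi.
  by rewrite mem_filter => /andP[/asboolP].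
have memX theta phi : isS theta phi -> phi \in X.
  move=> Sphi; rewrite mem_filter; apply/andP; split; first by apply/asboolP; exists theta.
  case: Sphi => It _ [chi g ->]; apply/IpisP.
  exact: (good_Ipi sepN nsMN piMN fongM It (nucN _ It) g).
(* Distinct representatives are not conjugate, so a member of [X] built from another one does not
   lie over [theta] and its pairing vanishes. *)
have dualX theta (chi : 'CF(S0 theta :&: N)) (H : {group gT}) phi :
    Ipi pi M theta -> rep theta = theta -> good pi N M (gam theta) chi ->
    pi.-Hall(S0 theta :&: N) H -> phi \in X ->
  '['Res[H] phi, 'Res[H] chi] = (phi == cfpi pi ('Ind[N] chi))%:R.
  move=> It rept g hallH /XP[theta' [It' rept' [chi' g' Dphi]]].
  have dot1 := good_Ind_dot sepN nsMN piMN fongM It (nucN _ It) hallH g g; rewrite eqxx in dot1.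
  have [-> | ne_phi] := eqVneq phi (cfpi pi ('Ind[N] chi)); first exact: dot1.
  have [eq_t | ne_t] := eqVneq theta' theta.
    rewrite {theta' It' rept'}eq_t in chi' g' Dphi; rewrite Dphi.
    rewrite (good_Ind_dot sepN nsMN piMN fongM It (nucN _ It) hallH g g').
    by case: (chi' =P chi) => // eq_chi; rewrite Dphi eq_chi eqxx in ne_phi.
  have [_ [e e_gt0 chiW] _ _] := g'.
  have Pphi : pchar pi phi.
    rewrite Dphi; apply/pchar_cfpi/cfInd_char/irrWchar; exact: good_irr g'.
  apply: (good_dot0 sepN nsMN piMN fongM It (nucN _ It) hallH Pphi g).
  apply/eqP; apply: contraNT ne_t; rewrite Dphi => nz.
  have [n Nn Dt] := nuc_mult_Ind_conj nsMN fongM It' (nucN _ It') chiW It nz.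
  by rewrite -rept -rept' {1}Dt repJ.
have spanX : ('CF(N, pi_elements pi N) <= <<X>>)%VS.
  apply: (good_span sepN nsMN fongM _ piMN) => theta It.
  have /cfclassP[n Nn Dn] := repP theta; exists n => //.
  exists (S0 (rep theta) :&: N)%G, (projT1 (nf (rep theta))).2, (gam (rep theta)).
  rewrite -Dn; split; first exact/nucN/repI.
  move=> chi g; apply/memv_span/(memX (rep theta)); split; [exact: repI | exact: repK |].
  by exists chi.
(* The pairings of [dualX] read off the coefficients of [phi] on [X], so these are natural numbers;
   being indecomposable, [phi] is then a single member of [X]. *)
have inX phi : Ipi pi N phi -> phi \in X.
  move=> Iphi; have Pphi := Ipi_pchar Iphi.
  have uniqX : uniq X by rewrite filter_uniq ?Ipis_uniq.
  have Xpchar s : s \in X -> pchar pi s by rewrite mem_filter => /andP[_ /IpisP/Ipi_pchar].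
  have [c Dphi] : exists c : 'CF(N) -> algC, phi = \sum_(s <- X) c s *: s.
    by apply: span_uniqP => //; apply: (subvP spanX); apply: pchar_on.
  have c_nat s : s \in X -> c s \in Num.nat.
    move=> Xs; have [theta [It rept [chi g Ds]]] := XP s Xs.
    have [|H hallH] := @pi_sep_Hall _ pi (S0 theta :&: N)%G.
      by apply: pi_sepS sepN; apply: subsetIr.
    have <- : '['Res[H] phi, 'Res[H] chi] = c s.
      rewrite Dphi linear_sum cfdot_suml (bigD1_seq s) //= linearZ cfdotZl (dualX _ _ _ _ It) //.
      rewrite -Ds eqxx mulr1 big_seq_cond big1 ?addr0 // => s' /andP[Xs' ne_s].
      by rewrite linearZ cfdotZl (dualX _ _ _ _ It) // -Ds (negPf ne_s) mulr0.
    apply: (pchar_cfdot _ (pHall_pgroup hallH) Pphi).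
      by rewrite (subset_trans (pHall_sub hallH)) ?subsetIr.
    exact: cfRes_char (irrWchar (good_irr g)).
  have [s Xs nz_cs] : exists2 s, s \in X & c s != 0.
    apply: contrapT => no_s; have /eqP[] := Ipi_neq0 Iphi.
    rewrite Dphi big_seq big1 // => s Xs; apply/eqP; rewrite scaler_eq0; apply/orP; left.
    by apply: contrapT => /negP nz; case: no_s; exists s.
  have /natrP[[|k] Dk] := c_nat s Xs; first by rewrite Dk eqxx in nz_cs.
  have [||s0|d0] := Ipi_split (a := s) (b := k%:R *: s + \sum_(s' <- X | s' != s) c s' *: s') Iphi (Xpchar s Xs).
  - apply: pcharD; first by apply: pcharZ; [apply: natr_nat | apply: Xpchar].
    rewrite big_seq_cond; apply: pchar_sum => s' /andP[Xs' _].
    by apply: pcharZ; [apply: c_nat | apply: Xpchar].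
  - by rewrite Dphi (bigD1_seq s) //= Dk -natr1 scalerDl scale1r addrA [s + _]addrC.
  - have := Xs; rewrite mem_filter => /andP[_ /IpisP/Ipi_neq0].
    by rewrite s0 eqxx.
  rewrite Dphi (bigD1_seq s) //= Dk -natr1 scalerDl scale1r addrAC d0 add0r.
  exact: Xs.
have [theta [It rept [chi g Dxi]]] := XP xi (inX xi Ixi).
exists theta; split=> //; first by exists chi.
move=> xi' Ixi' nz_xi'; have [theta' [It' rept' [chi' g' Dxi']]] := XP xi' (inX xi' Ixi').
have [_ [e e_gt0 chiW] _ _] := g'; rewrite Dxi' in nz_xi'.
have [n Nn Dt] := nuc_mult_Ind_conj nsMN fongM It' (nucN _ It') chiW It nz_xi'.
have eq_t : theta' = theta by rewrite -rept -rept' Dt repJ.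
by clear Dt; subst theta'; exists chi'.
Qed.

End NucleusStep.

Lemma nucleus_pgroup (gT : finGroupType) (pi : nat_pred) (G N : {group gT}) (xi : 'CF(N)) :
    pi.-group N -> N \subset G -> G \subset 'I[xi] -> Ipi pi N xi ->
  nucleus pi G G xi xi.
Proof.
move=> piN sNG Igx Ixi.
have irrN phi : Ipi pi N phi -> phi \in irr N.
  by move=> /Ipi_irr[i ->]; rewrite cfpi_pgroup ?mem_irr.
split=> //; first 1 last.
- by rewrite (setIidPr sNG).
- exact: irrN.
- by rewrite cfInd_id cfpi_pgroup.
- by apply: pnat_dvd piN; apply: cforder_lin_char_dvdG; apply: cfDet_lin_char.
- move=> H hallH; have /group_inj DH := pHall_id hallH piN.
  rewrite DH; split=> //; first by rewrite cfRes_id; apply: irrN.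
  move=> phi Iphi; rewrite !cfRes_id.
  have /irrP[i ->] := irrN _ Iphi; have /irrP[j ->] := irrN _ Ixi.
  by rewrite cfdot_irr (inj_eq irr_inj).
by rewrite mulGSid.
Qed.

(** The induction on [#|N|] leaves [G] free: it is applied to [M] both inside the stabiliser of
    [theta] in [G] and inside [M] itself. *)
Theorem nucleus_exists (gT : finGroupType) (pi : nat_pred) (G N : {group gT}) (xi : 'CF(N)) :
    pi_sep pi G -> N <| G -> Ipi pi N xi -> G \subset 'I[xi] ->
  exists (S W : {group gT}) (gamma : 'CF(W)), nucleus pi G S xi gamma.
Proof.
have [n] := ubnP #|N|; elim: n G N xi => // n IHn G N xi /ltnSE leNn sepG nsNG Ixi Igx.
have sNG := normal_sub nsNG.
have [N1 | ntN] := eqVneq N 1%G.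
  by exists G, N, xi; apply: nucleus_pgroup; rewrite // N1 pgroup1.
have [|M [nsMG _ ltMN piMN]] := sepG G 1%G N (subxx _) (normal1 _) nsNG.
  by rewrite proper1G; apply: contraNneq ntN => N1; apply/eqP/group_inj.
have [sMN _] := andP ltMN; have ltMn : (#|M| < n)%N := leq_trans (proper_card ltMN) leNn.
have sMG := normal_sub nsMG; have sepN := pi_sepS sNG sepG.
have nsMN : M <| N := normalS sMN sNG nsMG.
have fongM : fong pi M.
  move=> theta It; have sepM := pi_sepS sMG sepG.
  have [S [W [gamma nuc]]] := IHn M M theta ltMn sepM (normal_refl M) It (sub_inertia theta).
  have [|H hallH] := @pi_sep_Hall _ pi W.
    by apply: pi_sepS sepM; rewrite (nuc_cap nuc) subsetIr.
  by exists H, ('Res[H] gamma); apply: nuc_fong nuc H hallH.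
have nucM theta : Ipi pi M theta ->
    exists (S W : {group gT}) (gamma : 'CF(W)), nucleus pi 'I_G[theta] S theta gamma.
  move=> It; apply: (IHn 'I_G[theta]%G M theta ltMn _ _ It); last exact: subsetIr.
    exact: pi_sepS (subsetIl _ _) sepG.
  exact: normal_Inertia.
have [nf [nfP /(_ xi Ixi)[theta [It [chi g Dxi] over_theta]]]] :=
  nucleus_step sepG nsNG nsMG sMN piMN fongM nucM.
move: (nfP theta It) chi g Dxi over_theta; case: (nf theta) => [[S W] gamma] /= {nf nfP}.
move=> nuc chi g Dxi over_theta.
have sSG : S \subset G := nuc_subN nuc.
have nucN := nucleus_sub sMN sNG nuc.
have Pxi := Ipi_pchar Ixi; have Xon := pchar_on (pcharRes sMN Pxi).
have nz_xi : mult pi theta ('Res[M] xi) != 0.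
  have [_ [e e_gt0 chiW] _ _] := g; rewrite Dxi -[theta]cfConjgJ1.
  by rewrite (nuc_mult_Ind nsMN fongM It nucN chiW) ?group1 // pnatr_eq0 -lt0n.
exists S, (S :&: N)%G, chi; split=> //.
(* Frattini argument: [theta ^ x] lies under [xi ^ x], which is [xi], so it is [theta ^ y] for some
   [y] in [N]; then [x * y^-1] stabilises [theta] and lies in [S * M]. *)
- apply/eqP; rewrite eqEsubset mul_subG //=; apply/subsetP=> x Gx.
  have nMx : x \in 'N(M) := subsetP (normal_norm nsMG) x Gx.
  have Ix : (xi ^ x)%CF = xi by apply/inertiaJ/(subsetP Igx).
  have: mult pi (theta ^ x)%CF ('Res[M] (cfpi pi ('Ind[N] chi))) != 0.
    by rewrite -Dxi -Ix -(cfConjgRes _ nsNG nsMG Gx) multJ.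
  have [_ [e e_gt0 chiW] _ _] := g; move/(nuc_mult_Ind_conj nsMN fongM It nucN chiW (IpiJ x It)).
  case=> y Ny Dy; have Gy := subsetP sNG y Ny.
  have: (x * y^-1)%g \in (S * M)%g.
    have nMy := subsetP (normal_norm nsMG) y Gy.
    rewrite (nuc_mul nuc); apply/setIP; split; first by rewrite groupM ?groupV.
    apply/setIdP; split; first by rewrite groupM ?groupV.
    by rewrite cfConjgMnorm ?groupV // Dy cfConjgK.
  case/mulsgP=> s m Ss Mm Dxy; apply/mulsgP; exists s (m * y)%g => //.
    by rewrite groupM // (subsetP sMN).
  by rewrite mulgA -Dxy mulgKV.
- exact: good_irr g.
(* The conjugate of [chi] by [s] is good and induces the same [xi], so the pairing on a Hall
   subgroup identifies it with [chi]. *)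
- apply/subsetP=> s Ss; have gs := good_cfConjg nsNG nsMG nuc g Ss.
  have [|H hallH] := @pi_sep_Hall _ pi (S :&: N)%G.
    by apply: pi_sepS sepN; apply: subsetIr.
  have nNs : s \in 'N(N) by rewrite (subsetP (normal_norm nsNG)) ?(subsetP sSG).
  have nSNs : s \in 'N(S :&: N) by rewrite (subsetP (normsI (normG S) (subset_trans sSG (normal_norm nsNG)))).
  have := good_Ind_dot sepN nsMN piMN fongM It nucN hallH g gs.
  rewrite -(cfConjgInd_norm _ nSNs nNs) -cfpiJ -Dxi inertiaJ; last by rewrite (subsetP Igx) ?(subsetP sSG).
  rewrite Dxi (good_Ind_dot sepN nsMN piMN fongM It nucN hallH g g) eqxx.
  by case: eqP => [Ds _ | _ /eqP]; rewrite ?oner_eq0 // inE nSNs Ds eqxx.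
- by case: g.
move=> H hallH; split.
- by rewrite (subset_trans (pHall_sub hallH)) ?subsetIr.
- exact: pHall_pgroup hallH.
- exact: (good_irrH sepN nsMN piMN nucN hallH g).
(* A [phi] not over [theta] pairs to zero; one over [theta] comes from a good character over the
   same [gamma]. *)
move=> phi Iphi; have [phi0 | nz_phi] := eqVneq (mult pi theta ('Res[M] phi)) 0.
  rewrite (good_dot0 sepN nsMN piMN fongM It nucN hallH (Ipi_pchar Iphi) g phi0).
  by case: (phi =P xi) => // eq_phi; rewrite -eq_phi phi0 eqxx in nz_xi.
have [chi' g' Dphi] := over_theta phi Iphi nz_phi.
rewrite Dphi (good_Ind_dot sepN nsMN piMN fongM It nucN hallH g g').
have [-> | ne_chi] := eqVneq chi' chi; first by rewrite Dxi eqxx.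
case: eqP => // eq_phi; have := good_Ind_dot sepN nsMN piMN fongM It nucN hallH g g'.
rewrite eq_phi Dxi (good_Ind_dot sepN nsMN piMN fongM It nucN hallH g g) eqxx.
by rewrite (negPf ne_chi).
Qed.

Corollary fong_pi_sep (gT : finGroupType) (pi : nat_pred) (G : {group gT}) :
  pi_sep pi G -> fong pi G.
Proof.
move=> sepG phi Iphi.
have [S [W [gamma nuc]]] := nucleus_exists sepG (normal_refl G) Iphi (sub_inertia phi).
have [|H hallH] := @pi_sep_Hall _ pi W.
  by apply: pi_sepS sepG; rewrite (nuc_cap nuc) subsetIr.
by exists H, ('Res[H] gamma); apply: nuc_fong nuc H hallH.
Qed.

(** * Clifford theory for partial characters *)

Section NormalStep.

Variables (gT : finGroupType) (pi : nat_pred) (N M : {group gT}).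
Hypotheses (sepN : pi_sep pi N) (nsMN : M <| N) (piMN : pi_or_pi' pi #|N : M|).

Let sMN : M \subset N. Proof. exact: normal_sub. Qed.
Let fongM : fong pi M. Proof. exact/fong_pi_sep/(pi_sepS sMN). Qed.
Let fongN : fong pi N. Proof. exact: fong_pi_sep. Qed.

Lemma mult_ResJ (eta : 'CF(M)) (phi : 'CF(N)) y :
    Ipi pi M eta -> pchar pi phi -> y \in N ->
  mult pi (eta ^ y)%CF ('Res[M] phi) = mult pi eta ('Res[M] phi).
Proof.
move=> Ieta Pphi Ny; rewrite -[in LHS](cfConjg_id phi Ny) -(cfConjgRes _ (normal_refl N) nsMN Ny).
by rewrite multJ //; apply/pchar_on/pcharRes.
Qed.

Lemma good_exists (S W : {group gT}) (theta : 'CF(M)) (gamma : 'CF(W)) :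
    Ipi pi M theta -> nucleus pi 'I_N[theta] S theta gamma ->
  exists chi : 'CF(S), good pi N M gamma chi.
Proof.
move=> It nuc; have [piNM | not_pi] := boolP (pi.-nat #|N : M|); last first.
  exact: (good_exists_pi' sepN nsMN piMN nuc not_pi).
have [|i Si] := @neq0_has_constt _ _ ('Ind[S] gamma).
  rewrite cfInd_eq0 ?irrWchar ?(nuc_irr nuc) ?(normal_sub (nuc_normal nsMN nuc)) //.
  by have /irrP[j ->] := nuc_irr nuc; apply: irr_neq0.
by exists 'chi_i; apply: (good_constt nsMN nuc piNM Si).
Qed.

(** [nucleus_step] chooses its own [theta] in the orbit. To reach the orbit of [eta], it is applied
    to a member of [Ipi pi N] built over [eta]; both then lie under it and are conjugate. *)
Lemma Ipi_step (eta : 'CF(M)) :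
    Ipi pi M eta ->
  exists (theta : 'CF(M)) (S W : {group gT}) (gamma : 'CF(W)),
    [/\ exists2 y, y \in N & eta = (theta ^ y)%CF, Ipi pi M theta,
        nucleus pi 'I_N[theta] S theta gamma
      & forall phi, Ipi pi N phi -> mult pi theta ('Res[M] phi) != 0 ->
          exists2 chi : 'CF(S), good pi N M gamma chi & phi = cfpi pi ('Ind[N] chi)].
Proof.
move=> Ieta; have nucM (theta : 'CF(M)) : Ipi pi M theta ->
    exists (S W : {group gT}) (gamma : 'CF(W)), nucleus pi 'I_N[theta] S theta gamma.
  move=> It; apply: (@nucleus_exists _ _ 'I_N[theta]%G) => //; last exact: subsetIr.
    exact: pi_sepS (subsetIl _ _) sepN.
  exact: normal_Inertia.
have [S1 [W1 [gamma1 nuc1]]] := nucM eta Ieta.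
have [chi1 g1] := good_exists Ieta nuc1.
have Ixi := good_Ipi sepN nsMN piMN fongM Ieta nuc1 g1.
have [nf [nfP /(_ _ Ixi)[theta [It [chi g Dxi] over_theta]]]] :=
  nucleus_step sepN (normal_refl N) nsMN sMN piMN fongM nucM.
have nuc := nucleus_sub sMN (subxx N) (nfP theta It).
exists theta, ((projT1 (nf theta)).1 :&: N)%G, (projT1 (nf theta)).2, (projT2 (nf theta)).
split=> //; have [_ [e e_gt0 chiW] _ _] := g.
apply: (nuc_mult_Ind_conj nsMN fongM It nuc chiW Ieta); rewrite -Dxi.
have [_ [e1 e1_gt0 chiW1] _ _] := g1; rewrite -[eta]cfConjgJ1.
by rewrite (nuc_mult_Ind nsMN fongM Ieta nuc1 chiW1) ?group1 // pnatr_eq0 -lt0n.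
Qed.

Lemma Ipi_over_exists (eta : 'CF(M)) :
  Ipi pi M eta -> exists2 phi, Ipi pi N phi & mult pi eta ('Res[M] phi) != 0.
Proof.
move/Ipi_step=> [theta [S [W [gamma [[y Ny ->] It nuc _]]]]].
have [chi g] := good_exists It nuc; have Iphi := good_Ipi sepN nsMN piMN fongM It nuc g.
exists (cfpi pi ('Ind[N] chi)) => //; have [_ [e e_gt0 chiW] _ _] := g.
by rewrite (nuc_mult_Ind nsMN fongM It nuc chiW) // pnatr_eq0 -lt0n.
Qed.

Lemma Ipi_Res_conj (phi : 'CF(N)) (eta eta' : 'CF(M)) :
    Ipi pi N phi -> Ipi pi M eta -> Ipi pi M eta' ->
    mult pi eta ('Res[M] phi) != 0 -> mult pi eta' ('Res[M] phi) != 0 ->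
  exists2 y, y \in N & eta' = (eta ^ y)%CF.
Proof.
move=> Iphi /Ipi_step[theta [S [W [gamma [[y Ny ->] It nuc over_theta]]]]] Ieta'.
rewrite mult_ResJ //; last exact: Ipi_pchar.
case/(over_theta phi Iphi) => chi [_ [e _ chiW] _ _] ->.
case/(nuc_mult_Ind_conj nsMN fongM It nuc chiW Ieta') => z Nz ->.
exists (y^-1 * z)%g; first by rewrite groupM ?groupV.
by rewrite (cfConjgM _ nsMN) ?groupV // cfConjgK.
Qed.

Lemma mult_Res_pi' (phi : 'CF(N)) (eta : 'CF(M)) :
    ~~ pi.-nat #|N : M| -> Ipi pi N phi -> Ipi pi M eta ->
    mult pi eta ('Res[M] phi) != 0 -> mult pi eta ('Res[M] phi) = 1.
Proof.
move=> not_pi Iphi /Ipi_step[theta [S [W [gamma [[y Ny ->] It nuc over_theta]]]]].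
rewrite mult_ResJ //; last exact: Ipi_pchar.
case/(over_theta phi Iphi) => chi [_ _ _ /(_ not_pi) chiW] ->.
rewrite -[theta]cfConjgJ1; apply: (nuc_mult_Ind nsMN fongM It nuc) => //.
by rewrite scale1r.
Qed.

Lemma Ipi_over_unique (phi phi' : 'CF(N)) (eta : 'CF(M)) :
    ~~ pi.-nat #|N : M| -> Ipi pi N phi -> Ipi pi N phi' -> Ipi pi M eta ->
    mult pi eta ('Res[M] phi) != 0 -> mult pi eta ('Res[M] phi') != 0 ->
  phi = phi'.
Proof.
move=> not_pi Iphi Iphi' /Ipi_step[theta [S [W [gamma [[y Ny ->] It nuc over_theta]]]]].
rewrite !mult_ResJ //; try exact: Ipi_pchar.
case/(over_theta phi Iphi) => chi g ->; case/(over_theta phi' Iphi') => chi' g' ->.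
by rewrite (good_unique_pi' sepN nsMN piMN nuc not_pi g g').
Qed.

(** If [phi] comes from a good [chi], both sides are the multiplicity of [gamma] in ['Res[W] chi];
    for the left side, ['Ind[N] theta] is expanded along ['Ind[S] gamma]. If [phi] is not over
    [theta], both sides vanish. *)
Lemma mult_Ind_pi (phi : 'CF(N)) (eta : 'CF(M)) :
    pi.-nat #|N : M| -> Ipi pi N phi -> Ipi pi M eta ->
  mult pi phi ('Ind[N] eta) = mult pi eta ('Res[M] phi).
Proof.
move=> piNM Iphi /Ipi_step[theta [S [W [gamma [[y Ny ->] It nuc over_theta]]]]].
rewrite mult_ResJ //; last exact: Ipi_pchar.
have -> : 'Ind[N] (theta ^ y)%CF = 'Ind[N] theta.
  by rewrite -(cfConjgInd _ (normal_refl N) nsMN Ny) cfConjg_id.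
have [|H hallH] := @pi_sep_Hall _ pi S; first exact: pi_sepS (nuc_subN nuc) sepN.
have sWS := normal_sub (nuc_normal nsMN nuc); have sSN := nuc_subN nuc.
have g i : i \in irr_constt ('Ind[S] gamma) -> good pi N M gamma 'chi_i.
  by move=> Si; apply: (good_constt nsMN nuc piNM Si).
have -> : 'Ind[N] theta = \sum_(i in irr_constt ('Ind[S] gamma))
    '['Ind[S] gamma, 'chi_i] *: cfpi pi ('Ind[N] 'chi_i).
  rewrite (nuc_ind nuc) cfpiInd // cfIndInd ?(nuc_subM nuc) // -(cfIndInd _ sSN sWS).
  rewrite [in LHS](cfun_sum_constt ('Ind[S] gamma)) linear_sum /cfpi mulr_suml.
  by apply: eq_bigr => i _; rewrite linearZ -scalerAl.
rewrite mult_sum //.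
have [phi0 | nz_phi] := eqVneq (mult pi theta ('Res[M] phi)) 0.
  rewrite phi0 big1 // => i Si; rewrite multZ mult_Ipi //; last first.
    exact: (good_Ipi sepN nsMN piMN fongM It nuc (g i Si)).
  have [_ [e e_gt0 chiW] _ _] := g i Si.
  case: eqP => [Dphi|]; rewrite ?mulr0 //; have /eqP[] : e%:R != 0 :> algC by rewrite pnatr_eq0 -lt0n.
  by rewrite -phi0 -Dphi -[theta]cfConjgJ1 (nuc_mult_Ind nsMN fongM It nuc chiW) ?group1.
have [chi gchi Dphi] := over_theta phi Iphi nz_phi.
have [i Si Di] := good_ind_constt nuc gchi; have [_ [e e_gt0 chiW] _ _] := gchi.
rewrite (bigD1 i) //= big1 ?addr0 => [|j /andP[Sj ne_j]].
  rewrite multZ -Di -Dphi mult_Ipi // eqxx mulr1 -cfdot_Res_r Di -Di chiW.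
  rewrite cfdotZr irrWnorm ?(nuc_irr nuc) // mulr1 conj_natr ?natr_nat //.
  by rewrite -[theta]cfConjgJ1 Dphi (nuc_mult_Ind nsMN fongM It nuc chiW) ?group1.
rewrite multZ mult_Ipi //; last exact: (good_Ipi sepN nsMN piMN fongM It nuc (g j Sj)).
(* Distinct good characters induce distinct partial characters, as their pairings with [chi]
   differ. *)
case: eqP => [eq_ji|]; rewrite ?mulr0 //.
have := good_Ind_dot sepN nsMN piMN fongM It nuc hallH gchi (g j Sj).
rewrite eq_ji Dphi (good_Ind_dot sepN nsMN piMN fongM It nuc hallH gchi gchi) eqxx.
by rewrite Di (inj_eq irr_inj) (negPf ne_j) => /eqP; rewrite oner_eq0.
Qed.

End NormalStep.

(** * Multiplication by [zeta] and the induction through [K] *)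

Lemma cfIndMod (gT : finGroupType) (G H K : {group gT}) (phi : 'CF(H / K)) :
  K \subset H -> H \subset G -> K <| G -> 'Ind[G] (phi %% K)%CF = ('Ind[G / K] phi %% K)%CF.
Proof.
move=> sKH sHG /andP[_ nKG]; rewrite [LHS]cfIndMorph ?ker_coset //.
Qed.

Section MultLemmas.

Variables (gT : finGroupType) (pi : nat_pred) (G : {group gT}).
Hypothesis fongG : fong pi G.

Lemma mult_ge1 (phi f : 'CF(G)) :
  Ipi pi G phi -> pchar pi f -> mult pi phi f != 0 -> 1 <= mult pi phi f.
Proof.
move=> Iphi Pf; have /natrP[n ->] := mult_nat fongG Iphi Pf.
by rewrite pnatr_eq0 ler1n lt0n.
Qed.

Lemma pchar_sub_mult (phi f : 'CF(G)) :
  Ipi pi G phi -> pchar pi f -> pchar pi (f - mult pi phi f *: phi).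
Proof.
move=> Iphi Pf; have Pphi := Ipi_pchar Iphi.
apply: pchar_mult => // [|psi Ipsi].
  by rewrite rpredB ?memvZ ?pchar_on.
rewrite -scaleNr multD multZ (mult_Ipi fongG Ipsi Iphi).
have [-> | _] := eqVneq phi psi; last by rewrite mulr0 addr0 mult_nat.
by rewrite mulr1 subrr.
Qed.

Lemma exists_mult_linear (rT : finGroupType) (H : {group rT}) (F : {linear 'CF(G) -> 'CF(H)}) f psi :
    f \in 'CF(G, pi_elements pi G) -> mult pi psi (F f) != 0 ->
  exists phi, [/\ Ipi pi G phi, mult pi phi f != 0 & mult pi psi (F phi) != 0].
Proof.
move=> f_on nzFf; apply: contrapT => no_phi; case/eqP: nzFf.
rewrite {1}(Ipis_sum_mult fongG f_on) linear_sum mult_sum big_seq big1 // => phi /IpisP Iphi.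
rewrite linearZ multZ; apply/eqP; rewrite mulf_eq0; apply: contrapT => /negP/norP[nz1 nz2].
by case: no_phi; exists phi.
Qed.

End MultLemmas.

Definition cfMulMod (gT : finGroupType) (G N : {group gT}) (zeta : 'CF(G)) (kappa : 'CF(G / N)) :
  'CF(G) := (kappa %% N)%CF * zeta.

Section CfMulMod.

Variables (gT : finGroupType) (pi : nat_pred) (G N : {group gT}) (zeta : 'CF(G)).

Fact cfMulMod_is_linear : linear (@cfMulMod gT G N zeta).
Proof. by move=> a f g; rewrite /cfMulMod linearP mulrDl scalerAl. Qed.

HB.instance Definition _ := GRing.isLinear.Build _ _ _ _ (@cfMulMod gT G N zeta) cfMulMod_is_linear.

Lemma cfMulModP a (f g : 'CF(G / N)) :
  cfMulMod zeta (a *: f + g) = a *: cfMulMod zeta f + cfMulMod zeta g.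
Proof. exact: cfMulMod_is_linear. Qed.

Lemma pchar_cfMulMod (kappa : 'CF(G / N)) :
  N <| G -> pchar pi zeta -> pchar pi kappa -> pchar pi (cfMulMod zeta kappa).
Proof.
move=> nsNG [psi Npsi ->] [chi Nchi ->]; exists ((chi %% N)%CF * psi).
  by rewrite rpredM ?cfMod_char.
apply/cfun_inP=> x Gx; rewrite [LHS]cfunE cfModE // !cfpiE !inE Gx mem_quotient //=.
have [pi_x | _] := boolP (pi.-elt x); last by rewrite mulr0.
by rewrite morph_p_elt ?(subsetP (normal_norm nsNG)) //= [RHS]cfunE cfModE.
Qed.

Lemma cfRes_cfMulMod (K : {group gT}) (kappa : 'CF(G / N)) :
    N <| G -> K \subset G ->
  'Res[K] (cfMulMod zeta kappa) = cfMulMod ('Res[K] zeta) ('Res[K / N] kappa).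
Proof. by move=> nsNG sKG; rewrite /cfMulMod rmorphM /= cfResMod. Qed.

Lemma cfInd_cfMulMod (K : {group gT}) (mu : 'CF(K / N)) :
    N <| G -> N \subset K -> K \subset G ->
  'Ind[G] (cfMulMod ('Res[K] zeta) mu) = cfMulMod zeta ('Ind[G / N] mu).
Proof. by move=> nsNG sNK sKG; rewrite /cfMulMod cfIndM // cfIndMod. Qed.

Lemma cfConjg_cfMulMod (K : {group gT}) (mu : 'CF(K / N)) y :
    N <| G -> K <| G -> y \in G ->
  (cfMulMod ('Res[K] zeta) mu ^ y)%CF = cfMulMod ('Res[K] zeta) (mu ^ coset N y)%CF.
Proof.
move=> nsNG nsKG Gy; rewrite /cfMulMod rmorphM /= (cfConjgMod _ nsKG nsNG Gy).
by rewrite (cfConjgRes _ (normal_refl G) nsKG Gy) cfConjg_id.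
Qed.

End CfMulMod.

Definition Ipi_mul_bij (gT : finGroupType) (pi : nat_pred) (G N : {group gT}) (zeta : 'CF(G)) :=
  [/\ forall kappa : 'CF(G / N), Ipi pi (G / N)%G kappa -> Ipi pi G (cfMulMod zeta kappa),
      forall kappa kappa' : 'CF(G / N), Ipi pi (G / N)%G kappa -> Ipi pi (G / N)%G kappa' ->
        cfMulMod zeta kappa = cfMulMod zeta kappa' -> kappa = kappa'
    & forall phi : 'CF(G), Ipi pi G phi -> mult pi ('Res[N] zeta) ('Res[N] phi) != 0 ->
        exists2 kappa : 'CF(G / N), Ipi pi (G / N)%G kappa & phi = cfMulMod zeta kappa].

Section MulStep.

Variables (gT : finGroupType) (pi : nat_pred) (G N K : {group gT}) (zeta : 'CF(G)).
Hypotheses (sepG : pi_sep pi G) (nsNG : N <| G) (nsKG : K <| G) (sNK : N \subset K).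
Hypotheses (piGK : pi_or_pi' pi #|G : K|) (Izeta : Ipi pi G zeta).
Hypothesis bijK : @Ipi_mul_bij gT pi K N ('Res[K] zeta).

Let sKG : K \subset G. Proof. exact: normal_sub. Qed.
Let sepQ : pi_sep pi (G / N)%G. Proof. exact: pi_sep_quotient. Qed.
Let nsKQ : (K / N)%G <| (G / N)%G. Proof. exact: quotient_normal. Qed.
Let sKQ : (K / N)%G \subset (G / N)%G. Proof. exact: normal_sub nsKQ. Qed.
Let fongG : fong pi G. Proof. exact: fong_pi_sep. Qed.
Let fongK : fong pi K. Proof. exact/fong_pi_sep/(pi_sepS sKG). Qed.
Let fongQ : fong pi (G / N)%G. Proof. exact: fong_pi_sep. Qed.
Let fongKQ : fong pi (K / N)%G. Proof. exact/fong_pi_sep/(pi_sepS sKQ). Qed.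
Let indexQ : #|(G / N)%G : (K / N)%G| = #|G : K|.
Proof. by apply: index_quotient_eq; rewrite ?normal_norm // subIset ?sNK ?orbT. Qed.
Let piQ : pi_or_pi' pi #|(G / N)%G : (K / N)%G|. Proof. by rewrite indexQ. Qed.
Let Pzeta : pchar pi zeta. Proof. exact: Ipi_pchar. Qed.
Let zetaK := 'Res[K] zeta.

Let Pm kappa : pchar pi kappa -> pchar pi (@cfMulMod gT G N zeta kappa).
Proof. exact: pchar_cfMulMod. Qed.

Let IKm mu : Ipi pi (K / N)%G mu -> Ipi pi K (@cfMulMod gT K N zetaK mu).
Proof. by case: bijK => IK _ _; apply: IK. Qed.

(** Multiplication by [zetaK] maps [Ipi pi (K / N)] injectively into [Ipi pi K], so it carries
    coefficients to coefficients. *)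
Let mult_m mu (f : 'CF(K / N)) :
    Ipi pi (K / N)%G mu -> f \in 'CF(K / N, pi_elements pi (K / N)%G) ->
  mult pi (cfMulMod zetaK mu) (cfMulMod zetaK f) = mult pi mu f.
Proof.
move=> Imu f_on; rewrite (Ipis_sum_mult fongKQ f_on) linear_sum !mult_sum.
rewrite big_seq [RHS]big_seq; apply: eq_bigr => nu /IpisP Inu.
rewrite linearZ !multZ (mult_Ipi fongKQ Imu Inu) (mult_Ipi fongK (IKm Imu) (IKm Inu)).
by case: bijK => _ injK _; congr (_ * _%:R); congr nat_of_bool; apply/eqP/eqP => [/injK-> | ->].
Qed.

Let mult_m_Res mu kappa :
    Ipi pi (K / N)%G mu -> pchar pi kappa ->
  mult pi (cfMulMod zetaK mu) ('Res[K] (@cfMulMod gT G N zeta kappa)) = mult pi mu ('Res[K / N] kappa).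
Proof.
move=> Imu Pkappa; rewrite cfRes_cfMulMod // mult_m //.
exact/(@pchar_on _ _ (K / N)%G)/(@pcharRes _ _ (G / N)%G).
Qed.

Let mult_m_Ind mu phi :
    pi.-nat #|G : K| -> Ipi pi (K / N)%G mu -> Ipi pi G phi ->
  mult pi (cfMulMod zetaK mu) ('Res[K] phi) = mult pi phi (cfMulMod zeta ('Ind[G / N] mu)).
Proof.
move=> piG Imu Iphi; rewrite -cfInd_cfMulMod // mult_Ind_pi //; exact: IKm.
Qed.

Let Ind_decomp mu kappa :
    pi.-nat #|G : K| -> Ipi pi (K / N)%G mu -> Ipi pi (G / N)%G kappa ->
  exists2 rest : 'CF(G / N), @pchar _ pi (G / N)%G rest &
    'Ind[G / N] mu = mult pi mu ('Res[K / N] kappa) *: kappa + rest.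
Proof.
move=> piG Imu Ikappa; rewrite -(mult_Ind_pi sepQ nsKQ _ _ Ikappa) //=; last by rewrite indexQ.
have PInd : pchar pi ('Ind[(G / N)%G] mu) by apply: pcharInd => //; apply: Ipi_pchar.
exists ('Ind[G / N] mu - mult pi kappa ('Ind[G / N] mu) *: kappa); last by rewrite addrC subrK.
exact: (pchar_sub_mult fongQ Ikappa PInd).
Qed.

Let const_part mu kappa a b :
    Ipi pi (K / N)%G mu -> Ipi pi (G / N)%G kappa -> mult pi mu ('Res[K / N] kappa) != 0 ->
    pchar pi a -> pchar pi b -> cfMulMod zeta kappa = a + b -> a != 0 ->
  mult pi mu ('Res[K / N] kappa) <= mult pi (cfMulMod zetaK mu) ('Res[K] a).
Proof.
move=> Imu Ikappa nz_mu Pa Pb Dm nz_a; have Pkappa := Ipi_pchar Ikappa.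
have PR := pcharRes sKQ Pkappa.
have [piG | not_pi] := boolP (pi.-nat #|G : K|).
  have [phi Iphi nz_phi] := exists_mult fongG (pchar_on Pa) nz_a.
  have [rest Prest Da] : exists2 rest, pchar pi rest & a = mult pi phi a *: phi + rest.
    by exists (a - mult pi phi a *: phi); [apply: pchar_sub_mult | rewrite addrC subrK].
  have ge1_phi := mult_ge1 fongG Iphi Pa nz_phi.
  have IKmu := IKm Imu; have Pphi := Ipi_pchar Iphi.
  apply: le_trans (_ : mult pi (cfMulMod zetaK mu) ('Res[K] phi) <= _); last first.
    rewrite [in leRHS]Da raddfD /= linearZ multD multZ.
    apply: le_trans (_ : 1 * mult pi (cfMulMod zetaK mu) ('Res[K] phi) <= _).
      by rewrite mul1r.
    apply: ler_wpDr; first by apply: mult_ge0 => //; apply: pcharRes.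
    by apply: ler_wpM2r => //; apply: mult_ge0 => //; apply: pcharRes.
  (* By reciprocity the left side bounds the coefficient of [phi] in [zeta] times the induced [mu]:
     the latter contains [kappa] with that multiplicity, and [kappa * zeta] contains [phi] through
     [a]. *)
  rewrite mult_m_Ind //; have [rest' Prest' ->] := Ind_decomp piG Imu Ikappa.
  rewrite cfMulModP multD multZ Dm multD.
  apply: ler_wpDr; first by apply: mult_ge0 => //; apply: Pm.
  rewrite ler_peMr //; first exact: mult_ge0 fongKQ _ _ Imu PR.
  by apply: ler_wpDr => //; apply: mult_ge0.
rewrite (mult_Res_pi' sepQ nsKQ) //; last by rewrite indexQ.
have nz_aK : 'Res[K] a != 0.
  by rewrite -(pchar1_eq0 (pcharRes sKG Pa)) cfRes1 (pchar1_eq0 Pa).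
have PaK := pcharRes sKG Pa.
have [nu Inu nz_nu] := exists_mult fongK (pchar_on PaK) nz_aK.
(* Here the multiplicity is 1. A constituent [nu] of [a] on [K] has the form [mu' * zetaK] with
   [mu'] under [kappa], hence conjugate to [mu]; lifting the conjugating element to [G] shows that
   [a] also lies over [mu * zetaK]. *)
have nz_nu' : mult pi nu (cfMulMod zetaK ('Res[K / N] kappa)) != 0.
  rewrite -cfRes_cfMulMod // Dm raddfD multD /= gt_eqF // ltr_wpDr //.
    by apply: mult_ge0 => //; apply: pcharRes.
  by rewrite lt_def nz_nu mult_ge0.
have [mu' [Imu' nz_mu' nz_nu'']] := exists_mult_linear fongKQ (pchar_on PR) nz_nu'.
have Dnu : nu = cfMulMod zetaK mu'.
  by move: nz_nu''; rewrite (mult_Ipi fongK Inu (IKm Imu')); case: (_ =P nu) => [<- //|_]; rewrite eqxx.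
have [qy Qy Dmu'] := Ipi_Res_conj sepQ nsKQ piQ Ikappa Imu Imu' nz_mu nz_mu'.
have [y _ Gy Dqy] := morphimP Qy.
rewrite -(mult_ResJ (pi_sepS (subxx G) sepG) nsKG _ Pa Gy) //; last exact: IKm.
rewrite (cfConjg_cfMulMod _ _ nsNG nsKG Gy) -Dqy -Dmu' -Dnu.
exact: mult_ge1.
Qed.

Let exists_Res kappa :
    Ipi pi (G / N)%G kappa ->
  exists2 mu, Ipi pi (K / N)%G mu & mult pi mu ('Res[K / N] kappa) != 0.
Proof.
move=> Ikappa; have Pkappa := Ipi_pchar Ikappa; have PR := pcharRes sKQ Pkappa.
apply: exists_mult (pchar_on PR) _ => //.
by rewrite -(pchar1_eq0 PR) cfRes1 (pchar1_eq0 Pkappa) (Ipi_neq0 Ikappa).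
Qed.

Lemma Ipi_mul_step_Ipi (kappa : 'CF(G / N)) :
  Ipi pi (G / N)%G kappa -> Ipi pi G (cfMulMod zeta kappa).
Proof.
move=> Ikappa; have Pkappa := Ipi_pchar Ikappa.
have [mu Imu nz_mu] := exists_Res Ikappa.
apply: Ipi_intro => [||a b Pa Pb Dm]; first exact: Pm.
  rewrite -(pchar1_eq0 (Pm Pkappa)) cfunE mulf_neq0 //;
    by rewrite ?cfMod1 ?(pchar1_eq0 Pkappa) ?(pchar1_eq0 Pzeta) ?(Ipi_neq0 Ikappa) ?(Ipi_neq0 Izeta).
have [-> | nz_a] := eqVneq a 0; [by left | right].
apply: contrapT => /eqP nz_b; have Dm' : cfMulMod zeta kappa = b + a by rewrite addrC.
have le_a := const_part Imu Ikappa nz_mu Pa Pb Dm nz_a.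
have le_b := const_part Imu Ikappa nz_mu Pb Pa Dm' nz_b.
have Dsum : 'Res[K] (cfMulMod zeta kappa) = 'Res[K] a + 'Res[K] b by rewrite Dm raddfD.
have := lerD le_a le_b; rewrite -[leRHS]multD -Dsum mult_m_Res // gerDl.
have PR := pcharRes sKQ Pkappa.
by have := mult_ge1 fongKQ Imu PR nz_mu => ge1 le0; have := le_trans ge1 le0; rewrite ler10.
Qed.

Lemma Ipi_mul_step_inj (kappa kappa' : 'CF(G / N)) :
    Ipi pi (G / N)%G kappa -> Ipi pi (G / N)%G kappa' ->
  cfMulMod zeta kappa = cfMulMod zeta kappa' -> kappa = kappa'.
Proof.
move=> Ikappa Ikappa' eq_m.
have [Pkappa Pkappa'] := (Ipi_pchar Ikappa, Ipi_pchar Ikappa').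
have [PR PR'] := (pcharRes sKQ Pkappa, pcharRes sKQ Pkappa').
have eqR mu : Ipi pi (K / N)%G mu -> mult pi mu ('Res[K / N] kappa') = mult pi mu ('Res[K / N] kappa).
  by move=> Imu; rewrite -!mult_m_Res // eq_m.
have [piG | not_pi] := boolP (pi.-nat #|G : K|); last first.
  have pi'Q : pi^'.-nat #|(G / N)%G : (K / N)%G|.
    by rewrite indexQ; case/orP: piGK not_pi => // ->.
  have eqRR := mult_inj fongKQ (pchar_on PR) (pchar_on PR') (fun mu Imu => esym (eqR mu Imu)).
  have off_pi f x : @pchar _ pi (G / N)%G f -> ~~ pi.-elt x -> f x = 0.
    by move=> /pchar_on/cfun_on0 f0 pi'x; rewrite f0 // inE negb_and pi'x orbT.
  apply/cfun_inP=> x Qx; have [pi_x | pi'x] := boolP (pi.-elt x); last first.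
    by rewrite (off_pi _ _ Pkappa) // (off_pi _ _ Pkappa').
  have Kx := mem_pi'_index nsKQ pi'Q Qx pi_x.
  by rewrite -(cfResE kappa sKQ Kx) eqRR cfResE.
(* If [kappa] and [kappa'] were distinct, the induced [mu] would contain each of them [c] times, so
   its product with [zeta] would contain the common image at least [2 * c] times, while reciprocity
   gives exactly [c]. *)
apply: contrapT => /eqP ne_kappa; have [mu Imu nz_mu] := exists_Res Ikappa.
have Iphi := Ipi_mul_step_Ipi Ikappa.
have := mult_m_Res Imu Pkappa; rewrite (mult_m_Ind piG Imu Iphi).
have [rest Prest DInd] := Ind_decomp piG Imu Ikappa.
have Dc : mult pi kappa' rest = mult pi mu ('Res[K / N] kappa).
  have := mult_Ind_pi sepQ nsKQ piQ; rewrite indexQ => /(_ kappa' mu piG Ikappa' Imu).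
  rewrite /= DInd multD multZ (mult_Ipi fongQ Ikappa' Ikappa) (negPf ne_kappa) mulr0 add0r => ->.
  exact: eqR.
have := pchar_sub_mult fongQ Ikappa' Prest; set rest' := rest - _ => Prest'.
have Drest : rest = rest' + mult pi mu ('Res[K / N] kappa) *: kappa' by rewrite /rest' Dc subrK.
rewrite DInd Drest.
rewrite [rest' + _]addrC !cfMulModP !multD !multZ -eq_m (mult_Ipi fongG Iphi Iphi) eqxx mulr1.
have := mult_ge1 fongKQ Imu PR nz_mu; set c := mult pi mu _ => ge1 /eqP.
rewrite -[X in _ == X]addr0 (inj_eq (addrI c)) paddr_eq0.
- by rewrite [c == 0](negPf nz_mu).
- by apply: le_trans ge1; rewrite ler01.
by apply: mult_ge0 => //; apply: Pm.
Qed.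

(** Below [phi] lies some [mu * zetaK]. For a pi'-quotient only one member of [Ipi pi G] lies over
    it, and any [kappa] over [mu] yields it; for a pi-quotient [phi] occurs in [zeta] times the
    induced [mu], whose constituents have the required form. *)
Lemma Ipi_mul_step_surj (phi : 'CF(G)) :
    Ipi pi G phi -> mult pi ('Res[N] zeta) ('Res[N] phi) != 0 ->
  exists2 kappa : 'CF(G / N), Ipi pi (G / N)%G kappa & phi = cfMulMod zeta kappa.
Proof.
move=> Iphi; have PK := pcharRes sKG (Ipi_pchar Iphi).
rewrite -(cfResRes phi sNK sKG) => nz_xi.
have [psi [Ipsi nz_psi nz_xi']] := exists_mult_linear fongK (pchar_on PK) nz_xi.
have [_ _ /(_ psi Ipsi)[|mu Imu Dpsi]] := bijK; first by rewrite cfResRes.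
rewrite Dpsi in nz_psi.
have [piG | not_pi] := boolP (pi.-nat #|G : K|); last first.
  have [kappa Ikappa nz_mu] := Ipi_over_exists sepQ nsKQ piQ Imu.
  exists kappa => //; apply: (Ipi_over_unique sepG nsKG piGK not_pi Iphi _ (IKm Imu)) => //.
    exact: Ipi_mul_step_Ipi.
  by rewrite mult_m_Res //; apply: Ipi_pchar.
rewrite mult_m_Ind // in nz_psi.
have PInd : pchar pi ('Ind[(G / N)%G] mu) by apply: pcharInd => //; apply: Ipi_pchar.
have [kappa [Ikappa _ nz]] := exists_mult_linear fongQ (pchar_on PInd) nz_psi.
exists kappa => //; move: nz; rewrite (mult_Ipi fongG Iphi (Ipi_mul_step_Ipi Ikappa)).
by case: (_ =P phi) => [<- //|_]; rewrite eqxx.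
Qed.

End MulStep.

Lemma Ipi_trivial (gT : finGroupType) (pi : nat_pred) (G : {group gT}) (kappa : 'CF(G)) :
  G :=: 1%g -> Ipi pi G kappa -> kappa = 1.
Proof.
move=> G1 /Ipi_irr[i ->]; rewrite cfpi_pgroup; last by rewrite G1 pgroup1.
have abG : abelian G by rewrite G1 abelian1.
apply/cfun_inP=> x Gx; rewrite cfun1E Gx; move: Gx; rewrite {1}G1 => /set1P->.
by rewrite lin_char1 //; apply: (char_abelianP G abG).
Qed.

Lemma Ipi_mul_base (gT : finGroupType) (pi : nat_pred) (N : {group gT}) (zeta : 'CF(N)) :
  pi_sep pi N -> Ipi pi N zeta -> Ipi_mul_bij pi N zeta.
Proof.
move=> sepN Iz; have fongN := fong_pi_sep sepN.
have N1 : (N / N)%G :=: 1%g by rewrite /= trivg_quotient.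
have m1 : cfMulMod zeta (1 : 'CF(N / N)) = zeta by rewrite /cfMulMod rmorph1 mul1r.
split=> [kappa Ik | kappa kappa' Ik Ik' _ | phi Iphi nz].
- by rewrite (Ipi_trivial N1 Ik) m1.
- by rewrite (Ipi_trivial N1 Ik) (Ipi_trivial N1 Ik').
have fongQ : fong pi (N / N)%G by apply/fong_pi_sep/pi_sep_quotient.
have [|kappa Ik _] := exists_mult fongQ (cfpi_on pi (1 : 'CF((N / N)%G))).
  by rewrite cfpi_pgroup ?oner_eq0 // N1 pgroup1.
exists kappa => //; rewrite (Ipi_trivial N1 Ik) m1.
by move: nz; rewrite !cfRes_id (mult_Ipi fongN Iz Iphi); case: (phi =P zeta) => // _; rewrite eqxx.
Qed.

Theorem Ipi_mul_bij_pi_sep (gT : finGroupType) (pi : nat_pred) (G N : {group gT}) (zeta : 'CF(G)) :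
    pi_sep pi G -> N <| G -> Ipi pi G zeta -> Ipi pi N ('Res[N] zeta) ->
  Ipi_mul_bij pi N zeta.
Proof.
have [n] := ubnP #|G|; elim: n G zeta => // n IHn G zeta /ltnSE leGn sepG nsNG Iz Ixi.
have [eqNG | neNG] := eqVneq N G; first by subst N; apply: Ipi_mul_base.
have [|K [nsKG sNK ltKG piGK]] := sepG G N G (subxx _) nsNG (normal_refl _).
  by rewrite properEneq normal_sub // andbT; apply: contraNneq neNG => NG; apply/eqP/group_inj.
have sKG := normal_sub nsKG.
have bijK : Ipi_mul_bij pi N ('Res[K] zeta).
  have resK : 'Res[N] ('Res[K] zeta) = 'Res[N] zeta by rewrite cfResRes.
  apply: IHn; rewrite ?resK //.
  - exact: leq_trans (proper_card ltKG) leGn.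
  - exact: pi_sepS sepG.
  - exact: normalS nsNG.
  have PK := pcharRes sKG (Ipi_pchar Iz).
  (* A splitting of [zeta] on [K] would restrict to one of the irreducible [zeta] on [N], and
     restriction kills no nonzero partial character. *)
  apply: Ipi_intro => // [|a b Pa Pb Dz].
    by rewrite -(pchar1_eq0 PK) cfRes1 (pchar1_eq0 (Ipi_pchar Iz)) (Ipi_neq0 Iz).
  have res0 (f : 'CF(K)) : pchar pi f -> 'Res[N] f = 0 -> f = 0.
    by move=> Pf f0; apply/eqP; rewrite -(pchar1_eq0 Pf) -(cfRes1 N) f0 cfunE.
  have := Ipi_split Ixi (pcharRes sNK Pa) (pcharRes sNK Pb).
  by rewrite -resK Dz raddfD => -[] // /res0 ->; auto.
split.
- exact: (Ipi_mul_step_Ipi sepG nsNG nsKG sNK piGK Iz bijK).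
- exact: (Ipi_mul_step_inj sepG nsNG nsKG sNK piGK Iz bijK).
- exact: (Ipi_mul_step_surj sepG nsNG nsKG sNK piGK Iz bijK).
Qed.

(** Linear independence makes the existentially quantified coefficients unique, so they are the
    multiplicities. *)
Lemma Ipi_constt_mult (gT : finGroupType) (pi : nat_pred) (G : {group gT}) (eta f : 'CF(G)) :
    fong pi G -> Ipi pi G eta ->
  Ipi_constt pi eta f <-> f \in 'CF(G, pi_elements pi G) /\ mult pi eta f != 0.
Proof.
move=> fongG Ieta.
have sumE (c : 'CF(G) -> algC) :
    (\sum_(theta \in Ipi pi G) c theta *: theta)%R = \sum_(theta <- Ipis pi G) c theta *: theta.
  have -> : Ipi pi G = [set` Ipis pi G]%classic.
    by apply/seteqP; split=> theta /=; rewrite -?(rwP (IpisP _ _)).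
  by rewrite -fsbig_seq ?Ipis_uniq.
split=> [[_ [c Df nz_c]] | [f_on nz_f]]; last first.
  by split=> //; exists (fun theta => mult pi theta f); rewrite // sumE -Ipis_sum_mult.
have Dmult : mult pi eta f = c eta.
  rewrite Df sumE mult_sum (bigD1_seq eta) ?Ipis_uniq //=; last exact/IpisP.
  rewrite multZ mult_Ipi // eqxx mulr1 big_seq_cond big1 ?addr0 // => theta /andP[/IpisP It ne_t].
  by rewrite multZ mult_Ipi // (negPf ne_t) mulr0.
rewrite Dmult; split=> //; rewrite Df sumE big_seq rpred_sum // => theta /IpisP It.
by rewrite memvZ // (pchar_on (Ipi_pchar It)).
Qed.

Theorem theorem3 (gT : finGroupType) (pi : nat_pred) (G N : {group gT})
    (sepG : pi_separable pi G) (nsNG : N <| G)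
    (zeta : 'CF(G)) (xi : 'CF(N))
    (Izeta : Ipi pi G zeta) (def_xi : xi = 'Res[N] zeta) (Ixi : Ipi pi N xi) :
  set_bij (Ipi pi (G / N)%G) (Ipi_over pi G xi)
    (fun kappa : 'CF(G / N) => (kappa %% N)%CF * zeta).
Proof.
have sepG' := pi_separable_sep sepG; have sNG := normal_sub nsNG.
have fongN : fong pi N by apply/fong_pi_sep/pi_sepS/sepG'.
rewrite def_xi in Ixi *.
have [mI m_inj m_surj] := Ipi_mul_bij_pi_sep sepG' nsNG Izeta Ixi.
split.
- move=> kappa Ik; split; first exact: mI.
  have Pk := Ipi_pchar Ik; apply/Ipi_constt_mult => //; split.
    exact/pchar_on/pcharRes/Ipi_pchar/mI.
  (* On [N] the inflated [kappa] is the constant [kappa 1%g], which is then the multiplicity of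
     [xi]. *)
  have -> : 'Res[N] ((kappa %% N)%CF * zeta) = kappa 1%g *: 'Res[N] zeta.
    apply/cfun_inP=> x Nx; rewrite rmorphM /= !cfunE !cfResE // cfModE ?(subsetP sNG) //.
    by rewrite coset_id.
  by rewrite multZ mult_Ipi // eqxx mulr1 (pchar1_eq0 Pk) (Ipi_neq0 Ik).
- by move=> kappa kappa' /set_mem Ik /set_mem Ik'; apply: m_inj.
move=> phi [Iphi /(Ipi_constt_mult _ fongN Ixi)[_ nz]].
by have [kappa Ik ->] := m_surj phi Iphi nz; exists kappa.
Qed.
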